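(* Let $D\subset\mathbb{C}^2$ be a convex tube domain such that $\overline{W_D}=\mathbb{R}\times(-\infty,0]$. Take a map $\varphi\in\mathcal{M}^2$ with boundary measure $\mu$ and consider the decomposition $$\mu = g\,d\mathcal{L}^{\mathbb{T}}+\varrho\,d\nu,$$ where $g=(g_1,g_2):\mathbb{T}\to\mathbb{R}^2$ and $\varrho:\mathbb{T}\to\partial\mathbb{B}_2$ are Borel-measurable maps, $g_1,g_2\in L^1(\mathbb{T},\mathcal{L}^{\mathbb{T}})$, and $\nu$ is a positive, finite Borel measure on $\mathbb{T}$ singular to $\mathcal{L}^{\mathbb{T}}$. Then $\varphi(\mathbb{D})\subset D$ and $\varphi$ is a complex geodesic for $D$ if and only if there exists a map $h=(h_1,h_2)\in\mathcal{H}^2$, $h\not\equiv 0$, such that the following conditions hold: (i) $h_2\in-\mathcal{H}_+^1$, (ii) $g(\lambda)\in P_D(\bar\lambda h(\lambda))$ for $\mathcal{L}^{\mathbb{T}}$-a.e. $\lambda\in\mathbb{T}$, (iii) $\varrho(\lambda)=e_2$ for $\nu$-a.e. $\lambda\in\mathbb{T}$, (iv) $\mathrm{Re}\,\varphi(0)\in\mathrm{Re}\,D$, (v) if $h_2\not\equiv 0$, then $\nu=\alpha\delta_{\lambda_0}$ for some $\alpha\in[0,\infty)$ and $\lambda_0\in\mathbb{T}$ such that $\alpha h_2(\lambda_0)=0$.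
   Context: $\mathbb{D}$ and $\mathbb{T}$ are the unit disc and the unit circle in $\mathbb{C}$; $\mathcal{L}^{\mathbb{T}}$ is the Lebesgue (arc length) measure on $\mathbb{T}$, of total mass $2\pi$; $\delta_{\lambda_0}$ is the Dirac delta at $\lambda_0\in\mathbb{T}$. $\langle\cdot,\cdot\rangle$ is the standard inner product on $\mathbb{R}^n$, $\mathbb{B}_n$ the open Euclidean unit ball in $\mathbb{R}^n$, $\partial\mathbb{B}_n$ the unit sphere, $e_2=(0,1)\in\mathbb{R}^2$. $\mathcal{O}(X,Y)$ denotes the holomorphic maps from $X$ to $Y$. A tube domain in $\mathbb{C}^n$ is a set $D=\Omega+i\mathbb{R}^n$ with $\Omega\subset\mathbb{R}^n$ a (non-empty) domain; $\Omega$ is called the base of $D$ and denoted $\mathrm{Re}\,D$. A holomorphic map $\varphi:\mathbb{D}\to D$ into a convex domain $D\subset\mathbb{C}^n$ is a complex geodesic for $D$ if there exists a holomorphic $f:D\to\mathbb{D}$ with $f\circ\varphi=\mathrm{id}_{\mathbb{D}}$. A real Borel measure is a finite signed Borel measure. The boundary measure of $\varphi\in\mathcal{O}(\mathbb{D},\mathbb{C}^n)$, if it exists, is the unique $n$-tuple $\mu=(\mu_1,\ldots,\mu_n)$ of real Borel measures on $\mathbb{T}$ such that $\varphi(\lambda)=\frac{1}{2\pi}\int_{\mathbb{T}}\frac{\zeta+\lambda}{\zeta-\lambda}\,d\mu(\zeta)+i\,\mathrm{Im}\,\varphi(0)$ for all $\lambda\in\mathbb{D}$ (componentwise). $\mathcal{M}^n$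 is the set of $\varphi\in\mathcal{O}(\mathbb{D},\mathbb{C}^n)$ admitting a boundary measure. Every $n$-tuple $\mu$ of real Borel measures on $\mathbb{T}$ has a decomposition $\mu=g\,d\mathcal{L}^{\mathbb{T}}+\varrho\,d\nu$ of the form described in the claim (with $n$ in place of $2$), with $\nu$ unique, $\varrho$ unique up to a $\nu$-null set, and $g$ unique up to an $\mathcal{L}^{\mathbb{T}}$-null set. $\mathcal{H}^n:=\{h\in\mathcal{O}(\mathbb{C},\mathbb{C}^n):\bar\lambda h(\lambda)\in\mathbb{R}^n\ \forall\lambda\in\mathbb{T}\}$ and $\mathcal{H}_+^n:=\{h\in\mathcal{O}(\mathbb{C},\mathbb{C}^n):\bar\lambda h(\lambda)\in[0,\infty)^n\ \forall\lambda\in\mathbb{T}\}$; $-\mathcal{H}_+^1=\{-h:h\in\mathcal{H}_+^1\}$. For a convex tube domain $D\subset\mathbb{C}^n$ and $v\in\mathbb{R}^n$: $W_D:=\{v\in\mathbb{R}^n:\sup_{x\in\mathrm{Re}\,D}\langle x,v\rangle<\infty\}$, $P_D(v):=\{p\in\overline{\mathrm{Re}\,D}:\langle x-p,v\rangle<0\text{ for all }x\in\mathrm{Re}\,D\}$. *)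

(* Defs.v *)
(* MathComp-Analysis over an arbitrary R : realType, with C = R[i].           *)
(* R[i]^o is R[i] seen as a normed module over itself; C^n is 'rV[R[i]]_n and *)
(* R^n is 'rV[R]_n.  Pitfalls:                                                *)
(* - in the order of R[i], 0 <= z means that z is real and nonnegative;       *)
(* - `|x| on 'rV[R]_n is the max norm, hence the explicit inner product [dot];*)
(* - maps defined on a subset are total functions whose values outside of     *)
(*   that subset are irrelevant.                                              *)
From HB Require Import structures.
From mathcomp Require Import all_boot all_order all_algebra.
From mathcomp Require Import all_classical all_reals all_analysis.
From mathcomp Require Import measurable_realfun complex.

Set Implicit Arguments.
Unset Strict Implicit.
Unset Printing Implicit Defensive.
Import Order.TTheory GRing.Theory Num.Theory.
Import numFieldNormedType.Exports.

Local Open Scope classical_set_scope.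
Local Open Scope ring_scope.
Local Open Scope complex_scope.

Notation borelType T := (g_sigma_algebraType (@open T)).

Definition disc (R : realType) : set R[i]^o := [set z | `|z| < 1].
Arguments disc R : clear implicits.

Definition circle (R : realType) : Type := [set z : R[i]^o | `|z| = 1].

HB.instance Definition _ (R : realType) := Topological.copy (circle R)
  (set_type [set z : R[i]^o | `|z| = 1]).

Definition circle_val (R : realType) (z : circle R) : R[i] := \val z.

Lemma norm_cis (R : realType) (t : R) :
  [set z : R[i]^o | `|z| = 1] (cos t +i* sin t).
Proof. by rewrite /= normc_def /= cos2Dsin2 sqrtr1. Qed.

Definition circle_of_angle (R : realType) (t : R) : circle R :=
  exist _ (cos t +i* sin t) (mem_set (norm_cis t)).

HB.instance Definition _ (R : realType) :=
  isPointed.Build (circle R) (circle_of_angle 0).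

Lemma cis_continuous (R : realType) :
  continuous (fun t : R => (cos t +i* sin t : R[i]^o)).
Proof.
move=> t; apply/cvgrPdist_lt => e e0.
have eE : e = (complex.Re e)%:C by rewrite RRe_real // gtr0_real.
have r0 : 0 < complex.Re e by rewrite eE ltcR in e0.
have r2 : 0 < complex.Re e / 2 by rewrite divr_gt0.
have /cvgrPdist_lt/(_ _ r2) Hc := @continuous_cos R t.
have /cvgrPdist_lt/(_ _ r2) Hs := @continuous_sin R t.
near=> s.
rewrite [ltLHS](_ : _ =
  `|(cos t - cos s)%:C + 'i%C * (sin t - sin s)%:C|); last first.
  by congr `| _ |; rewrite [LHS]complexE /=.
apply: (le_lt_trans (ler_normD _ _)).
rewrite normrM !normc_def /= !expr0n /= !addr0 !add0r expr1n sqrtr1 mul1r.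
rewrite !sqrtr_sqr eE -rmorphD /= ltcR [ltRHS](splitr (complex.Re e)).
by apply: ltrD; near: s.
Unshelve. all: by end_near. Qed.

Lemma circle_of_angle_measurable (R : realType) :
  measurable_fun [set: measurableTypeR R]
    (@circle_of_angle R : measurableTypeR R -> borelType (circle R)).
Proof.
apply: (@measurability _ _ _ (borelType (circle R)) _ _ open) => //.
move=> _ [U [W oW <-] <-]; rewrite setTI; apply: open_measurable.
by have /continuousP := @cis_continuous R; apply.
Qed.

(* Image under t |-> e^(it) of the Lebesgue measure on [0, 2 pi[.             *)
Definition arc_length (R : realType) : set (borelType (circle R)) -> \bar R :=
  pushforward
    (mrestr (@lebesgue_measure R) (measurable_itv `[(0 : R), 2 * pi[))
    (@circle_of_angle R : measurableTypeR R -> borelType (circle R)).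
Arguments arc_length R : clear implicits.

HB.instance Definition _ (R : realType) := Measure.copy (arc_length R)
  (measure_function_pushforward__canonical__measure_function_Measure
    (mrestr (@lebesgue_measure R) (measurable_itv `[(0 : R), 2 * pi[))
    (@circle_of_angle_measurable R)).

(* Integral against a real Borel measure, through its Jordan decomposition    *)
(* (independent of the chosen Hahn decomposition).                            *)
Definition charge_Rintegral d (T : measurableType d) (R : realType)
    (nu : {charge set T -> \bar R}) (f : T -> R) : R :=
  let: exist P exN := cid (Hahn_decomposition nu) in
  let: exist N nuPN := cid exN in
  \int[jordan_pos nuPN]_x f x - \int[jordan_neg nuPN]_x f x.

Definition charge_Cintegral d (T : measurableType d) (R : realType)
    (nu : {charge set T -> \bar R}) (f : T -> R[i]) : R[i] :=
  charge_Rintegral nu (fun x => complex.Re (f x))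
  +i* charge_Rintegral nu (fun x => complex.Im (f x)).

Definition mutually_singular d (T : measurableType d) (R : realType)
    (mu nu : {measure set T -> \bar R}) : Prop :=
  exists N, [/\ measurable N, mu N = 0%E & nu (~` N) = 0%E].

Definition dot (R : realType) n (x y : 'rV[R]_n) : R :=
  \sum_(j < n) x 0 j * y 0 j.

Definition sphere (R : realType) n : set 'rV[R]_n :=
  [set x | Num.sqrt (dot x x) = 1].
Arguments sphere R n : clear implicits.

Definition e2 (R : realType) : 'rV[R]_2 := delta_mx 0 1.
Arguments e2 R : clear implicits.

Definition Re_vec (R : realType) n (z : 'rV[R[i]]_n) : 'rV[R]_n :=
  map_mx (@complex.Re R) z.

Definition is_tube_domain (R : realType) n (D : set 'rV[R[i]]_n) : Prop :=
  exists Omega : set 'rV[R]_n,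
    [/\ Omega !=set0, open Omega, connected Omega
      & D = [set z | Omega (Re_vec z)]].

Definition ReD (R : realType) n (D : set 'rV[R[i]]_n) : set 'rV[R]_n :=
  @Re_vec R n @` D.

(* [convex_set] is taken over the scalars R[i]; as 0 <= t <= 1 in R[i] forces *)
(* t to be real, this is the usual convexity.                                 *)
Definition is_convex_tube_domain (R : realType) n
    (D : set 'rV[R[i]]_n) : Prop :=
  is_tube_domain D /\ convex_set (D : set (convex_lmodType 'rV[R[i]]_n)).

Definition W_ (R : realType) n (D : set 'rV[R[i]]_n) : set 'rV[R]_n :=
  [set v | (ereal_sup [set (dot x v)%:E | x in ReD D] < +oo)%E].

Definition P_ (R : realType) n (D : set 'rV[R[i]]_n) (v : 'rV[R]_n) :
    set 'rV[R]_n :=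
  [set p | closure (ReD D) p /\ forall x, ReD D x -> dot (x - p) v < 0].

(* O(X, Y), for X open.  Scalars are complex, so that [differentiable] is     *)
(* complex (Frechet) differentiability.                                       *)
Definition holomorphic_map (R : realType) (V W : normedModType R[i])
    (X : set V) (Y : set W) : set (V -> W) :=
  [set f | (forall x, X x -> Y (f x)) /\ forall x, X x -> differentiable f x].

Definition complex_geodesic (R : realType) n (D : set 'rV[R[i]]_n)
    (phi : R[i]^o -> 'rV[R[i]]_n) : Prop :=
  holomorphic_map (disc R) D phi /\
  exists2 f : 'rV[R[i]]_n -> R[i]^o, holomorphic_map D (disc R) f
    & forall l, disc R l -> f (phi l) = l.

Definition boundary_measure (R : realType) n (phi : R[i]^o -> 'rV[R[i]]_n)
    (mu : 'I_n -> {charge set (borelType (circle R)) -> \bar R}) : Prop :=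
  forall l, disc R l -> forall j,
    phi l 0 j =
      ((2 * pi)^-1)%:C *
        charge_Cintegral (mu j)
          (fun z => (circle_val z + l) / (circle_val z - l))
      + 'i * (complex.Im (phi 0 0 j))%:C.

Definition M_ (R : realType) n : set (R[i]^o -> 'rV[R[i]]_n) :=
  [set phi : R[i]^o -> 'rV[R[i]]_n | holomorphic_map (disc R) setT phi /\
             exists mu, boundary_measure phi mu].
Arguments M_ R n : clear implicits.

Definition H_ (R : realType) n : set (R[i]^o -> 'rV[R[i]]_n) :=
  [set h : R[i]^o -> 'rV[R[i]]_n | holomorphic_map setT setT h /\
    forall l : circle R, forall j,
      (circle_val l)^* * h (circle_val l) 0 j \is Num.real].
Arguments H_ R n : clear implicits.

Definition Hplus (R : realType) n : set (R[i]^o -> 'rV[R[i]]_n) :=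
  [set h : R[i]^o -> 'rV[R[i]]_n | holomorphic_map setT setT h /\
    forall l : circle R, forall j,
      0 <= (circle_val l)^* * h (circle_val l) 0 j].
Arguments Hplus R n : clear implicits.

(* The vector conj(l) * h(l), which is real when h belongs to [H_ R n].       *)
Definition conj_mul (R : realType) n (h : R[i]^o -> 'rV[R[i]]_n)
    (l : circle R) : 'rV[R]_n :=
  Re_vec ((circle_val l)^* *: h (circle_val l)).

Definition component (R : realType) n (h : R[i]^o -> 'rV[R[i]]_n) (j : 'I_n) :
  R[i]^o -> 'rV[R[i]]_1 := fun z => col j (h z).

(* Main.v *)
(* Put k = conj(zeta) h on the circle. An element of H^n has quadratic
   components conj(a) + b l + a l^2, so that k = b + 2 Re(a zeta), and
   [h(l) - l k(zeta)] (zeta + l)/(zeta - l) = conj(a) - a l^2 - 2 i l Im(a zeta).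
   Hence, up to an explicit term c - conj(c) l^2 + i t l, the function
   h . (phi - z) is l times the Schwarz integral of k . (mu - Re z dL).

   Necessity: for a left inverse f, the maps f((1 - s) phi + s w), w in D, send
   the disc to itself, and differentiating at s = 0 gives
   Re(conj(l) H(l) . (w - phi(l))) <= (1 - |l|^2) Re(conj(l) H(0) . (w - phi(0)))
   with H = f'(phi). Translating w by i R^n turns this into an equality for the
   imaginary parts, which forces H to be quadratic, and what is left says that
   the Poisson integrals of k . (mu - Re w dL) are nonnegative. The conditions
   follow by letting w vary.

   Sufficiency: for z in D the measure k . (mu - Re z dL) is positive, and
   f(z) is the zero of h . (phi - z). The zero is unique because dividing by
   (l - tau)(1 - conj(tau) l) leaves a function of positive real part. It exists
   after adding s l with s > 0, and Harnack's inequality along the segment from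
   phi(0) to z keeps it away from the circle as s tends to 0. *)
Require Import Defs.
From HB Require Import structures.
From mathcomp Require Import all_boot all_order all_algebra.
From mathcomp Require Import all_classical all_reals all_analysis.
From mathcomp Require Import measurable_realfun complex ring lra.

Set Implicit Arguments.
Unset Strict Implicit.
Unset Printing Implicit Defensive.
Import Order.TTheory GRing.Theory Num.Theory.
Import numFieldNormedType.Exports.

Local Open Scope classical_set_scope.
Local Open Scope ring_scope.
Local Open Scope complex_scope.

(** Measures enter only as linear functionals on bounded Borel functions, so that mu, its two parts
    and k . mu obey one calculus.

    Letting w vary meets an obstacle: the null set depends on w, so only the countably many rational
    points of Re D can be used at once. The strict inequality in P_D is then recovered because Re D
    is open and k vanishes at no more than two points of the circle.

    The hypothesis on W_D acts in three ways. Its closure contains e_1, - e_1 and - e_2, and <rho,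
    v> <= 0 for these v forces rho = e_2. Next, k lies in W_D almost everywhere, so k_2 <= 0, that
    is b_2 + 2 |a_2| <= 0. Unless h_2 = 0 this leaves at most one zero of k_2 on the circle, and
    positivity of the singular part of k . mu puts nu on that zero, which is (v). Conversely, every
    v in W_D has v_2 <= 0, so a singular part directed along e_2 can only lower <Re phi, v>, and phi
    stays in D. *)

Section ComplexModulus.
Variable R : realType.
Implicit Types (z w : R[i]) (a b e : R).

(** The norm of [R[i]] has values in [R[i]]; this copy with values in [R] lets estimates use the
    total order of the reals and [lra]. *)
Definition cabs z : R := complex.Re `|z|.

Lemma cabsE z : (cabs z)%:C = `|z|.
Proof. by rewrite RRe_real. Qed.

Lemma cabs_def z : cabs z = Num.sqrt (complex.Re z ^+ 2 + complex.Im z ^+ 2).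
Proof. by rewrite /cabs normc_def. Qed.

Lemma cabs_ge0 z : 0 <= cabs z.
Proof. by rewrite -lecR cabsE; exact: normr_ge0. Qed.

Lemma cabs_lt z a : (cabs z < a) = (`|z| < a%:C).
Proof. by rewrite -ltcR cabsE. Qed.

Lemma cabsM z w : cabs (z * w) = cabs z * cabs w.
Proof. by apply: complexI; rewrite rmorphM /= !cabsE normrM. Qed.

Lemma cabsD z w : cabs (z + w) <= cabs z + cabs w.
Proof. by rewrite -lecR rmorphD /= !cabsE ler_normD. Qed.

Lemma cabsN z : cabs (- z) = cabs z.
Proof. by rewrite /cabs normrN. Qed.

Lemma cabsC z w : cabs (z - w) = cabs (w - z).
Proof. by rewrite -cabsN opprB. Qed.

Lemma cabsB z w : cabs (z - w) <= cabs z + cabs w.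
Proof. by rewrite -(cabsN w) cabsD. Qed.

Lemma cabs0 : cabs 0 = 0.
Proof. by rewrite /cabs normr0. Qed.

Lemma cabs1 : cabs 1 = 1.
Proof. by rewrite /cabs normr1. Qed.

Lemma cabs_eq0 z : (cabs z == 0) = (z == 0).
Proof. by rewrite -(inj_eq (@complexI R)) cabsE /= normr_eq0. Qed.

Lemma cabs_gt0 z : (0 < cabs z) = (z != 0).
Proof. by rewrite lt_def cabs_ge0 cabs_eq0 andbT. Qed.

Lemma cabsV z : cabs z^-1 = (cabs z)^-1.
Proof. by apply: complexI; rewrite fmorphV /= !cabsE normfV. Qed.

Lemma cabsX z n : cabs (z ^+ n) = cabs z ^+ n.
Proof. by apply: complexI; rewrite rmorphXn /= !cabsE normrX. Qed.

Lemma cabsJ z : cabs z^*%C = cabs z.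
Proof. by rewrite /cabs normcJ. Qed.

Lemma cabs_sqr z : cabs z ^+ 2 = complex.Re z ^+ 2 + complex.Im z ^+ 2.
Proof. by rewrite cabs_def sqr_sqrtr // addr_ge0 ?sqr_ge0. Qed.

Lemma mulcJ z : z * z^*%C = (cabs z ^+ 2)%:C.
Proof. by rewrite rmorphXn /= cabsE sqr_normc. Qed.

Lemma cabs_real a : cabs a%:C = `|a|.
Proof. by rewrite cabs_def /= expr0n addr0 sqrtr_sqr. Qed.

Lemma Re_le_cabs z : `|complex.Re z| <= cabs z.
Proof. by rewrite cabs_def -sqrtr_sqr ler_wsqrtr // lerDl sqr_ge0. Qed.

Lemma Im_le_cabs z : `|complex.Im z| <= cabs z.
Proof. by rewrite cabs_def -sqrtr_sqr ler_wsqrtr // lerDr sqr_ge0. Qed.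

Lemma Re_ge_Ncabs z : - cabs z <= complex.Re z.
Proof. by have := Re_le_cabs z; rewrite ler_norml => /andP[]. Qed.

Lemma Re_leC z : complex.Re z <= cabs z.
Proof. by have := Re_le_cabs z; rewrite ler_norml => /andP[]. Qed.

Lemma cabs_i : cabs 'i = 1.
Proof. by rewrite cabs_def /= expr0n expr1n add0r sqrtr1. Qed.

Lemma cabs_le_ReIm z : cabs z <= `|complex.Re z| + `|complex.Im z|.
Proof.
rewrite {1}[z]complexE (le_trans (cabsD _ _)) // cabsM cabs_i mul1r.
by rewrite !cabs_real.
Qed.

Lemma cabs_cis t : cabs (cos t +i* sin t) = 1.
Proof. by rewrite cabs_def /= cos2Dsin2 sqrtr1. Qed.

Lemma Re_add z w : complex.Re (z + w) = complex.Re z + complex.Re w.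
Proof. by case: z; case: w. Qed.
Lemma Im_add z w : complex.Im (z + w) = complex.Im z + complex.Im w.
Proof. by case: z; case: w. Qed.
Lemma Re_opp z : complex.Re (- z) = - complex.Re z.
Proof. by case: z. Qed.
Lemma Im_opp z : complex.Im (- z) = - complex.Im z.
Proof. by case: z. Qed.
Lemma Re_mul z w : complex.Re (z * w) =
  complex.Re z * complex.Re w - complex.Im z * complex.Im w.
Proof. by case: z; case: w. Qed.
Lemma Im_mul z w : complex.Im (z * w) =
  complex.Re z * complex.Im w + complex.Im z * complex.Re w.
Proof. by case: z; case: w. Qed.
Lemma Re_conjc z : complex.Re z^*%C = complex.Re z.
Proof. by case: z. Qed.
Lemma Im_conjc z : complex.Im z^*%C = - complex.Im z.
Proof. by case: z. Qed.
Lemma Re_RC a : complex.Re a%:C = a. Proof. by []. Qed.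
Lemma Im_RC a : complex.Im a%:C = 0. Proof. by []. Qed.
Lemma Re_RCmul a z : complex.Re (a%:C * z) = a * complex.Re z.
Proof. by rewrite Re_mul Re_RC Im_RC mul0r subr0. Qed.
Lemma Im_RCmul a z : complex.Im (a%:C * z) = a * complex.Im z.
Proof. by rewrite Im_mul Re_RC Im_RC mul0r addr0. Qed.
Lemma complexP z w : complex.Re z = complex.Re w ->
  complex.Im z = complex.Im w -> z = w.
Proof. by case: z; case: w => a b c d /= -> ->. Qed.

Lemma conjcM z w : (z * w)^*%C = z^*%C * w^*%C.
Proof. by case: z; case: w => a b c d; congr Complex; ring. Qed.
Lemma conjcD z w : (z + w)^*%C = z^*%C + w^*%C.
Proof. by case: z; case: w => a b c d; congr Complex; ring. Qed.
Lemma conjcN z : (- z)^*%C = - z^*%C.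
Proof. by case: z. Qed.
Lemma conjcB z w : (z - w)^*%C = z^*%C - w^*%C.
Proof. by rewrite conjcD conjcN. Qed.

End ComplexModulus.
Arguments cabs {R}.
Notation ReImE := (Re_add, Im_add, Re_opp, Im_opp, Re_mul, Im_mul, Re_conjc, Im_conjc, Re_RC, Im_RC).

Section ComplexTopology.
Variable R : realType.
Implicit Types (z w : R[i]) (a b e : R).
Notation C := R[i]^o.

Lemma gt0_realE (e : R[i]) : 0 < e -> e = (complex.Re e)%:C /\ 0 < complex.Re e.
Proof.
move=> e0; have eE : e = (complex.Re e)%:C by rewrite RRe_real // gtr0_real.
by split => //; rewrite eE ltcR in e0.
Qed.

Lemma nbhs_cabsP (z : C) (A : set C) :
  nbhs z A <-> exists2 e, 0 < e & forall w, cabs (z - w) < e -> A w.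
Proof.
split=> [/nbhs_ballP[e /= /gt0_realE[eE e0] sub]|[e e0 sub]].
  exists (complex.Re e) => // w zw; apply: sub.
  by rewrite -ball_normE /= eE -cabsE ltcR.
apply/nbhs_ballP; exists e%:C; rewrite /= ?ltcR // => w.
by rewrite -ball_normE /= -cabsE ltcR; exact: sub.
Qed.

Lemma cvg_cabsP (T : Type) (F : set_system T) (FF : Filter F) (f : T -> C) (l : C) :
  f @ F --> l <-> forall e, 0 < e -> \forall x \near F, cabs (l - f x) < e.
Proof.
split=> [/cvgrPdist_lt fl e e0|fl].
  have : (0 : R[i]) < e%:C by rewrite ltcR.
  by move/fl; apply: filterS => x; rewrite -cabsE ltcR.
apply/cvgrPdist_lt => e /gt0_realE[eE e0].
by near=> x; rewrite -cabsE eE ltcR; near: x; exact: fl.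
Unshelve. all: by end_near. Qed.

End ComplexTopology.

(** * Complex differentiability as a first-order expansion *)

Section Differentials.
Variables (R : realType) (V : normedModType R[i]).
Notation C := R[i]^o.

Definition vabs (v : V) : R := complex.Re `|v|.

Lemma vabsE v : (vabs v)%:C = `|v|.
Proof. by rewrite RRe_real. Qed.

Lemma vabs_ge0 v : 0 <= vabs v.
Proof. by rewrite -lecR vabsE; exact: normr_ge0. Qed.

Lemma vabsZ (a : R[i]) v : vabs (a *: v) = cabs a * vabs v.
Proof. by apply: complexI; rewrite rmorphM /= !vabsE cabsE normrZ. Qed.

Lemma vabsD v w : vabs (v + w) <= vabs v + vabs w.
Proof. by rewrite -lecR rmorphD /= !vabsE ler_normD. Qed.

Lemma vabs0 : vabs 0 = 0.
Proof. by rewrite /vabs normr0. Qed.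

Lemma nbhs_vabsP (x : V) (A : set V) :
  nbhs x A <-> exists2 e, 0 < e & forall y, vabs (y - x) < e -> A y.
Proof.
split=> [/nbhs_ballP[e /= /gt0_realE[eE e0] sub]|[e e0 sub]].
  exists (complex.Re e) => // w zw; apply: sub.
  by rewrite -ball_normE /= eE distrC -vabsE ltcR.
apply/nbhs_ballP; exists e%:C; rewrite /= ?ltcR // => w.
by rewrite -ball_normE /= distrC -vabsE ltcR; exact: sub.
Qed.

Definition holomorphic_at (W : normedModType R[i]) (f : V -> W) (x : V) : Prop :=
  differentiable f x.

Definition has_vderiv (f : V -> R[i]) (x : V) (df : V -> R[i]) : Prop :=
  forall e, 0 < e -> exists2 d, 0 < d &
    forall y, vabs (y - x) < d ->
      cabs (f y - f x - df (y - x)) <= e * vabs (y - x).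

Lemma differentiable_vderiv (f : V -> C) x :
  differentiable f x -> has_vderiv f x ('d f x).
Proof.
move=> /diff_locallyP[_ /eqaddoP dfE] e e0.
have := dfE e%:C; rewrite ltcR => /(_ e0) /nbhs_vabsP[d d0 Hd].
exists d => // y yd; have := Hd (y - x); rewrite subr0 => /(_ yd).
by rewrite !fctE /= subrK opprD addrA -cabsE -vabsE -rmorphM /= lecR.
Qed.

(** The general case reduces to this one by subtracting a linear map already known to be
    differentiable, as in [cderiv_differentiable] and [vderiv_differentiable]. *)
Lemma vderiv0_differentiable (f : V -> C) x :
  has_vderiv f x (fun=> 0) -> differentiable f x.
Proof.
move=> fx; have fE : f \o shift x = cst (f x) + (\0 : V -> C) +o_ 0 id.
  apply/eqaddoP => e /gt0_realE[-> e0]; have [d d0 Hd] := fx _ e0.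
  apply/nbhs_vabsP; exists d => // v; rewrite subr0 => vd.
  have := Hd (v + x); rewrite addrK => /(_ vd).
  rewrite !fctE /= subr0 !addr0 => H.
  by rewrite -cabsE -vabsE -rmorphM /= lecR.
have c0 : continuous (\0 : V -> C) by move=> ?; exact: cvg_cst.
apply/diff_locallyP; split; first by rewrite (diff_unique c0 fE).
by rewrite (diff_unique c0 fE).
Qed.

End Differentials.

Section ComplexDerivative.
Variable R : realType.
Implicit Types (f g : R[i] -> R[i]) (z w : R[i]) (e : R).
Notation C := R[i]^o.

Definition has_cderiv f z (A : R[i]) : Prop :=
  forall e, 0 < e -> exists2 d, 0 < d &
    forall w, cabs (w - z) < d ->
      cabs (f w - f z - A * (w - z)) <= e * cabs (w - z).

Lemma differentiable_cderiv (f : C -> C) (z : C) :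
  differentiable f z -> has_cderiv f z ('d f z 1).
Proof.
move=> fz; have H := differentiable_vderiv fz => e e0.
have [d d0 Hd] := H e e0; exists d => // w wd.
have -> : ('d f z 1 : R[i]) * (w - z) = 'd f z (w - z).
  by rewrite -[in RHS](mulr1 (w - z)) -[(w - z) * 1]/((w - z) *: (1 : C)) linearZ /= mulrC.
exact: Hd.
Qed.

Lemma cderiv_differentiable f z (A : R[i]) :
  has_cderiv f z A -> differentiable (f : C -> C) (z : C).
Proof.
move=> fA; pose g : C -> C := fun w => f w - A * w.
have -> : f = (g + (fun w : C => A *: w : C)) :> (C -> C).
  by apply/funext => w; rewrite fctE /g -[A *: w]/(A * w) subrK.
apply: differentiableD; last exact: differentiableZ.
apply: vderiv0_differentiable => e e0; have [d d0 Hd] := fA e e0.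
exists d => // y yd; rewrite subr0 /g.
have -> : f y - A * y - (f z - A * z) = f y - f z - A * (y - z) by ring.
exact: Hd.
Qed.

Lemma has_cderiv_unique f z (A B : R[i]) :
  has_cderiv f z A -> has_cderiv f z B -> A = B.
Proof.
move=> fA fB; apply/eqP; rewrite -subr_eq0 -cabs_eq0 eq_le cabs_ge0 andbT.
apply/ler_addgt0Pr => e e0; rewrite add0r.
have e2 : 0 < e / 2 by rewrite divr_gt0.
have [d d0 Hd] := fA _ e2; have [d' d'0 Hd'] := fB _ e2.
pose t := Num.min d d' / 2; have t0 : 0 < t by rewrite divr_gt0 // lt_min d0.
have [td td'] : t < d /\ t < d'.
  have : t < Num.min d d' by rewrite ltr_pdivrMr // ltr_pMr ?ltr1n // lt_min d0.
  by rewrite lt_min => /andP[].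
have tE : cabs (z + t%:C - z) = t by rewrite addrC addKr cabs_real gtr0_norm.
have := Hd (z + t%:C); have := Hd' (z + t%:C); rewrite tE => /(_ td') h1 /(_ td) h2.
rewrite -(ler_pM2r t0) -{1}tE -cabsM.
have -> : (A - B) * (z + t%:C - z) =
  (f (z + t%:C) - f z - B * (z + t%:C - z)) - (f (z + t%:C) - f z - A * (z + t%:C - z)).
  by ring.
by rewrite (le_trans (cabsB _ _)) // [e]splitr mulrDl lerD.
Qed.

End ComplexDerivative.

Lemma norm_coord_le (K : numFieldType) n (x : 'rV[K]_n) j : `|x 0 j| <= `|x|.
Proof.
have -> : `|x| = mx_norm x by [].
rewrite mx_normE.
pose i0 : 'I_1 * 'I_n := (ord0, j).
have -> : `|x 0 j| = `|x i0.1 i0.2|%:nng%:num by [].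
rewrite num_le.
exact: (le_bigmax _ (fun i : 'I_1 * 'I_n => `|x i.1 i.2|%:nng) i0).
Qed.

Lemma norm_delta_mx_le1 (K : numFieldType) n (j : 'I_n) :
  `|delta_mx 0 j : 'rV[K]_n| <= 1.
Proof.
rewrite [leLHS](_ : _ = mx_norm (delta_mx 0 j : 'rV[K]_n)) // mx_normE.
rewrite [leRHS](_ : _ = 1%:nng%:num) // num_le.
apply/bigmax_leP; split => [|i _]; first by rewrite -num_le /= ler01.
by rewrite -num_le /= mxE; case: (_ && _); rewrite ?normr1 ?normr0 ?ler01.
Qed.

Section VectorDerivative.
Variables (R : realType) (n : nat).
Notation C := R[i]^o.
Implicit Types (x y v : 'rV[R[i]]_n).

Lemma vderiv_differentiable (f : 'rV[R[i]]_n -> C) x (a : 'I_n -> R[i]) :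
  has_vderiv f x (fun v => \sum_j a j * v 0 j) ->
  holomorphic_at f x.
Proof.
move=> fa; pose L : 'rV[R[i]]_n -> C := fun v => \sum_j a j * v 0 j.
pose g : 'rV[R[i]]_n -> C := fun v => f v - L v.
have LB u v : L (u - v) = L u - L v.
  by rewrite /L -sumrB; apply: eq_bigr => j _; rewrite !mxE mulrBr.
have -> : f = g + L by apply/funext => w; rewrite fctE /g subrK.
apply: differentiableD.
  apply: vderiv0_differentiable => e e0; have [d d0 Hd] := fa e e0.
  exists d => // y yd; rewrite subr0 /g.
  have -> : f y - L y - (f x - L x) = f y - f x - L (y - x) by rewrite LB; ring.
  exact: Hd.
have -> : L = \sum_j (fun v : 'rV[R[i]]_n => a j *: (v 0 j : C) : C).
  by apply/funext => v; rewrite /L fct_sumE.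
apply: differentiable_sum => j; apply: differentiableZ.
exact: differentiable_coord.
Qed.

Lemma cabs_coord_le x j : cabs (x 0 j) <= vabs x.
Proof.
by rewrite -lecR cabsE vabsE; exact: norm_coord_le.
Qed.

Lemma vabs_le_sum x : vabs x <= \sum_j cabs (x 0 j).
Proof.
rewrite -lecR vabsE rmorph_sum /=.
rewrite [in leLHS](row_sum_delta x).
apply: le_trans (ler_norm_sum _ _ _) _; apply: ler_sum => j _.
rewrite normrZ -cabsE ler_piMr ?cabsE ?normr_ge0 //.
exact: norm_delta_mx_le1.
Qed.

End VectorDerivative.

(** * Integrals of continuous functions over segments *)

Section SegmentIntegral.
Variable R : realType.
Implicit Types (f g : R -> R) (a b c e m : R).

Definition sint f a b : R := \int[lebesgue_measure]_(x in `[a, b]) f x.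

(** Continuity is two-sided even at the ends of the segment: the integrands below are defined and
    controlled in a neighbourhood of it. *)
Definition cont_on f a b := forall x, a <= x <= b -> {for x, continuous f}.

Lemma cont_onS f a b a' b' : cont_on f a b -> a <= a' -> b' <= b -> cont_on f a' b'.
Proof.
move=> cf aa' b'b x /andP[a'x xb']; apply: cf.
by rewrite (le_trans aa') // (le_trans xb').
Qed.

Lemma cont_on_integrable f a b : cont_on f a b ->
  lebesgue_measure.-integrable `[a, b] (EFin \o f).
Proof.
move=> cf; apply: continuous_compact_integrable; first exact: segment_compact.
by apply: continuous_in_subspaceT => x; rewrite inE /= in_itv /=; exact: cf.
Qed.

Lemma sint_split f a b c : cont_on f a b -> a <= c <= b ->
  sint f a b = sint f a c + sint f c b.
Proof.
move=> cf /andP[ac cb]; apply/eqP; rewrite -[X in _ == X]addrC -subr_eq; apply/eqP.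
rewrite /sint Rintegral_itvB ?bnd_simp //; last exact: cont_on_integrable.
rewrite Rintegral_itv_obnd_cbnd //.
apply: (integrableS _ _ _ (cont_on_integrable cf)) => //.
by apply: subset_itvScc; rewrite bnd_simp ?ac.
Qed.

Lemma sintB f g a b : cont_on f a b -> cont_on g a b ->
  sint (fun x => f x - g x) a b = sint f a b - sint g a b.
Proof. by move=> cf cg; apply: RintegralB => //; exact: cont_on_integrable. Qed.

Lemma sint_cst c a b : a <= b -> sint (fun=> c) a b = c * (b - a).
Proof.
by move=> ab; rewrite /sint Rintegral_cst //= lebesgue_measure_itv /= lte_fin; case: ltP => // ba /=;
  have -> : a = b by [apply/eqP; rewrite eq_le ab ba]; rewrite subrr.
Qed.

Lemma sint_dist f a b c m : a <= b -> cont_on f a b ->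
  (forall x, a <= x <= b -> `|f x - c| <= m) ->
  `|sint f a b - c * (b - a)| <= m * (b - a).
Proof.
move=> ab cf fcm; have cc d : cont_on (fun=> d) a b by move=> x _; exact: cst_continuous.
rewrite -(sint_cst c ab) -sintB //.
have cB : cont_on (fun x => f x - c) a b.
  by move=> x xab; apply: continuousB; [exact: cf|exact: cst_continuous].
apply: le_trans (le_normr_Rintegral _ (cont_on_integrable cB)) _ => //.
rewrite -(sint_cst m ab); apply: le_Rintegral => //.
- by apply: cont_on_integrable => x /cB ?; apply: continuous_comp => //; exact: norm_continuous.
- exact: cont_on_integrable (cc m).
Qed.

End SegmentIntegral.

Lemma near_dist_lt (R : realType) (x e : R) : 0 < e -> \forall y \near x, `|y - x| < e.
Proof.
move=> e0; apply/nbhs_ballP; exists e => //= y.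
by rewrite /ball /= distrC.
Qed.

(** * Goursat's lemma *)
Section Goursat.
Variables (R : realType) (P Q : R -> R -> R) (s1 s2 t1 t2 : R).

(* [al] is the common value of d_s P and d_t Q; no continuity of the derivatives is assumed. *)
Hypothesis PQ : forall s t, s1 <= s <= s2 -> t1 <= t <= t2 ->
  exists al be ga : R, forall e : R, 0 < e -> exists2 d : R, 0 < d &
  forall s' t' : R, `|s' - s| < d -> `|t' - t| < d ->
    `|P s' t' - P s t - al * (s' - s) - be * (t' - t)| <= e * (`|s' - s| + `|t' - t|) /\
    `|Q s' t' - Q s t - ga * (s' - s) - al * (t' - t)| <= e * (`|s' - s| + `|t' - t|).

Lemma goursat_contP s : s1 <= s <= s2 -> cont_on (P s) t1 t2.
Proof.
move=> hs t ht; have [al [be [ga H]]] := PQ hs ht.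
apply/cvgrPdist_lt => e e0; have [d d0 Hd] := H 1 ltr01.
pose m := `|be| + 1; have m0 : 0 < m by rewrite ltr_wpDl.
have : \forall x \near t, `|x - t| < Num.min d (e / m).
  by apply: near_dist_lt; rewrite lt_min d0 divr_gt0.
apply: filterS => x; rewrite lt_min => /andP[xd xe].
have := Hd s x; rewrite subrr normr0 mulr0 !subr0 add0r mul1r => /(_ d0 xd)[Hx _].
rewrite distrC (_ : P s x - P s t = (P s x - P s t - be * (x - t)) + be * (x - t)); last by ring.
apply: le_lt_trans (ler_normD _ _) _; apply: le_lt_trans (lerD Hx (lexx _)) _.
rewrite normrM -{1}[`|x - t|]mul1r -mulrDl addrC -/m mulrC -ltr_pdivlMr //.
Qed.

Let cQs t : t1 <= t <= t2 -> cont_on (Q ^~ t) s1 s2.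
Proof.
move=> ht s hs; have [al [be [ga H]]] := PQ hs ht.
apply/cvgrPdist_lt => e e0; have [d d0 Hd] := H 1 ltr01.
pose m := `|ga| + 1; have m0 : 0 < m by rewrite ltr_wpDl.
have : \forall x \near s, `|x - s| < Num.min d (e / m).
  by apply: near_dist_lt; rewrite lt_min d0 divr_gt0.
apply: filterS => x; rewrite lt_min => /andP[xd xe].
have := Hd x t; rewrite subrr normr0 !mulr0 !subr0 addr0 mul1r => /(_ xd d0)[_ Hx].
rewrite distrC (_ : Q x t - Q s t = (Q x t - Q s t - ga * (x - s)) + ga * (x - s)); last by ring.
apply: le_lt_trans (ler_normD _ _) _; apply: le_lt_trans (lerD Hx (lexx _)) _.
rewrite normrM -{1}[`|x - s|]mul1r -mulrDl addrC -/m mulrC -ltr_pdivlMr //.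
Qed.

Let cPt := goursat_contP.

(** The integral of Q ds + P dt around the rectangle [a, a + u] x [c, c + v]. Opposite sides are
    paired, so that affine functions are integrated exactly in [Jlocal]. *)
Let J a u c v := sint (fun t => P (a + u) t - P a t) c (c + v) -
                 sint (fun s => Q s (c + v) - Q s c) a (a + u).

Let inrect a u c v := [/\ s1 <= a, a + u <= s2, t1 <= c, c + v <= t2 & 0 <= u /\ 0 <= v].

Let JE a u c v : inrect a u c v ->
  J a u c v = sint (P (a + u)) c (c + v) - sint (P a) c (c + v) -
    (sint (Q ^~ (c + v)) a (a + u) - sint (Q ^~ c) a (a + u)).
Proof.
move=> [h1 h2 h3 h4 [u0 v0]]; rewrite /J !sintB //.
- by apply: cont_onS (cQs _) _ _ => //; lra.
- by apply: cont_onS (cQs _) _ _ => //; lra.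
- by apply: cont_onS (cPt _) _ _ => //; lra.
- by apply: cont_onS (cPt _) _ _ => //; lra.
Qed.

(** The integrals over the inner sides of the four quarters cancel. *)
Let Jsplit a u c v : inrect a u c v ->
  J a u c v = J a (u / 2) c (v / 2) + J (a + u / 2) (u / 2) c (v / 2) +
    (J a (u / 2) (c + v / 2) (v / 2) + J (a + u / 2) (u / 2) (c + v / 2) (v / 2)).
Proof.
move=> [h1 h2 h3 h4 [u0 v0]].
rewrite !JE; try by split; [lra|lra|lra|lra|split; lra].
have -> : a + u / 2 + u / 2 = a + u by lra.
have -> : c + v / 2 + v / 2 = c + v by lra.
have sP s : s1 <= s <= s2 -> sint (P s) c (c + v) =
    sint (P s) c (c + v / 2) + sint (P s) (c + v / 2) (c + v).
  move=> hs; apply: sint_split; last by lra.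
  by apply: cont_onS (cPt hs) _ _; lra.
have sQ t : t1 <= t <= t2 -> sint (Q ^~ t) a (a + u) =
    sint (Q ^~ t) a (a + u / 2) + sint (Q ^~ t) (a + u / 2) (a + u).
  move=> ht; apply: sint_split; last by lra.
  by apply: cont_onS (cQs ht) _ _; lra.
rewrite (sP (a + u)) ?(sP a) ?(sQ (c + v)) ?(sQ c); try lra.
Qed.

(** The affine parts of P and of Q contribute al u v each and cancel. What remains is an error e
    times the size of the rectangle, integrated over sides of length u and v. *)
Let Jlocal s t : s1 <= s <= s2 -> t1 <= t <= t2 -> forall e, 0 < e ->
  exists2 d, 0 < d & forall a u c v, inrect a u c v -> a <= s <= a + u ->
    c <= t <= c + v -> u < d -> v < d -> `|J a u c v| <= e * (4 * (u + v) ^+ 2).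
Proof.
move=> hs ht e e0; have [al [be [ga H]]] := PQ hs ht.
have [d d0 Hd] := H e e0; exists d => // a u c v ir has hct ud vd.
have [h1 h2 h3 h4 [u0 v0]] := ir.
have B1 s' t' : a <= s' <= a + u -> c <= t' <= c + v -> `|s' - s| <= u /\ `|t' - t| <= v.
  by move=> ? ?; rewrite !ler_norml; split; lra.
have EP : `|sint (fun x => P (a + u) x - P a x) c (c + v) - (al * u) * (c + v - c)|
    <= (2 * e * (u + v)) * (c + v - c).
  apply: sint_dist; first lra.
    move=> x hx; apply: continuousB; apply: cPt; lra.
  move=> x hx; have [k1 k2] : `|a + u - s| <= u /\ `|x - t| <= v by apply: B1; lra.
  have [k3 k4] : `|a - s| <= u /\ `|x - t| <= v by apply: B1; lra.
  have [+ _] := Hd (a + u) x (le_lt_trans k1 ud) (le_lt_trans k2 vd).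
  have [+ _] := Hd a x (le_lt_trans k3 ud) (le_lt_trans k4 vd) => E1 E2.
  rewrite (_ : _ - _ = (P (a + u) x - P s t - al * (a + u - s) - be * (x - t)) -
    (P a x - P s t - al * (a - s) - be * (x - t))); last by ring.
  apply: le_trans (ler_normB _ _) _; apply: le_trans (lerD E2 E1) _.
  rewrite -mulrDr [2 * e]mulrC -mulrA ler_pM2l //; lra.
have EQ : `|sint (fun x => Q x (c + v) - Q x c) a (a + u) - (al * v) * (a + u - a)|
    <= (2 * e * (u + v)) * (a + u - a).
  apply: sint_dist; first lra.
    move=> x hx; apply: continuousB; [apply: (@cQs (c + v))|apply: (@cQs c)]; lra.
  move=> x hx; have [k1 k2] : `|x - s| <= u /\ `|c + v - t| <= v by apply: B1; lra.
  have [k3 k4] : `|x - s| <= u /\ `|c - t| <= v by apply: B1; lra.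
  have [_] := Hd x (c + v) (le_lt_trans k1 ud) (le_lt_trans k2 vd).
  have [_] := Hd x c (le_lt_trans k3 ud) (le_lt_trans k4 vd) => E1 E2.
  rewrite (_ : _ - _ = (Q x (c + v) - Q s t - ga * (x - s) - al * (c + v - t)) -
    (Q x c - Q s t - ga * (x - s) - al * (c - t))); last by ring.
  apply: le_trans (ler_normB _ _) _; apply: le_trans (lerD E2 E1) _.
  rewrite -mulrDr [2 * e]mulrC -mulrA ler_pM2l //; lra.
set A := sint _ _ _ in EP; set B := sint _ _ _ in EQ.
rewrite (_ : J a u c v = (A - al * u * (c + v - c)) - (B - al * v * (a + u - a))); last first.
  by rewrite /J -/A -/B; ring.
apply: le_trans (ler_normB _ _) _; apply: le_trans (lerD EP EQ) _.
have -> : 2 * e * (u + v) * (c + v - c) + 2 * e * (u + v) * (a + u - a) = e * (2 * (u + v) ^+ 2) by ring.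
by rewrite ler_pM2l //; have := sqr_ge0 (u + v); lra.
Qed.

Let J2 (p : (R * R) * (R * R)) := `|J p.1.1 p.1.2 p.2.1 p.2.2|.
Let ok (p : (R * R) * (R * R)) := inrect p.1.1 p.1.2 p.2.1 p.2.2.

(** The implication stands under the existential, so that [choice] provides a total successor map on
    rectangles. *)
Let step p : exists q, ok p -> [/\ ok q, J2 p <= 4 * J2 q,
  q.1.2 = p.1.2 / 2 /\ q.2.2 = p.2.2 / 2,
  p.1.1 <= q.1.1 /\ q.1.1 + q.1.2 <= p.1.1 + p.1.2 &
  p.2.1 <= q.2.1 /\ q.2.1 + q.2.2 <= p.2.1 + p.2.2].
Proof.
case: p => [[a u] [c v]]; rewrite /ok /J2 /=.
have [okp|] := pselect (inrect a u c v); last by exists ((a, u), (c, v)).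
(* The booleans select the quarter: [(u / 2) *+ i] is 0 or u / 2. *)
have H (i j : bool) : inrect (a + (u / 2) *+ i) (u / 2) (c + (v / 2) *+ j) (v / 2).
  case: okp => h1 h2 h3 h4 [u0 v0].
  by case: i; case: j; rewrite ?mulr0n ?mulr1n; split; try lra; split; lra.
have K (i j : bool) : `|J a u c v| <= 4 * `|J (a + (u / 2) *+ i) (u / 2) (c + (v / 2) *+ j) (v / 2)| ->
  exists q : (R * R) * (R * R), inrect a u c v -> [/\ inrect q.1.1 q.1.2 q.2.1 q.2.2,
   `|J a u c v| <= 4 * `|J q.1.1 q.1.2 q.2.1 q.2.2|,
    q.1.2 = u / 2 /\ q.2.2 = v / 2,
  a <= q.1.1 /\ q.1.1 + q.1.2 <= a + u &
  c <= q.2.1 /\ q.2.1 + q.2.2 <= c + v].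
  move=> le; exists ((a + (u / 2) *+ i, u / 2), (c + (v / 2) *+ j, v / 2)) => /= _.
  have [_ _ _ _ [u0 v0]] := okp; split => //.
    by case: (i); rewrite ?mulr0n ?mulr1n; split; lra.
  by case: (j); rewrite ?mulr0n ?mulr1n; split; lra.
move: (K false false) (K true false) (K false true) (K true true).
have := Jsplit okp; rewrite !mulr0n !mulr1n !addr0.
set W1 := J a (u / 2) c (v / 2); set W2 := J (a + u / 2) (u / 2) c (v / 2).
set W3 := J a (u / 2) (c + v / 2) (v / 2).
set W4 := J (a + u / 2) (u / 2) (c + v / 2) (v / 2).
move=> ->; case: (lerP _ (4 * `|W1|)) => [_ + _ _ _|h1 _]; first exact.
case: (lerP _ (4 * `|W2|)) => [_ + _ _|h2 _]; first exact.
case: (lerP _ (4 * `|W3|)) => [_ + _|h3 _]; first exact.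
case: (lerP _ (4 * `|W4|)) => [_|h4 _]; first exact.
have := ler_normD (W1 + W2) (W3 + W4); have := ler_normD W1 W2; have := ler_normD W3 W4.
move: h1 h2 h3 h4; clear; lra.
Qed.

(** Bisection: some quarter always carries at least a fourth of |J|, and the chosen quarters shrink
    to a point (s, t) at which [Jlocal] applies. *)
Lemma goursat : s1 <= s2 -> t1 <= t2 ->
  sint (fun t => P s2 t - P s1 t) t1 t2 = sint (fun s => Q s t2 - Q s t1) s1 s2.
Proof.
move=> s12 t12; pose p0 := ((s1, s2 - s1), (t1, t2 - t1)).
have ok0 : ok p0 by rewrite /ok /=; split; try lra; split; lra.
suff : J2 p0 = 0.
  by rewrite /J2 /J /= !subrKC => /normr0_eq0/eqP; rewrite subr_eq0 => /eqP.
have [nx nxP] := choice step.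
pose p n := iter n nx p0.
have okp n : ok (p n) by elim: n => //= n /nxP[].
have szp n : (p n).1.2 = (s2 - s1) / 2 ^+ n /\ (p n).2.2 = (t2 - t1) / 2 ^+ n.
  elim: n => [|n [ih1 ih2]]; first by rewrite !expr0 !divr1.
  have [_ _ [-> ->] _ _] := nxP _ (okp n).
  by rewrite -/(p n) ih1 ih2 !exprSr !invfM !mulrA.
have Jp n : J2 p0 <= 4 ^+ n * J2 (p n).
  elim: n => [|n ih]; first by rewrite expr0 mul1r.
  apply: le_trans ih _; rewrite exprSr -mulrA ler_pM2l ?exprn_gt0 //.
  by have [] := nxP _ (okp n).
have nest (f g : nat -> R) : (forall n, f n <= f n.+1) -> (forall n, g n.+1 <= g n) ->
    (forall n, f n <= g n) -> forall m, f m <= sup (range f) <= g m.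
  move=> fi gd fg.
  have fm i k : f i <= f (i + k)%N.
    by elim: k => [|k ih]; rewrite ?addn0 // addnS (le_trans ih).
  have gm i k : g (i + k)%N <= g i.
    by elim: k => [|k ih]; rewrite ?addn0 // addnS (le_trans _ ih).
  have fg' i j : f i <= g j.
    by apply: le_trans (fm i j) _; apply: le_trans (fg _) _; rewrite addnC gm.
  move=> m; apply/andP; split.
    by apply: ub_le_sup; [exists (g 0%N) => _ [i _ <-]|exists m].
  by apply: ge_sup; [exists (f 0%N), 0%N|move=> _ [i _ <-]].
pose s := sup (range (fun n => (p n).1.1)); pose t := sup (range (fun n => (p n).2.1)).
have hs n : (p n).1.1 <= s <= (p n).1.1 + (p n).1.2.
  apply: (nest (fun n => (p n).1.1) (fun n => (p n).1.1 + (p n).1.2)) => k.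
  - by have [_ _ _ [] ] := nxP _ (okp k).
  - by have [_ _ _ [] ] := nxP _ (okp k).
  - by have [_ _ _ _ [u0 _]] := okp k; rewrite lerDl.
have ht n : (p n).2.1 <= t <= (p n).2.1 + (p n).2.2.
  apply: (nest (fun n => (p n).2.1) (fun n => (p n).2.1 + (p n).2.2)) => k.
  - by have [_ _ _ _ [] ] := nxP _ (okp k).
  - by have [_ _ _ _ [] ] := nxP _ (okp k).
  - by have [_ _ _ _ [_ v0]] := okp k; rewrite lerDl.
have hs0 : s1 <= s <= s2 by have := hs 0%N; rewrite /= subrKC.
have ht0 : t1 <= t <= t2 by have := ht 0%N; rewrite /= subrKC.
pose L := (s2 - s1) + (t2 - t1).
apply/eqP; rewrite eq_le normr_ge0 andbT; apply/ler_addgt0Pr => e e0; rewrite add0r.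
(* The factor 4 ^ N lost in N bisections is regained from the square of the size L / 2 ^ N, so |J|
   is at most e' times 4 L ^ 2, hence at most e. *)
pose e' := e / (4 * L ^+ 2 + 1).
have D0 : 0 < 4 * L ^+ 2 + 1 by rewrite ltr_wpDl // mulr_ge0 // sqr_ge0.
have e'0 : 0 < e' by rewrite divr_gt0.
have [d d0 Hd] := Jlocal hs0 ht0 e'0.
have L0 : 0 <= L by rewrite /L; lra.
have [N HN] : exists N, L / 2 ^+ N < d.
  have [N HN] : exists N : nat, L / d < N%:R by exists (Num.bound (L / d)); apply: archi_boundP; rewrite divr_ge0 // ltW.
  exists N; rewrite ltr_pdivrMr ?exprn_gt0 // mulrC -ltr_pdivrMr //.
  by apply: lt_le_trans HN _; rewrite -natrX ler_nat ltnW // ltn_expl.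
have [su sv] := szp N.
have q0 : 0 < 2 ^- N :> R by rewrite invr_gt0 exprn_gt0.
have := Hd _ _ _ _ (okp N) (hs N) (ht N).
have uL : (p N).1.2 <= L / 2 ^+ N by rewrite su ler_pM2r // /L lerDl; lra.
have vL : (p N).2.2 <= L / 2 ^+ N by rewrite sv ler_pM2r // /L lerDr; lra.
move=> /(_ (le_lt_trans uL HN) (le_lt_trans vL HN)); rewrite -/(J2 (p N)) su sv -mulrDl -/L.
move=> H; apply: le_trans (Jp N) _; rewrite -ler_pdivlMl ?exprn_gt0 //.
apply: le_trans H _; rewrite expr_div_n -exprM mulnC exprM (_ : 2 ^+ 2 = 4) //; last by rewrite -natrX.
rewrite [_ * e]mulrC !mulrA ler_pM2r ?invr_gt0 ?exprn_gt0 //.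
have -> : e' * 4 * L * L = e * (4 * L ^+ 2) / (4 * L ^+ 2 + 1) by rewrite /e'; ring.
by rewrite ler_pdivrMr // ler_pM2l // lerDl ler01.
Qed.

End Goursat.

(** * The mean value property in logarithmic polar coordinates *)

Section MeanValue.
Variable R : realType.
Implicit Types (u : R[i] -> R[i]) (z : R[i]) (r s t e : R).
Notation C := R[i]^o.

Lemma is_derive_expand (f : R -> R) (x df : R) : is_derive x 1 f df ->
  forall e, 0 < e -> exists2 d : R, 0 < d &
    forall y : R, `|y - x| < d -> `|f y - f x - df * (y - x)| <= e * `|y - x|.
Proof.
move=> [+ dfE] e e0 => /derivable1_diffP fd.
have /diff_locallyP[_ /eqaddoP/(_ e e0)] := fd.
move=> /nbhs_ballP[d /= d0 Hd]; exists d => // y yd.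
have := Hd (y - x); rewrite /ball /= sub0r normrN => /(_ yd).
rewrite !fctE /= subrK opprD addrA; congr (`|_ - _| <= _).
by rewrite -dfE deriveE // -[in LHS](mulr1 (y - x)) -[(y - x) * 1]/((y - x) *: 1) linearZ /= mulrC.
Qed.

Definition cis t : R[i] := cos t +i* sin t.

Lemma cisD s t : cis (s + t) = cis s * cis t.
Proof. by apply: complexP; rewrite ?Re_mul ?Im_mul /cis /= ?cosD ?sinD //; ring. Qed.

Lemma cabs_cisE t : cabs (cis t) = 1. Proof. exact: cabs_cis. Qed.

(** This is exp(s + i t). It maps a rectangle of height 2 pi onto an annulus, so that circle means
    become integrals over vertical sides. *)
Definition ecis s t : R[i] := (expR s)%:C * cis t.

Lemma ecisD s t h k : ecis (s + h) (t + k) = ecis s t * ecis h k.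
Proof. by rewrite /ecis expRD cisD rmorphM /=; ring. Qed.

Lemma cabs_ecis s t : cabs (ecis s t) = expR s.
Proof. by rewrite cabsM cabs_cisE mulr1 cabs_real gtr0_norm ?expR_gt0. Qed.

Lemma ecis_expand0 e : 0 < e -> exists2 d : R, 0 < d & forall h k : R,
  `|h| < d -> `|k| < d -> cabs (ecis h k - 1 - (h +i* k)) <= e * (`|h| + `|k|).
Proof.
move=> e0; pose e' := Num.min (e / 8) 1.
have e'0 : 0 < e' by rewrite lt_min divr_gt0 //= ltr01.
have e'8 : e' <= e / 8 by rewrite ge_min lexx.
have e'1 : e' <= 1 by rewrite ge_min lexx orbT.
have [d1 d10 H1] := is_derive_expand (is_derive_expR 0) e'0.
have [d2 d20 H2] := is_derive_expand (is_derive_cos 0) e'0.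
have [d3 d30 H3] := is_derive_expand (is_derive_sin 0) e'0.
pose d := Num.min (Num.min d1 d2) (Num.min d3 (e' / 2)).
exists d; first by rewrite !lt_min d10 d20 d30 divr_gt0.
move=> h k; rewrite !lt_min => /andP[/andP[hd1 _] /andP[_ hd4]] /andP[/andP[_ kd2] /andP[kd3 _]].
have := H1 h; have := H2 k; have := H3 k; rewrite !subr0 expR0 cos0 sin0 subr0 oppr0 mul0r !mul1r subr0.
move=> /(_ kd3) A3 /(_ kd2) A2 /(_ hd1) A1.
have B1 : `|expR h - 1| <= e'.
  rewrite (_ : _ - _ = (expR h - 1 - h) + h); last by ring.
  apply: le_trans (ler_normD _ _) _; apply: le_trans (lerD A1 (lexx _)) _.
  have : e' * `|h| <= 1 * `|h| by rewrite ler_wpM2r.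
  by lra.
have B2 : expR h <= 2 by move: B1; rewrite ler_norml; lra.
have B0 := expR_gt0 h.
apply: le_trans (cabs_le_ReIm _) _.
rewrite ?ReImE /ecis ?ReImE /cis /= ?mul0r ?subr0 ?addr0.
rewrite (_ : _ - 1 - h = (expR h - 1 - h) + expR h * (cos k - 1)); last by ring.
rewrite (_ : _ - k = expR h * (sin k - k) + (expR h - 1) * k); last by ring.
have C1 := ler_normD (expR h - 1 - h) (expR h * (cos k - 1)).
have C2 := ler_normD (expR h * (sin k - k)) ((expR h - 1) * k).
apply: le_trans (lerD C1 C2) _; rewrite !normrM (gtr0_norm B0).
have E1 : expR h * `|cos k - 1| <= 2 * (e' * `|k|) by apply: ler_pM => //; exact: ltW.
have E2 : expR h * `|sin k - k| <= 2 * (e' * `|k|) by apply: ler_pM => //; exact: ltW.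
have E3 : `|expR h - 1| * `|k| <= e' * `|k| by apply: ler_wpM2r.
have F1 : e' * `|k| <= e / 8 * `|k| by apply: ler_wpM2r.
have F2 : e' * `|h| <= e / 8 * `|h| by apply: ler_wpM2r.
have G1 : 0 <= e / 8 * `|h| by rewrite mulr_ge0 // ltW // divr_gt0.
have G2 : 0 <= e / 8 * `|k| by rewrite mulr_ge0 // ltW // divr_gt0.
rewrite (_ : e * (`|h| + `|k|) = 8 * (e / 8 * `|h|) + 8 * (e / 8 * `|k|)); last by field.
move: A1 E1 E2 E3 F1 F2 G1 G2; clear; lra.
Qed.

Lemma ecis_expand s t e : 0 < e -> exists2 d : R, 0 < d & forall s' t' : R,
  `|s' - s| < d -> `|t' - t| < d ->
  cabs (ecis s' t' - ecis s t - ecis s t * ((s' - s) +i* (t' - t))) <= e * (`|s' - s| + `|t' - t|).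
Proof.
move=> e0; have es0 := expR_gt0 s.
have [d d0 Hd] := ecis_expand0 (divr_gt0 e0 es0).
exists d => // s' t' sd td; have H := Hd _ _ sd td.
rewrite (_ : ecis s' t' = ecis s t * ecis (s' - s) (t' - t)); last by rewrite -ecisD !subrKC.
rewrite (_ : _ - _ - _ = ecis s t * (ecis (s' - s) (t' - t) - 1 - ((s' - s) +i* (t' - t)))); last by ring.
by rewrite cabsM cabs_ecis mulrC -ler_pdivlMr // mulrAC.
Qed.

Lemma has_cderiv_ecis u s t (A : R[i]) : has_cderiv u (ecis s t) A ->
  forall e, 0 < e -> exists2 d : R, 0 < d & forall s' t' : R, `|s' - s| < d -> `|t' - t| < d ->
  cabs (u (ecis s' t') - u (ecis s t) - A * ecis s t * ((s' - s) +i* (t' - t)))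
    <= e * (`|s' - s| + `|t' - t|).
Proof.
move=> uA e e0; have es0 := expR_gt0 s.
pose m := expR s + 1; have m0 : 0 < m by rewrite addr_gt0.
pose e1 := e / 2 / m; have e10 : 0 < e1 by rewrite !divr_gt0.
pose n := cabs A + 1; have n0 : 0 < n by rewrite ltr_wpDl // cabs_ge0.
pose e2 := Num.min (e / 2 / n) 1; have e20 : 0 < e2 by rewrite lt_min !divr_gt0 //= ltr01.
have [d1 d10 H1] := uA _ e10.
have [d2 d20 H2] := ecis_expand s t e20.
pose d := Num.min d2 (d1 / 2 / m); exists d; first by rewrite lt_min d20 !divr_gt0.
move=> s' t'; rewrite !lt_min => /andP[sd2 sd1] /andP[td2 td1].
have E2 := H2 _ _ sd2 td2; set L := `|s' - s| + `|t' - t| in E2 *.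
have L0 : 0 <= L by rewrite addr_ge0.
have hk : cabs ((s' - s) +i* (t' - t)) <= L by apply: le_trans (cabs_le_ReIm _) _.
have D : cabs (ecis s' t' - ecis s t) <= m * L.
  rewrite (_ : _ - _ = (ecis s' t' - ecis s t - ecis s t * ((s' - s) +i* (t' - t))) + ecis s t * ((s' - s) +i* (t' - t))); last by ring.
  apply: le_trans (cabsD _ _) _; rewrite cabsM cabs_ecis /m mulrDl addrC.
  apply: lerD; first by rewrite ler_wpM2l // ltW.
  by apply: le_trans E2 _; rewrite ler_wpM2r // ge_min lexx orbT.
have Dd : cabs (ecis s' t' - ecis s t) < d1.
  apply: le_lt_trans D _; rewrite mulrC -ltr_pdivlMr // /L.
  by rewrite [ltRHS](_ : _ = d1 / 2 / m + d1 / 2 / m) ?ltrD //; field; rewrite gt_eqF.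
have E1 := H1 _ Dd.
rewrite (_ : _ - _ = (u (ecis s' t') - u (ecis s t) - A * (ecis s' t' - ecis s t)) +
   A * (ecis s' t' - ecis s t - ecis s t * ((s' - s) +i* (t' - t)))); last by ring.
apply: le_trans (cabsD _ _) _; rewrite [e]splitr mulrDl; apply: lerD.
  apply: le_trans E1 _; apply: le_trans (ler_wpM2l (ltW e10) D) _.
  by rewrite mulrA /e1 divfK // gt_eqF.
rewrite cabsM; apply: le_trans (ler_wpM2l (cabs_ge0 _) E2) _.
rewrite mulrA ler_wpM2r //.
apply: (@le_trans _ _ (n * e2)); first by rewrite ler_wpM2r ?(ltW e20) // lerDl ler01.
by rewrite mulrC -ler_pdivlMr // ge_min lexx.
Qed.

Lemma Re_increment (U V B : R[i]) s t : complex.Re (U - V - B * (s +i* t)) =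
  complex.Re U - complex.Re V - complex.Re B * s - (- complex.Im B) * t.
Proof. by case: U V B => [a b] [c d] [e f] /=; ring. Qed.

Lemma Im_increment (U V B : R[i]) s t : complex.Im (U - V - B * (s +i* t)) =
  complex.Im U - complex.Im V - complex.Im B * s - complex.Re B * t.
Proof. by case: U V B => [a b] [c d] [e f] /=; ring. Qed.

Definition hol_on u (A : set R[i]) := forall z : C, A z -> differentiable (u : C -> C) z.

Definition rmeanRe u r : R := sint (fun t => complex.Re (u (r%:C * cis t))) 0 (2 * pi).
(** This is [goursat] for the real and imaginary parts P and Q of u(exp(s + i t)), the
    Cauchy-Riemann equation being d_s P = d_t Q. The horizontal sides cancel since Q takes the same
    values at t = 0 and t = 2 pi. *)
Lemma rmeanRe_annulus u r1 r2 : 0 < r1 -> r1 <= r2 ->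
  hol_on u [set z | r1 <= cabs z <= r2] -> rmeanRe u r1 = rmeanRe u r2.
Proof.
move=> r10 r12 hu; have r20 := lt_le_trans r10 r12.
pose s1 := ln r1; pose s2 := ln r2.
have E1 : expR s1 = r1 by rewrite lnK.
have E2 : expR s2 = r2 by rewrite lnK.
have s12 : s1 <= s2 by rewrite ler_ln.
pose P s t := complex.Re (u (ecis s t)); pose Q s t := complex.Im (u (ecis s t)).
have PQ s t : s1 <= s <= s2 -> 0 <= t <= 2 * pi ->
  exists al be ga : R, forall e : R, 0 < e -> exists2 d : R, 0 < d &
  forall s' t' : R, `|s' - s| < d -> `|t' - t| < d ->
    `|P s' t' - P s t - al * (s' - s) - be * (t' - t)| <= e * (`|s' - s| + `|t' - t|) /\
    `|Q s' t' - Q s t - ga * (s' - s) - al * (t' - t)| <= e * (`|s' - s| + `|t' - t|).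
  move=> /andP[hs1 hs2] _.
  have /differentiable_cderiv uA : differentiable (u : C -> C) (ecis s t : C).
    by apply: hu; rewrite /= cabs_ecis -{1}E1 -E2 !ler_expR hs1.
  set A := ('d _ _ _) in uA; pose B := A * ecis s t.
  exists (complex.Re B), (- complex.Im B), (complex.Im B) => e e0.
  have [d d0 Hd] := has_cderiv_ecis uA e0; exists d => // s' t' sd td.
  have := Hd s' t' sd td; rewrite -/B; move: B {uA Hd} => B H; split; apply: le_trans H.
    by rewrite /P -Re_increment; exact: Re_le_cabs.
  by rewrite /Q -Im_increment; exact: Im_le_cabs.
have tp : 0 <= 2 * pi :> R by rewrite mulr_ge0 // pi_ge0.
have cQ (s : R) : Q s (2 * pi) - Q s 0 = 0.
  by rewrite /Q /ecis /cis mulr_natl cos2pi sin2pi cos0 sin0 subrr.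
have := goursat PQ s12 tp.
rewrite [RHS](_ : _ = 0); last first.
  under [in LHS]eq_fun do rewrite cQ.
  by rewrite sint_cst // mul0r.
rewrite sintB; last 2 first.
- by apply: (goursat_contP PQ); rewrite s12 lexx.
- by apply: (goursat_contP PQ); rewrite s12 lexx.
have -> : rmeanRe u r1 = sint (P s1) 0 (2 * pi) := congr1 (rmeanRe u) (esym E1).
have -> : rmeanRe u r2 = sint (P s2) 0 (2 * pi) := congr1 (rmeanRe u) (esym E2).
by move=> /subr0_eq ->.
Qed.


(** This and the next three lemmas phrase continuity with real epsilon and delta, for each choice of
    R or C as source and target. *)
Lemma cts_CR (f : C -> R) (z : C) :
  (forall e, 0 < e -> exists2 d, 0 < d & forall w, cabs (w - z) < d -> `|f w - f z| < e) <->
  {for z, continuous f}.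
Proof.
have FF : Filter (nbhs z) by exact: nbhs_filter.
split=> [H|/(@cvgrPdist_lt _ _ _ (nbhs z) FF) H e e0].
  apply/(@cvgrPdist_lt _ _ _ (nbhs z) FF) => e /H[d d0 Hd]; apply/nbhs_cabsP.
  by exists d => // w; rewrite cabsC distrC; exact: Hd.
have /nbhs_cabsP[d d0 Hd] := H e e0; exists d => // w; rewrite cabsC distrC; exact: Hd.
Qed.

Lemma cts_CC (f : C -> C) (z : C) :
  (forall e, 0 < e -> exists2 d, 0 < d & forall w, cabs (w - z) < d -> cabs (f w - f z) < e) <->
  {for z, continuous f}.
Proof.
have FF : Filter (nbhs z) by exact: nbhs_filter.
split=> [H|/(@cvg_cabsP _ _ _ FF) H e e0].
  apply/(@cvg_cabsP _ _ _ FF) => e /H[d d0 Hd]; apply/nbhs_cabsP.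
  by exists d => // w; rewrite cabsC [cabs (f z - _)]cabsC; exact: Hd.
have /nbhs_cabsP[d d0 Hd] := H e e0.
by exists d => // w; rewrite cabsC [cabs (f w - _)]cabsC; exact: Hd.
Qed.

Lemma cts_RC (f : R -> C) (z : R) :
  (forall e, 0 < e -> exists2 d, 0 < d & forall w, `|w - z| < d -> cabs (f w - f z) < e) <->
  {for z, continuous f}.
Proof.
split=> [H|/cvg_cabsP H e e0].
  apply/cvg_cabsP => e /H[d d0 Hd]; apply/nbhs_ballP; exists d => //= w.
  by rewrite /ball /= distrC cabsC; exact: Hd.
have /nbhs_ballP[d /= d0 Hd] := H e e0.
by exists d => // w; rewrite cabsC distrC; exact: Hd.
Qed.

Lemma cts_RR (f : R -> R) (z : R) :
  (forall e, 0 < e -> exists2 d : R, 0 < d & forall w, `|w - z| < d -> `|f w - f z| < e) <->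
  {for z, continuous f}.
Proof.
split=> [H|/cvgrPdist_lt H e e0].
  apply/cvgrPdist_lt => e /H[d d0 Hd]; apply/nbhs_ballP; exists d => //= w.
  by rewrite /ball /= distrC [X in X < e]distrC; exact: Hd.
have /nbhs_ballP[d /= d0 Hd] := H e e0.
by exists d => // w; rewrite distrC [X in X < e]distrC; exact: Hd.
Qed.

Lemma cts_comp_CR_RC (g : R -> C) (f : C -> R) (x : R) : {for x, continuous g} ->
  {for g x, continuous f} -> {for x, continuous (fun y => f (g y))}.
Proof.
move=> /cts_RC cg /cts_CR cf; apply/cts_RR => e /cf[d /cg[d' d'0 Hd'] Hd].
by exists d' => // w /Hd' /Hd.
Qed.

Lemma Cof_continuous : continuous (fun p : R * R => (p.1 +i* p.2 : C)).
Proof.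
move=> [a b]; apply/cvg_cabsP => e e0; have e2 : 0 < e / 2 by rewrite divr_gt0.
exists ([set x | `|x - a| < e / 2], [set x | `|x - b| < e / 2]) => /=.
  by split; exact: near_dist_lt.
move=> [c d] /= [ca db]; apply: le_lt_trans (cabs_le_ReIm _) _; rewrite [e]splitr.
by rewrite /= ltrD // distrC.
Qed.

Lemma cabs_lip z w : `|cabs w - cabs z| <= cabs (w - z).
Proof.
have h1 := cabsD (w - z) z; have h2 := cabsD (z - w) w.
by move: h1 h2; rewrite !subrK cabsC ler_norml; lra.
Qed.

Lemma cabs_continuous : continuous (cabs : C -> R).
Proof.
move=> z; apply/cts_CR => e e0; exists e => // w; apply: le_lt_trans; exact: cabs_lip.
Qed.

Lemma disc_compact r : compact ([set z | cabs z <= r] : set C).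
Proof.
apply: (@subclosed_compact _ _ ((fun p : R * R => (p.1 +i* p.2 : C)) @` (`[- r, r] `*` `[- r, r]))).
- apply: (@closed_comp _ _ (cabs : C -> R) [set x | x <= r]); last exact: closed_le.
  by move=> z _; exact: cabs_continuous.
- apply: continuous_compact; first by apply: continuous_subspaceT => p; exact: Cof_continuous.
  by apply: compact_setX; exact: segment_compact.
- move=> [a b] /= zr; exists (a, b) => //=.
  have := le_trans (Re_le_cabs _) zr; have := le_trans (Im_le_cabs _) zr.
  by rewrite /= !in_itv /= -!ler_norml => -> ->.
Qed.

Lemma continuous_bounded_disc u r : 0 <= r ->
  (forall z : C, cabs z <= r -> {for z, continuous (u : C -> C)}) ->
  exists2 M, 0 <= M & forall z, cabs z <= r -> cabs (u z) <= M.
Proof.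
move=> r0 cu.
have [||| c _ Hc] := @compact_EVT_max C R (fun z => cabs (u z)) [set z | cabs z <= r].
- by exists 0; rewrite /= cabs0.
- exact: disc_compact.
- apply: continuous_in_subspaceT => z; rewrite inE /= => zr.
  have /cts_CC cuz := cu z zr; apply/cts_CR => e /cuz[d d0 Hd]; exists d => // w /Hd.
  by apply: le_lt_trans; exact: cabs_lip.
exists (cabs (u c)); first exact: cabs_ge0.
by move=> z zr; apply: Hc; rewrite inE.
Qed.

Lemma cis_cont : continuous (cis : R -> C).
Proof. exact: cis_continuous. Qed.

Lemma scale_cis_continuous r : continuous (fun t => r%:C * cis t : C).
Proof.
move=> t; apply/cts_RC => e e0; pose m := `|r| + 1.
have m0 : 0 < m by rewrite ltr_wpDl.
have /cts_RC/(_ (e / m)) := @cis_cont t; rewrite divr_gt0 // => /(_ isT)[d d0 Hd].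
exists d => // s /Hd; rewrite -mulrBr cabsM cabs_real ltr_pdivlMr // mulrC; apply: le_lt_trans.
by rewrite ler_wpM2r ?cabs_ge0 // lerDl ler01.
Qed.

Lemma cis_scale_continuous t : continuous (fun r : R => r%:C * cis t : C).
Proof.
move=> r; apply/cts_RC => e e0; exists e => // s.
by rewrite -mulrBl cabsM cabs_cisE mulr1 -rmorphB cabs_real.
Qed.

Lemma Re_comp_continuous u (z : C) : {for z, continuous (u : C -> C)} ->
  {for z, continuous (fun z : C => complex.Re (u z))}.
Proof.
move=> /cts_CC cu; apply/cts_CR => e /cu[d d0 Hd]; exists d => // w /Hd.
by apply: le_lt_trans; rewrite -Re_opp -Re_add Re_le_cabs.
Qed.

Lemma polar_continuous_t u r t : {for (r%:C * cis t : C), continuous (u : C -> C)} ->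
  {for t, continuous (fun t => complex.Re (u (r%:C * cis t)))}.
Proof.
move=> /Re_comp_continuous cu; exact: (cts_comp_CR_RC (@scale_cis_continuous r t) cu).
Qed.

Lemma polar_continuous_r u r t : {for (r%:C * cis t : C), continuous (u : C -> C)} ->
  {for r, continuous (fun r => complex.Re (u (r%:C * cis t)))}.
Proof.
move=> /Re_comp_continuous cu; exact: (cts_comp_CR_RC (@cis_scale_continuous t r) cu).
Qed.

Lemma rmeanRe_continuous u p : 0 < p ->
  (forall z : C, cabs z < p -> {for z, continuous (u : C -> C)}) ->
  forall r, `|r| < p -> {for r, continuous (rmeanRe u)}.
Proof.
move=> p0 cu r rp; pose q := (`|r| + p) / 2.
have [rq qp] : `|r| < q /\ q < p by rewrite /q; split; lra.
have q0 : 0 <= q by apply: le_trans (normr_ge0 r) (ltW rq).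
have [M M0 HM] : exists2 M, 0 <= M & forall z, cabs z <= q -> cabs (u z) <= M.
  by apply: continuous_bounded_disc => // z zq; apply: cu; exact: le_lt_trans zq qp.
have ab s t : `|s| < q -> cabs (s%:C * cis t) < q.
  by rewrite cabsM cabs_cisE mulr1 cabs_real.
have I s : [set` `]- q, q[] s -> `|s| < q by rewrite /= in_itv /= ltr_norml.
apply: (@continuity_under_integral R _ _ lebesgue_measure
  (fun s t => complex.Re (u (s%:C * cis t))) `[0, 2 * pi] _ (- q) q _ _ (fun=> M)) => //.
- move=> s /I sq; apply: cont_on_integrable => t _; apply: polar_continuous_t.
  by apply: cu; apply: lt_trans (ab _ _ sq) qp.
- apply/aeW => t _ s; rewrite inE => /I sq; apply: polar_continuous_r.
  by apply: cu; apply: lt_trans (ab _ _ sq) qp.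
- by apply: cont_on_integrable => t _; exact: cst_continuous.
- move=> s /I sq; apply/aeW => t _; apply: le_trans (Re_le_cabs _) _.
  by apply: HM; exact: ltW (ab _ _ sq).
- by rewrite inE /= in_itv /= -ltr_norml.
Qed.

Lemma cts_eq_right (f : R -> R) a b c : a < b -> {for a, continuous f} ->
  (forall x, a < x < b -> f x = c) -> f a = c.
Proof.
move=> ab /cvgrPdist_lt fa fc; apply/eqP; rewrite -subr_eq0 -normr_le0.
apply/ler_addgt0Pr => e e0; rewrite add0r.
have /nbhs_ballP[d /= d0 Hd] := fa e e0.
pose x := a + Num.min (d / 2) ((b - a) / 2).
have m0 : 0 < Num.min (d / 2) ((b - a) / 2) by rewrite lt_min !divr_gt0 // subr_gt0.
have m1 : Num.min (d / 2) ((b - a) / 2) <= d / 2 by rewrite ge_min lexx.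
have m2 : Num.min (d / 2) ((b - a) / 2) <= (b - a) / 2 by rewrite ge_min lexx orbT.
rewrite -(fc x); last by rewrite /x; lra.
apply/ltW/Hd; rewrite /ball /= distrC /x addrC addKr gtr0_norm //; lra.
Qed.

Lemma cts_eq_left (f : R -> R) a b c : a < b -> {for b, continuous f} ->
  (forall x, a < x < b -> f x = c) -> f b = c.
Proof.
move=> ab /cvgrPdist_lt fa fc; apply/eqP; rewrite -subr_eq0 -normr_le0.
apply/ler_addgt0Pr => e e0; rewrite add0r.
have /nbhs_ballP[d /= d0 Hd] := fa e e0.
pose x := b - Num.min (d / 2) ((b - a) / 2).
have m0 : 0 < Num.min (d / 2) ((b - a) / 2) by rewrite lt_min !divr_gt0 // subr_gt0.
have m1 : Num.min (d / 2) ((b - a) / 2) <= d / 2 by rewrite ge_min lexx.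
have m2 : Num.min (d / 2) ((b - a) / 2) <= (b - a) / 2 by rewrite ge_min lexx orbT.
rewrite -(fc x); last by rewrite /x; lra.
apply/ltW/Hd; rewrite /ball /= /x opprB addrC subrK gtr0_norm //; lra.
Qed.

Lemma rmeanRe0 u : rmeanRe u 0 = complex.Re (u 0) * (2 * pi).
Proof.
rewrite -[in RHS](subr0 (2 * pi)) -sint_cst ?mulr_ge0 ?pi_ge0 //.
by apply: eq_Rintegral => t _; rewrite mul0r.
Qed.

(* The exceptional point is crossed by continuity of the mean in the radius. *)
Lemma mean_value_Re u p (l : C) :
  (forall z : C, cabs z < p -> {for z, continuous (u : C -> C)}) ->
  (forall z : C, cabs z < p -> z != l -> differentiable (u : C -> C) z) ->
  forall r, 0 <= r < p -> rmeanRe u r = complex.Re (u 0) * (2 * pi).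
Proof.
move=> cu du r /andP[r0 rp]; have p0 := le_lt_trans r0 rp.
have cK s : 0 <= s -> s < p -> {for s, continuous (rmeanRe u)}.
  by move=> s0 sp; apply: (rmeanRe_continuous p0 cu); rewrite ger0_norm.
have KA a b : 0 < a -> a <= b -> b < p -> (cabs l < a \/ b < cabs l) -> rmeanRe u a = rmeanRe u b.
  move=> a0 ab bp labs; apply: rmeanRe_annulus => // z /= /andP[az zb].
  apply: du; first exact: le_lt_trans zb bp.
  by apply/eqP => zl; move: labs az zb; rewrite zl; case; lra.
have below s : 0 <= s -> s < p -> s < cabs l -> rmeanRe u s = complex.Re (u 0) * (2 * pi).
  move=> s0 sp sl; rewrite -rmeanRe0; move: s0; rewrite le_eqVlt => /predU1P[<- //|s0].
  apply/esym; apply: (@cts_eq_right (rmeanRe u) 0 s) => //; first exact: cK.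
  by move=> x /andP[x0 xs]; apply: KA => //; [exact: ltW|right].
have at_l : cabs l < p -> rmeanRe u (cabs l) = complex.Re (u 0) * (2 * pi).
  have := cabs_ge0 l; rewrite le_eqVlt => /predU1P[<- _|l0 lp]; first exact: rmeanRe0.
  apply: (@cts_eq_left _ 0) => //; first by apply: cK => //; exact: ltW.
  by move=> x /andP[x0 xl]; apply: below => //; [exact: ltW|exact: lt_trans lp].
case: (ltgtP r (cabs l)) => rl; last by rewrite rl at_l // -rl.
  exact: below.
have lp := lt_trans rl rp.
rewrite -(at_l lp); apply/esym; apply: (@cts_eq_right _ _ r) => //; first by apply: cK => //; exact: cabs_ge0.
move=> x /andP[lx xr]; apply: KA => //; [|exact: ltW|by left].
exact: le_lt_trans (cabs_ge0 _) lx.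
Qed.

End MeanValue.

(** * Integration on the circle *)
Section BoundedFunctions.
Variable R : realType.
Notation T := (borelType (circle R)).
Notation C := R[i]^o.
Implicit Types (f g u : T -> R) (F G : T -> R[i]).

(** The common domain of all functionals below: closed under products, and integrable for every
    finite measure. *)
Definition bmeas f := measurable_fun setT f /\ exists M, forall x, `|f x| <= M.

Lemma bmeas_cst c : bmeas (fun=> c).
Proof. by split; [exact: measurable_cst|exists `|c|]. Qed.

Lemma bmeasD f g : bmeas f -> bmeas g -> bmeas (fun x => f x + g x).
Proof.
move=> [mf [M fM]] [mg [N gN]]; split; first exact: measurable_funD.
by exists (M + N) => x; apply: le_trans (ler_normD _ _) _; exact: lerD.
Qed.

Lemma bmeasM f g : bmeas f -> bmeas g -> bmeas (fun x => f x * g x).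
Proof.
move=> [mf [M fM]] [mg [N gN]]; split; first exact: measurable_funM.
by exists (M * N) => x; rewrite normrM; exact: ler_pM.
Qed.

Lemma bmeasZ c f : bmeas f -> bmeas (fun x => c * f x).
Proof. by apply: bmeasM; exact: bmeas_cst. Qed.

Lemma bmeasN f : bmeas f -> bmeas (fun x => - f x).
Proof.
move=> /(bmeasZ (-1)); rewrite (_ : (fun _ => _) = fun x => - f x) //.
by apply/funext => x; rewrite mulN1r.
Qed.

Lemma bmeasB f g : bmeas f -> bmeas g -> bmeas (fun x => f x - g x).
Proof. by move=> bf bg; apply: bmeasD => //; exact: bmeasN. Qed.

Lemma bmeas_sum (I : Type) (s : seq I) (h : I -> T -> R) :
  (forall i, bmeas (h i)) -> bmeas (fun x => \sum_(i <- s) h i x).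
Proof.
move=> bh; elim: s => [|i s ih].
  by under eq_fun do rewrite big_nil; exact: bmeas_cst.
by under eq_fun do rewrite big_cons; exact: bmeasD.
Qed.

Lemma bmeas_indic (A : set T) : measurable A -> bmeas (\1_A : T -> R).
Proof.
move=> mA; split; first exact: measurable_indic.
by exists 1 => x; rewrite indicE; case: (_ \in _); rewrite ?normr1 ?normr0.
Qed.

Lemma bmeas_abs f : bmeas f -> bmeas (fun x => `|f x|).
Proof.
move=> [mf [M fM]]; split; first exact: measurableT_comp.
by exists M => x; rewrite normr_id.
Qed.

Definition bmC F := bmeas (fun x => complex.Re (F x)) /\ bmeas (fun x => complex.Im (F x)).

Lemma bmC_cst c : bmC (fun=> c).
Proof. by split; exact: bmeas_cst. Qed.

Lemma bmCD F G : bmC F -> bmC G -> bmC (fun x => F x + G x).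
Proof.
move=> [f1 f2] [g1 g2]; split.
  by under [X in bmeas X]eq_fun do rewrite /= Re_add; exact: bmeasD.
by under [X in bmeas X]eq_fun do rewrite /= Im_add; exact: bmeasD.
Qed.

Lemma bmCM F G : bmC F -> bmC G -> bmC (fun x => F x * G x).
Proof.
move=> [f1 f2] [g1 g2]; split.
  by under [X in bmeas X]eq_fun do rewrite /= Re_mul; apply: bmeasB; exact: bmeasM.
by under [X in bmeas X]eq_fun do rewrite /= Im_mul; apply: bmeasD; exact: bmeasM.
Qed.

Lemma bmCZ c F : bmC F -> bmC (fun x => c * F x).
Proof. by apply: bmCM; exact: bmC_cst. Qed.

Lemma bmCN F : bmC F -> bmC (fun x => - F x).
Proof.
move=> [f1 f2]; split.
  by under [X in bmeas X]eq_fun do rewrite /= Re_opp; exact: bmeasN.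
by under [X in bmeas X]eq_fun do rewrite /= Im_opp; exact: bmeasN.
Qed.

Lemma bmCB F G : bmC F -> bmC G -> bmC (fun x => F x - G x).
Proof. by move=> bF bG; apply: bmCD => //; exact: bmCN. Qed.

Lemma bmCJ F : bmC F -> bmC (fun x => (F x)^*%C).
Proof.
move=> [f1 f2]; split.
  by under [X in bmeas X]eq_fun do rewrite /= Re_conjc; exact: f1.
by under [X in bmeas X]eq_fun do rewrite /= Im_conjc; exact: bmeasN.
Qed.

Lemma bmC_real f : bmeas f -> bmC (fun x => (f x)%:C).
Proof. by move=> bf; split => //; exact: bmeas_cst. Qed.

Lemma bmC_Re F : bmC F -> bmeas (fun x => complex.Re (F x)).
Proof. by case. Qed.

Lemma bmC_Im F : bmC F -> bmeas (fun x => complex.Im (F x)).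
Proof. by case. Qed.

Lemma cabs_circle (z : circle R) : cabs (circle_val z) = 1.
Proof. by apply: complexI; rewrite cabsE; have := valP z; rewrite inE. Qed.

Lemma circle_preimage_open (W : set C) : open W ->
  open [set z : circle R | W (circle_val z)].
Proof. by move=> oW; exists W. Qed.

Lemma circle_continuous_measurable (f : C -> R) :
  (forall z : C, cabs z = 1 -> {for z, continuous f}) ->
  measurable_fun setT (fun z : T => f (circle_val z)).
Proof.
move=> cf; apply: (measurability _ (RGenOInfty.measurableE R)).
move=> _ [_ [a ->] <-]; rewrite setTI; apply: sub_sigma_algebra.
(* Since f is continuous only at the points of the circle, the superlevel set need not be open in C;
   its interior has the same trace on the circle. *)
pose W : set C := interior [set z : C | a < f z].
suff -> : (fun z : circle R => f (circle_val z)) @^-1` `]a, +oo[ = [set z : circle R | W (circle_val z)].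
  by apply: circle_preimage_open; exact: open_interior.
apply/seteqP; split=> z /=; rewrite in_itv /= andbT.
  move=> az; apply/nbhs_cabsP.
  have /cts_CR/(_ (f (circle_val z) - a)) := cf (circle_val z) (cabs_circle z).
  rewrite subr_gt0 => /(_ az)[d d0 Hd]; exists d => // w wd.
  have : `|f w - f (circle_val z)| < f (circle_val z) - a by apply: Hd; rewrite cabsC.
  by rewrite /= ltr_norml; lra.
exact: interior_subset.
Qed.

Lemma circle_compact : compact ([set z | cabs z = 1] : set C).
Proof.
apply: (@subclosed_compact _ _ _ _ (@disc_compact R 1)).
  apply: (@closed_comp _ _ (cabs : C -> R) [set x | x = 1]); last exact: closed_eq.
  by move=> z _; exact: cabs_continuous.
by move=> z /= ->.
Qed.

Lemma circle_continuous_bmeas (f : C -> R) :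
  (forall z : C, cabs z = 1 -> {for z, continuous f}) ->
  bmeas (fun z : T => f (circle_val z)).
Proof.
move=> cf; split; first exact: circle_continuous_measurable.
have [||| c _ Hc] := @compact_EVT_max C R (fun z => `|f z|) [set z | cabs z = 1].
- by exists 1; rewrite /= cabs1.
- exact: circle_compact.
- apply: continuous_in_subspaceT => z; rewrite inE /= => /cf /cts_CR cz.
  apply/cts_CR => e /cz[d d0 Hd]; exists d => // w /Hd; apply: le_lt_trans.
  exact: ler_dist_dist.
by exists `|f c| => z; apply: Hc; rewrite inE /=; exact: cabs_circle.
Qed.

Lemma circle_continuous_bmC (F : C -> C) :
  (forall z : C, cabs z = 1 -> {for z, continuous F}) ->
  bmC (fun z : T => F (circle_val z)).
Proof.
move=> cF; split.
  apply: (@circle_continuous_bmeas (fun z => complex.Re (F z))) => z /cF /cts_CC cz.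
  apply/cts_CR => e /cz[d d0 Hd]; exists d => // w /Hd.
  by apply: le_lt_trans; rewrite -Re_opp -Re_add Re_le_cabs.
apply: (@circle_continuous_bmeas (fun z => complex.Im (F z))) => z /cF /cts_CC cz.
apply/cts_CR => e /cz[d d0 Hd]; exists d => // w /Hd.
by apply: le_lt_trans; rewrite -Im_opp -Im_add Im_le_cabs.
Qed.

Lemma bmC_circle_val : bmC (@circle_val R : T -> R[i]).
Proof. by apply: (@circle_continuous_bmC id) => z _; exact: cvg_id. Qed.

End BoundedFunctions.

Section LinearFunctionals.
Variable R : realType.
Notation T := (borelType (circle R)).
Implicit Types (f g u : T -> R) (F G : T -> R[i]).

(** Restricted to bounded Borel functions, because additivity fails for the default values that
    integrals take on other functions. *)
Definition linear_bm (Lam : (T -> R) -> R) :=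
  (forall f g, bmeas f -> bmeas g -> Lam (fun x => f x + g x) = Lam f + Lam g) /\
  (forall c f, bmeas f -> Lam (fun x => c * f x) = c * Lam f).

Definition cext (Lam : (T -> R) -> R) F : R[i] :=
  (Lam (fun x => complex.Re (F x))) +i* (Lam (fun x => complex.Im (F x))).

Variable Lam : (T -> R) -> R.
Hypothesis lin : linear_bm Lam.

Lemma linear_bmB f g : bmeas f -> bmeas g -> Lam (fun x => f x - g x) = Lam f - Lam g.
Proof.
case: lin => [D Z] bf bg; rewrite -mulN1r -Z // -D //; last exact: bmeasZ.
by congr Lam; apply/funext => x; rewrite mulN1r.
Qed.

Lemma cextD F G : bmC F -> bmC G -> cext Lam (fun x => F x + G x) = cext Lam F + cext Lam G.
Proof.
case: lin => [D Z] [f1 f2] [g1 g2]; apply: complexP; rewrite ?Re_add ?Im_add /= -D //.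
  by congr Lam; apply/funext => x; rewrite /= Re_add.
by congr Lam; apply/funext => x; rewrite /= Im_add.
Qed.

Lemma cextZ c F : bmC F -> cext Lam (fun x => c * F x) = c * cext Lam F.
Proof.
case: lin => [D Z] [f1 f2]; apply: complexP; rewrite ?Re_mul ?Im_mul /= -!Z //.
  rewrite -linear_bmB; [|exact: bmeasZ..].
  by congr Lam; apply/funext => x; rewrite /= Re_mul.
rewrite -D; [|exact: bmeasZ..].
by congr Lam; apply/funext => x; rewrite /= Im_mul.
Qed.

Lemma cextB F G : bmC F -> bmC G -> cext Lam (fun x => F x - G x) = cext Lam F - cext Lam G.
Proof.
move=> bF bG; rewrite -mulN1r -cextZ // -cextD //; last exact: bmCZ.
by congr cext; apply/funext => x; rewrite mulN1r.
Qed.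

Lemma cextJ F : bmC F -> cext Lam (fun x => (F x)^*%C) = (cext Lam F)^*%C.
Proof.
case: lin => [D Z] [f1 f2]; apply: complexP; rewrite ?Re_conjc ?Im_conjc /=.
  by congr Lam; apply/funext => x; rewrite /= Re_conjc.
rewrite -mulN1r -Z //.
by congr Lam; apply/funext => x; rewrite /= Im_conjc mulN1r.
Qed.

Lemma cext_real f : bmeas f -> cext Lam (fun x => (f x)%:C) = (Lam f)%:C.
Proof.
case: lin => [D Z] bf; apply: complexP => //=.
transitivity (Lam (fun x => 0 * f x)); last by rewrite Z // mul0r.
by congr Lam; apply/funext => x; rewrite mul0r.
Qed.

Lemma Re_cext F : complex.Re (cext Lam F) = Lam (fun x => complex.Re (F x)).
Proof. by []. Qed.

End LinearFunctionals.

Section WeightedIntegrals.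
Variable R : realType.
Notation T := (borelType (circle R)).
Variable m : {measure set T -> \bar R}.
Implicit Types (f g u : T -> R).

Definition L1 u := m.-integrable setT (EFin \o u).

Definition wint u f := \int[m]_x (f x * u x).

Lemma L1M u f : L1 u -> bmeas f -> L1 (fun x => f x * u x).
Proof.
move=> iu [mf [M fM]]; apply: (@integrableMr _ _ _ m setT _ f (EFin \o u)) => //.
exists M; split; first exact: num_real.
by move=> y My x _; apply: le_trans (fM x) (ltW My).
Qed.

Lemma linear_wint u : L1 u -> linear_bm (wint u).
Proof.
move=> iu; split=> [f g bf bg|c f bf]; rewrite /wint.
  by rewrite -RintegralD //; [|exact: L1M..]; apply: eq_Rintegral => x _; rewrite mulrDl.
by rewrite -RintegralZl //; [|exact: L1M]; apply: eq_Rintegral => x _; rewrite mulrA.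
Qed.

Lemma wint_ge0 u f : (forall x, 0 <= f x * u x) -> 0 <= wint u f.
Proof. by move=> fu; apply: Rintegral_ge0. Qed.

Lemma wint_le u f g : L1 u -> bmeas f -> bmeas g ->
  (forall x, f x * u x <= g x * u x) -> wint u f <= wint u g.
Proof. by move=> iu bf bg fg; apply: le_Rintegral => //; exact: L1M. Qed.

Lemma wint_norm u f e : L1 u -> bmeas f -> (forall x, `|f x| <= e) ->
  `|wint u f| <= e * \int[m]_x `|u x|.
Proof.
move=> iu bf fe; apply: le_trans (le_normr_Rintegral _ (L1M iu bf)) _ => //.
have ia : L1 (fun x => `|u x|) by exact: integrable_norm.
rewrite -RintegralZl //; apply: le_Rintegral => //.
- by apply: (@integrable_norm _ _ _ m setT (fun x => f x * u x)); exact: L1M.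
- by apply: (@L1M (fun x => `|u x|) (fun=> e)) => //; exact: bmeas_cst.
- by move=> x _; rewrite normrM ler_wpM2r.
Qed.

Lemma bmeas_L1 f : (m setT < +oo)%E -> bmeas f -> L1 f.
Proof.
move=> fin [mf [M fM]]; apply: measurable_bounded_integrable => //.
exists M; split; first exact: num_real.
by move=> y My x _; apply: le_trans (fM x) (ltW My).
Qed.

End WeightedIntegrals.

Section CircleMean.
Variable R : realType.
Notation T := (borelType (circle R)).
Notation C := R[i]^o.

Lemma arc_lengthT : arc_length R setT = (2 * pi)%:E.
Proof.
rewrite /arc_length /pushforward preimage_setT /mrestr setTI.
rewrite lebesgue_measure_itv /= lte_fin mulr_gt0 ?pi_gt0 //.
by rewrite -EFinD subr0.
Qed.

Lemma arc_length_fin : (arc_length R setT < +oo)%E.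
Proof. by rewrite arc_lengthT ltry. Qed.

Lemma integral_arc_length (f : T -> R) : bmeas f ->
  \int[arc_length R]_x f x = sint (fun t => f (circle_of_angle t)) 0 (2 * pi).
Proof.
move=> bf; have [mf [M fM]] := bf.
have mg : measurable_fun setT (fun t : measurableTypeR R => f (circle_of_angle t)).
  exact: measurableT_comp mf (@circle_of_angle_measurable R).
have gM t : `|f (circle_of_angle t)| <= M by exact: fM.
pose I : set R := `[0, 2 * pi[%classic.
have mI : measurable (I : set (measurableTypeR R)) by exact: measurable_itv.
pose mu := mrestr (@lebesgue_measure R) (measurable_itv `[(0 : R), 2 * pi[).
have muT : (mu setT < +oo)%E.
  rewrite /mu /mrestr setTI lebesgue_measure_itv /= lte_fin mulr_gt0 ?pi_gt0 //.
  by rewrite -EFinD ltry.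
have bdg (A : set R) : [bounded f (circle_of_angle t) | t in A].
  exists M; split; first exact: num_real.
  by move=> y My x _; apply: le_trans (gM x) (ltW My).
have ig : mu.-integrable setT (EFin \o (fun t : measurableTypeR R => f (circle_of_angle t))).
  exact: measurable_bounded_integrable.
rewrite /sint -Rintegral_itv_bndo_bndc; last first.
  apply: measurable_bounded_integrable => //; last exact: measurable_funTS.
  by rewrite /= lebesgue_measure_itv /= lte_fin mulr_gt0 ?pi_gt0 // -EFinD ltry.
rewrite /Rintegral; congr fine.
have -> : (\int[arc_length R]_x (f x)%:E =
  \int[pushforward mu (@circle_of_angle R : measurableTypeR R -> T)]_(x in setT) (f x)%:E)%E by [].
rewrite integral_pushforward //; last first.
- exact/measurable_EFinP.
- exact: circle_of_angle_measurable.
(* The restricted measure does not charge the complement of [0, 2 pi[, and on this interval it is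
   the Lebesgue measure. *)
rewrite preimage_setT (@negligible_integral _ _ _ mu setT (~` I)) //; last 2 first.
- exact: measurableC.
- rewrite [LHS](_ : _ = lebesgue_measure (~` I `&` I)) //.
  by rewrite setICl measure0.
rewrite setDE setTI setCK; apply: eq_measure_integral => A mA AI.
by rewrite /mu /= /mrestr; congr lebesgue_measure; rewrite setIidl.
Qed.

Definition mean (f : T -> R) : R := (2 * pi)^-1 * \int[arc_length R]_x f x.

Lemma linear_mean : linear_bm mean.
Proof.
split=> [f g bf bg|c f bf]; rewrite /mean.
  by rewrite RintegralD ?mulrDr //; apply: bmeas_L1 => //; exact: arc_length_fin.
rewrite RintegralZl; [by rewrite mulrCA|exact: measurableT|].
exact: (bmeas_L1 arc_length_fin bf).
Qed.

Let ipi : 0 < (2 * pi)^-1 :> R. Proof. by rewrite invr_gt0 mulr_gt0 // pi_gt0. Qed.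

Lemma mean_cst c : mean (fun=> c) = c.
Proof.
rewrite /mean Rintegral_cst // (_ : fine _ = 2 * pi) ?(congr1 fine arc_lengthT) //.
rewrite mulrC mulfK //.
by rewrite gt_eqF // -invr_gt0.
Qed.

Lemma mean_le (f g : T -> R) : bmeas f -> bmeas g -> (forall x, f x <= g x) -> mean f <= mean g.
Proof.
move=> bf bg fg; rewrite /mean ler_pM2l //; apply: le_Rintegral => //;
  by apply: bmeas_L1 => //; exact: arc_length_fin.
Qed.

Lemma mean_ge0 (f : T -> R) : (forall x, 0 <= f x) -> 0 <= mean f.
Proof. by move=> f0; rewrite /mean mulr_ge0 ?(ltW ipi) // Rintegral_ge0. Qed.

Lemma mean_value_circle (u : C -> C) p (l : C) :
  (forall z : C, cabs z < p -> {for z, continuous u}) ->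
  (forall z : C, cabs z < p -> z != l -> differentiable u z) ->
  forall r, 0 <= r < p -> cext mean (fun z => u (r%:C * circle_val z)) = u 0.
Proof.
move=> cu du r rp; have /andP[r0 rp'] := rp.
have main (v : C -> C) : (forall z : C, cabs z < p -> {for z, continuous v}) ->
    (forall z : C, cabs z < p -> z != l -> differentiable v z) ->
    mean (fun z => complex.Re (v (r%:C * circle_val z))) = complex.Re (v 0).
  move=> cv dv; rewrite /mean integral_arc_length; last first.
    apply: (@circle_continuous_bmeas R (fun z => complex.Re (v (r%:C * z)))) => z z1.
    have /cv /cts_CC cz : cabs (r%:C * z) < p by rewrite cabsM z1 mulr1 cabs_real ger0_norm.
    apply/cts_CR => e /cz[d d0 Hd]; exists (d / (r + 1)); first by rewrite divr_gt0 // ltr_wpDl.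
    move=> w; rewrite ltr_pdivlMr ?ltr_wpDl // => wd.
    apply: le_lt_trans (Hd (r%:C * w) _); first by rewrite -Re_opp -Re_add Re_le_cabs.
    rewrite -mulrBr cabsM cabs_real ger0_norm // mulrC.
    by apply: le_lt_trans wd; rewrite ler_wpM2l ?cabs_ge0 // lerDl ler01.
  have := mean_value_Re cv dv rp; rewrite /rmeanRe /cis /circle_val /= => ->.
  by rewrite mulrCA mulVf ?mulr1 // gt_eqF // -invr_gt0.
apply: complexP; first exact: main.
(* The imaginary part of u is the real part of - i u. *)
have ReNi w : complex.Re (- 'i * w) = complex.Im w by case: w => a b /=; ring.
have H := main (fun z => - 'i * u z) _ _; rewrite /= -ReNi -H.
- by congr mean; apply/funext => z; rewrite ReNi.
- by move=> z zp; apply: continuousZl_tmp; exact: cu.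
- by move=> z zp zl; apply: differentiableZ; exact: du.
Qed.

End CircleMean.

(** * Cauchy, Poisson and Schwarz formulas *)
Section CauchyFormulas.
Variable R : realType.
Notation T := (borelType (circle R)).
Notation C := R[i]^o.
Notation zv := (@circle_val R).
Notation M := (cext (@mean R)).
Implicit Types (u F : C -> C) (l : R[i]) (r p : R).

Let linM := @linear_mean R.

Lemma M_cst (c : R[i]) : M (fun=> c) = c.
Proof. by apply: complexP; rewrite /= mean_cst. Qed.

Lemma invcE (z : R[i]) : z != 0 -> z^-1 = z^*%C * ((cabs z ^+ 2)^-1)%:C.
Proof.
move=> z0; apply: (mulfI z0); rewrite mulfV // mulrA mulcJ -rmorphM /= mulfV //.
by rewrite expf_neq0 // cabs_eq0.
Qed.

Lemma has_cderiv_near (f g : R[i] -> R[i]) z A d : 0 < d ->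
  (forall w, cabs (w - z) < d -> f w = g w) -> has_cderiv g z A -> has_cderiv f z A.
Proof.
move=> d0 fg gA e /gA[d' d'0 Hd]; exists (Num.min d d'); first by rewrite lt_min d0.
move=> w; rewrite lt_min => /andP[wd wd'].
by rewrite !fg ?subrr ?cabs0 //; exact: Hd.
Qed.

Lemma differentiable_near u F (z : C) d : 0 < d ->
  (forall w, cabs (w - z) < d -> u w = F w) -> differentiable F z -> differentiable u z.
Proof.
move=> d0 uF /differentiable_cderiv FA; apply: cderiv_differentiable.
exact: has_cderiv_near uF FA.
Qed.

(** At [a] the filled-in quotient is only shown to be continuous; this is the case for which
    [mean_value_circle] admits an exceptional point, in place of a removable singularity theorem. *)
Definition diffquot u (a : C) (z : C) : C :=
  if z == a then 'd u a 1 else (u z - u a) / (z - a).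

Lemma diffquot_differentiable u (a z : C) : z != a -> differentiable u z ->
  differentiable (diffquot u a) z.
Proof.
move=> za uz.
apply: (@differentiable_near _ (fun w => (u w - u a) * (w - a)^-1) _ (cabs (z - a))).
- by rewrite cabs_gt0 subr_eq0.
- move=> w wz; rewrite /diffquot; case: eqP => // wa.
  by move: wz; rewrite wa cabsC ltxx.
- apply: (@differentiableM _ _ (fun w => u w - u a) (fun w => (w - a)^-1)).
    exact: differentiableB.
  apply: (@differentiableV _ _ (fun w => w - a)); first exact: differentiableB.
  by rewrite subr_eq0.
Qed.

Lemma diffquot_continuous u (a z : C) : differentiable u a -> differentiable u z ->
  {for z, continuous (diffquot u a)}.
Proof.
move=> /differentiable_cderiv ua uz; have [->|za] := eqVneq z a; last first.
  exact/differentiable_continuous/diffquot_differentiable.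
apply/cts_CC => e e0; have [d d0 Hd] := ua _ (divr_gt0 e0 (ltr0n R 2) : 0 < e / 2).
exists d => // w /Hd; rewrite /diffquot eqxx; case: eqVneq => [_|wa].
  by rewrite subrr cabs0.
have wa0 : 0 < cabs (w - a) by rewrite cabs_gt0 subr_eq0.
rewrite -ler_pdivrMr // -cabsV -cabsM mulrBl mulfK ?subr_eq0 //.
by move=> /le_lt_trans; apply; rewrite ltr_pdivrMr // ltr_pMr // ltr1n.
Qed.

Lemma mean_hol u p r : (forall z : C, cabs z < p -> differentiable u z) ->
  0 <= r < p -> M (fun z => u (r%:C * zv z)) = u 0.
Proof.
move=> du rp; apply: (@mean_value_circle R u p 0 _ _ r rp) => z zp.
  exact/differentiable_continuous/du.
by move=> _; exact: du.
Qed.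

Lemma hol_bmC u p r : (forall z : C, cabs z < p -> differentiable u z) ->
  0 <= r < p -> bmC (fun z : T => u (r%:C * zv z)).
Proof.
move=> du /andP[r0 rp]; apply: (@circle_continuous_bmC R (fun z => u (r%:C * z))) => z z1.
have /du/differentiable_continuous/cts_CC cz : cabs (r%:C * z) < p.
  by rewrite cabsM z1 mulr1 cabs_real ger0_norm.
apply/cts_CC => e /cz[d d0 Hd]; exists (d / (r + 1)); first by rewrite divr_gt0 // ltr_wpDl.
move=> w; rewrite ltr_pdivlMr ?ltr_wpDl // => wd.
apply: Hd; rewrite -mulrBr cabsM cabs_real ger0_norm // mulrC.
by apply: le_lt_trans wd; rewrite ler_wpM2l ?cabs_ge0 // lerDl ler01.
Qed.

Section Kernels.
Variable l : R[i].
Hypothesis l1 : cabs l < 1.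

Lemma circle_subr_neq0 (z : T) : zv z - l != 0.
Proof. by rewrite subr_eq0; apply/eqP => zl; move: l1; rewrite -zl cabs_circle ltxx. Qed.

Lemma circle_val_neq0 (z : T) : zv z != 0.
Proof. by rewrite -cabs_gt0 cabs_circle ltr01. Qed.

Lemma circle_conj (z : T) : (zv z)^*%C = (zv z)^-1.
Proof.
apply: (mulfI (circle_val_neq0 z)); rewrite mulcJ cabs_circle expr1n.
by rewrite mulfV // circle_val_neq0.
Qed.

Lemma bmC_inv : bmC (fun z : T => (zv z - l)^-1).
Proof.
apply: (@circle_continuous_bmC R (fun z => (z - l)^-1)) => z z1.
apply: differentiable_continuous; apply: (@differentiableV _ _ (fun w : C => w - l)).
  exact: differentiableB.
by rewrite subr_eq0; apply/eqP => zl; move: l1; rewrite -zl z1 ltxx.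
Qed.

(** The radius 2 / (1 + |l|) is larger than 1 and smaller than 1 / |l|, and it needs no case
    distinction at l = 0. *)
Lemma one_subJ_neq0 (z : R[i]) : cabs z < 2 / (1 + cabs l) -> 1 - l^*%C * z != 0.
Proof.
have l0 := cabs_ge0 l; have d0 : 0 < 1 + cabs l by rewrite ltr_wpDr.
rewrite ltr_pdivlMr // => zl; rewrite subr_eq0; apply/eqP => /(congr1 cabs).
rewrite cabs1 cabsM cabsJ => E; have z0 := cabs_ge0 z.
have z1 : cabs z < 1 by move: zl; rewrite mulrDr mulr1 mulrC -E; lra.
have : cabs l * cabs z <= cabs z by rewrite ler_piMl // ltW.
by rewrite -E; lra.
Qed.

(** The factor 1 - conj(l) z has no zero in a disc larger than the unit disc, so the integrand
    extends holomorphically, with value F(0) at 0. *)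
Lemma mean_conj_kernel F p r : (forall z : C, cabs z < p -> differentiable F z) ->
  0 < r < p -> M (fun z => F (r%:C * zv z) * (1 - l^*%C * zv z)^-1) = F 0.
Proof.
move=> dF /andP[r0 rp]; pose q := Num.min (p / r) (2 / (1 + cabs l)).
have l0 := cabs_ge0 l; have d0 : 0 < 1 + cabs l by rewrite ltr_wpDr.
have := @mean_hol (fun z => F (r%:C * z) * (1 - l^*%C * z)^-1) q 1.
rewrite /= !mulr0 subr0 invr1 mulr1 => <-.
- by congr M; apply/funext => z; rewrite mul1r.
- move=> z; rewrite lt_min ltr_pdivlMr // => /andP[zr zl].
  apply: (@differentiableM _ _ (fun z : C => F (r%:C * z)) (fun z : C => (1 - l^*%C * z)^-1)).
    apply: (@differentiable_comp _ _ _ _ (fun z : C => r%:C * z : C) F).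
      exact: differentiableZ.
    by apply: dF; rewrite cabsM cabs_real gtr0_norm // mulrC.
  apply: (@differentiableV _ _ (fun w : C => 1 - l^*%C * w)); last exact: one_subJ_neq0.
  by apply: differentiableB => //; exact: differentiableZ.
- by rewrite ler01 lt_min ltr_pdivlMr // mul1r rp ltr_pdivlMr // mul1r /=; move: l1; lra.
Qed.

Lemma conj_kernelE (z : T) : ((1 - l^*%C * zv z)^-1)^*%C = zv z / (zv z - l).
Proof.
rewrite fmorphV rmorphB rmorph1 rmorphM /= conjcK circle_conj.
have z0 := circle_val_neq0 z; have zl := circle_subr_neq0 z; field.
by rewrite z0 zl.
Qed.

Lemma bmC_conj_kernel : bmC (fun z : T => (1 - l^*%C * zv z)^-1).
Proof.
apply: (@circle_continuous_bmC R (fun z => (1 - l^*%C * z)^-1)) => z z1.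
apply: differentiable_continuous; apply: (@differentiableV _ _ (fun w : C => 1 - l^*%C * w)).
  by apply: differentiableB => //; exact: differentiableZ.
have l0 := cabs_ge0 l; have d0 : 0 < 1 + cabs l by rewrite ltr_wpDr.
by apply: one_subJ_neq0; rewrite z1 ltr_pdivlMr // mul1r; move: l1; lra.
Qed.

Lemma bmC_cauchy : bmC (fun z : T => zv z / (zv z - l)).
Proof. by apply: bmCM; [exact: bmC_circle_val|exact: bmC_inv]. Qed.

Lemma mean_cauchy_kernel : M (fun z => zv z / (zv z - l)) = 1.
Proof.
under eq_fun do rewrite -conj_kernelE.
rewrite cextJ //; last exact: bmC_conj_kernel.
have := @mean_conj_kernel (fun=> 1) 2 1 (fun z _ => differentiable_cst _ _) _.
rewrite ltr01 ltr1n => /(_ isT) => H.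
have -> : (fun z : T => (1 - l^*%C * zv z)^-1) = (fun z => 1 / (1 - l^*%C * zv z)).
  by apply/funext => z; rewrite div1r.
by rewrite H conjc1.
Qed.

(** With a = r l, the product of z and the difference quotient of F at a has mean 0, its value at 0.
    On the circle it is (F - F(a)) times the Cauchy kernel, whose mean is 1. *)
Lemma cauchy_formula F p r : (forall z : C, cabs z < p -> differentiable F z) ->
  0 < r < p -> M (fun z => F (r%:C * zv z) * (zv z / (zv z - l))) = F (r%:C * l).
Proof.
move=> dF /andP[r0 rp]; pose a : C := r%:C * l.
have ap : cabs a < p.
  rewrite /a cabsM cabs_real gtr0_norm //; apply: lt_trans rp.
  by rewrite gtr_pMr.
have bF : bmC (fun z : T => F (r%:C * zv z)) by apply: hol_bmC dF _; rewrite ltW.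
have := @mean_value_circle R (fun z => diffquot F a z * z) p a _ _ r _.
rewrite mulr0 (ltW r0) rp => H.
have : M (fun z => diffquot F a (r%:C * zv z) * (r%:C * zv z)) = 0.
  apply: H => [z zp|z zp za|//].
    by apply: (@continuousM C _ (diffquot F a) id); [apply: diffquot_continuous; exact: dF|exact: cvg_id].
  apply: (@differentiableM _ _ (diffquot F a) id) => //.
  by apply: diffquot_differentiable => //; exact: dF.
rewrite (_ : (fun z => _) = (fun z => F (r%:C * zv z) * (zv z / (zv z - l)) - F a * (zv z / (zv z - l)))).
  rewrite cextB //; last 2 first.
  - exact: bmCM bF bmC_cauchy.
  - exact: bmCZ bmC_cauchy.
  rewrite cextZ //; last exact: bmC_cauchy.
  by rewrite mean_cauchy_kernel mulr1 => /eqP; rewrite subr_eq0 => /eqP.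
apply/funext => z; rewrite /diffquot /a.
have rC0 : r%:C != 0 :> R[i] by rewrite -cabs_gt0 cabs_real normr_gt0 gt_eqF.
have zl := circle_subr_neq0 z.
rewrite (inj_eq (mulfI rC0)) -subr_eq0 (negbTE zl).
by move: (r%:C) rC0 => c c0; field; rewrite -?mulrBr ?mulf_neq0 ?zl ?c0.
Qed.

Definition poisson (z : T) : R := complex.Re ((zv z + l) / (zv z - l)).

Lemma bmC_schwarz : bmC (fun z : T => (zv z + l) / (zv z - l)).
Proof.
apply: bmCM bmC_inv; apply: bmCD; [exact: bmC_circle_val|exact: bmC_cst].
Qed.

Lemma bmeas_poisson : bmeas poisson.
Proof. by have [] := bmC_schwarz. Qed.

Lemma poissonE z : poisson z = (1 - cabs l ^+ 2) / cabs (zv z - l) ^+ 2.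
Proof.
rewrite /poisson (invcE (circle_subr_neq0 z)) mulrA mulrC Re_RCmul mulrC.
congr (_ / _); rewrite rmorphB /= mulrBr !mulrDl mulcJ cabs_circle expr1n.
rewrite [l * l^*%C]mulcJ.
by case: (zv z) l => [a b] [c d] /=; ring.
Qed.

Lemma poisson_gt0 z : 0 < poisson z.
Proof.
rewrite poissonE divr_gt0 //; last by rewrite exprn_gt0 // cabs_gt0 circle_subr_neq0.
by rewrite subr_gt0 expr_lt1 // cabs_ge0.
Qed.

Lemma poisson_ge z : (1 - cabs l) / (1 + cabs l) <= poisson z.
Proof.
have l0 := cabs_ge0 l; have d0 : 0 < 1 + cabs l by rewrite ltr_wpDr.
have c0 : 0 < cabs (zv z - l) by rewrite cabs_gt0 circle_subr_neq0.
have cB : cabs (zv z - l) <= 1 + cabs l by rewrite -(cabs_circle z) cabsB.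
rewrite poissonE ler_pdivlMr ?exprn_gt0 // mulrAC ler_pdivrMr //.
have -> : (1 - cabs l ^+ 2) * (1 + cabs l) = (1 - cabs l) * (1 + cabs l) ^+ 2 by ring.
by rewrite ler_pM2l ?subr_gt0 // lerXn2r // nnegrE ltW.
Qed.

Lemma schwarz_cauchyE (z : T) : (zv z + l) / (zv z - l) = 2 * (zv z / (zv z - l)) - 1.
Proof. by field; exact: circle_subr_neq0. Qed.

Lemma mean_schwarz : M (fun z => (zv z + l) / (zv z - l)) = 1.
Proof.
under eq_fun do rewrite schwarz_cauchyE.
rewrite cextB //; last 2 first.
- exact: bmCZ bmC_cauchy.
- exact: bmC_cst.
rewrite cextZ //; last exact: bmC_cauchy.
by rewrite mean_cauchy_kernel M_cst; ring.
Qed.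

Lemma mean_poisson : mean poisson = 1.
Proof. by have := congr1 (@complex.Re R) mean_schwarz. Qed.

Lemma poisson_conjE z : (poisson z)%:C = zv z / (zv z - l) + ((1 - l^*%C * zv z)^-1 - 1).
Proof.
have AB := conj_kernelE z; set A := _ / _ in AB *; set B := _^-1 in AB *.
have BA : A^*%C = B by rewrite -AB conjcK.
rewrite /poisson schwarz_cauchyE -/A ReJ_add rmorphB rmorphM rmorph1 rmorph_nat /= BA.
by field.
Qed.

(** By [poisson_conjE] the Cauchy kernel reproduces F(r l), and the rest contributes F(0) - F(0). *)
Lemma poisson_formula F p r : (forall z : C, cabs z < p -> differentiable F z) ->
  0 < r < p -> M (fun z => F (r%:C * zv z) * (poisson z)%:C) = F (r%:C * l).
Proof.
move=> dF rp; have /andP[r0 rp'] := rp.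
have bF : bmC (fun z : T => F (r%:C * zv z)) by apply: hol_bmC dF _; rewrite ltW.
have bA := bmCM bF bmC_cauchy; have bB := bmCM bF bmC_conj_kernel.
under eq_fun do rewrite poisson_conjE mulrDr mulrBr mulr1.
rewrite (cextD linM bA (bmCB bB bF)) (cextB linM bB bF).
rewrite (cauchy_formula dF rp) (mean_conj_kernel dF rp) (mean_hol dF) ?subrr ?addr0 //.
by rewrite ltW.
Qed.

(** Its real part is the outward radial component of F on the circle of radius r; for r = 1 it is
    the quantity required to be real in the definition of H^n. *)
Definition radial_weight F r (z : T) : R[i] := (zv z)^*%C * F (r%:C * zv z).

(** Recovers F from F(0), the real part of its radial weight and one imaginary constant. The
    identity [E] expresses Re k and Im k through k and its conjugate; the means of the resulting
    terms are given by the formulas above. *)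
Lemma schwarz_formula F p r : (forall z : C, cabs z < p -> differentiable F z) ->
  0 < r < p -> let k := radial_weight F r in
  F (r%:C * l) = F 0 - (F 0)^*%C * l ^+ 2 +
    l * (M (fun z => (complex.Re (k z))%:C * ((zv z + l) / (zv z - l))) +
         'i%C * (mean (fun z => complex.Im (k z)))%:C).
Proof.
move=> dF rp k; have /andP[r0 rp'] := rp.
have bF : bmC (fun z : T => F (r%:C * zv z)) by apply: hol_bmC dF _; rewrite ltW.
have bk : bmC k by apply: bmCM bF; exact: bmCJ (bmC_circle_val R).
have bK1 : bmC (fun z => (complex.Re (k z))%:C * ((zv z + l) / (zv z - l))).
  by apply: bmCM bmC_schwarz; apply: bmC_real; exact: bmC_Re.
have bK2 : bmC (fun z => (complex.Im (k z))%:C) by apply: bmC_real; exact: bmC_Im.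
have E : (fun z => l * ((complex.Re (k z))%:C * ((zv z + l) / (zv z - l)) + 'i%C * (complex.Im (k z))%:C)) =
  (fun z => (F (r%:C * zv z) * (zv z / (zv z - l)) - F (r%:C * zv z)) +
    l ^+ 2 * (F (r%:C * zv z) * (1 - l^*%C * zv z)^-1)^*%C).
  apply/funext => z; have z0 := circle_val_neq0 z; have zl := circle_subr_neq0 z.
  rewrite rmorphM /= conj_kernelE ReJ_add ImJ_sub /k /radial_weight rmorphM /= conjcK circle_conj.
  rewrite ['i%C * (_ * 'i%C)]mulrCA -['i%C * 'i%C]expr2 sqr_i.
  by field; rewrite z0 zl.
have bA := bmCM bF bmC_cauchy; have bB := bmCM bF bmC_conj_kernel.
have := congr1 M E.
rewrite (cextZ linM l (bmCD bK1 (bmCZ 'i%C bK2))) (cextD linM bK1 (bmCZ 'i%C bK2)).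
rewrite (cextD linM (bmCB bA bF) (bmCZ (l ^+ 2) (bmCJ bB))) (cextB linM bA bF).
rewrite (cextZ linM (l ^+ 2) (bmCJ bB)) (cextJ linM bB).
rewrite (cauchy_formula dF rp) (mean_conj_kernel dF rp) (mean_hol dF) ?(ltW r0) //.
rewrite (cextZ linM 'i%C bK2) (cext_real linM (bmC_Im bk)).
by move=> ->; ring.
Qed.

End Kernels.

End CauchyFormulas.

(** * Estimates, zeros and limits of holomorphic functions in the disc *)

Section DiscFunctions.
Variable R : realType.
Notation T := (borelType (circle R)).
Notation C := R[i]^o.
Notation zv := (@circle_val R).
Notation M := (cext (@mean R)).
Implicit Types (u F : C -> C) (l : R[i]) (r p : R).

Let linM := @linear_mean R.

Lemma cabs2 : cabs 2 = 2 :> R.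
Proof. by rewrite -[2 in LHS](rmorph_nat (real_complex R)) cabs_real ger0_norm. Qed.

Lemma rotate (z : R[i]) : exists2 w : R[i], cabs w = 1 & w * z = (cabs z)%:C.
Proof.
have [->|z0] := eqVneq z 0; first by exists 1; rewrite ?cabs1 // mulr0 cabs0.
exists (z^*%C * ((cabs z)^-1)%:C).
  by rewrite cabsM cabsJ cabs_real normfV ger0_norm ?cabs_ge0 // mulfV // cabs_eq0.
rewrite mulrAC [_ * z]mulrC mulcJ -rmorphM /= expr2 mulfK //.
by rewrite cabs_eq0.
Qed.

Lemma M_norm (F : T -> R[i]) e : bmC F -> (forall z, cabs (F z) <= e) -> cabs (M F) <= e.
Proof.
move=> bF Fe; have [w w1 wM] := rotate (M F).
have -> : cabs (M F) = mean (fun z => complex.Re (w * F z)).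
  by rewrite -Re_cext cextZ // wM.
rewrite -[leRHS](@mean_cst R); apply: mean_le.
- exact: bmC_Re (bmCZ w bF).
- exact: bmeas_cst.
- by move=> z; apply: le_trans (Re_leC _) _; rewrite cabsM w1 mul1r.
Qed.

Lemma Re_poisson F p r l : cabs l < 1 -> (forall z : C, cabs z < p -> differentiable F z) ->
  0 < r < p -> complex.Re (F (r%:C * l)) = mean (fun z => complex.Re (F (r%:C * zv z)) * poisson l z).
Proof.
move=> l1 dF rp; rewrite -(poisson_formula l1 dF rp) Re_cext; congr mean; apply/funext => z.
by rewrite mulrC Re_RCmul mulrC.
Qed.

Definition hol_disc F := forall z : C, cabs z < 1 -> differentiable F z.

(** Harnack's inequality for the nonnegative real part of 1 - w u, where the unimodular w makes w
    u(t) equal to |u(t)|. On the circle of radius 3/4 the point t is r l with |l| <= 2/3, and (1 -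
    2/3) / (1 + 2/3) = 1/5. *)
Lemma harnack u : hol_disc u -> (forall z, cabs z < 1 -> cabs (u z) <= 1) ->
  forall t, cabs t <= 2^-1 -> (1 - cabs (u 0)) / 5 <= 1 - cabs (u t).
Proof.
move=> du u1 t t2; have [w w1 wM] := rotate (u t).
pose r : R := 3 / 4; have rp : 0 < r < 1 by rewrite /r; lra.
have r0 : 0 < r by rewrite /r; lra.
pose l : R[i] := (r^-1)%:C * t.
have tE : t = r%:C * l by rewrite /l mulrA -rmorphM /= mulfV ?gt_eqF // mul1r.
have l23 : cabs l <= 2 / 3.
  rewrite /l cabsM cabs_real gtr0_norm ?invr_gt0 // /r.
  by rewrite invf_div; have := cabs_ge0 t; lra.
have l1 : cabs l < 1 by apply: le_lt_trans l23 _; lra.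
pose F : C -> C := fun z => 1 - w * u z.
have dF : forall z : C, cabs z < 1 -> differentiable F z.
  move=> z /du uz; apply: differentiableB => //; exact: differentiableZ.
have F0 z : cabs z < 1 -> 0 <= complex.Re (F z).
  move=> /u1 zu; rewrite /F Re_add Re_opp /= subr_ge0; apply: le_trans (Re_leC _) _.
  by rewrite cabsM w1 mul1r.
have bF : bmC (fun z : T => F (r%:C * zv z)) by apply: (hol_bmC dF); rewrite /r; lra.
have -> : 1 - cabs (u t) = complex.Re (F t) by rewrite /F wM.
rewrite [in leRHS]tE (Re_poisson l1 dF rp).
apply: (@le_trans _ _ (complex.Re (F 0) / 5)).
  rewrite ler_pM2r ?invr_gt0 // /F Re_add Re_opp /= lerD2l lerN2.
  by apply: le_trans (Re_leC _) _; rewrite cabsM w1 mul1r.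
rewrite -(mean_hol dF (_ : 0 <= r < 1)); last by rewrite /r; lra.
rewrite Re_cext mulrC -[X in _ * X]/(mean _).
have [_ Z] := linM; rewrite -Z; last exact: bmC_Re.
apply: mean_le.
- by apply: bmeasZ; exact: bmC_Re.
- by apply: bmeasM; [exact: bmC_Re|exact: bmeas_poisson].
- move=> z; rewrite mulrC ler_wpM2l //.
    by apply: F0; rewrite cabsM cabs_circle mulr1 cabs_real gtr0_norm // /r; lra.
  apply: le_trans (poisson_ge l1 z); have l0 := cabs_ge0 l.
  by rewrite ler_pdivlMr ?ltr_wpDr //; lra.
Qed.

(** Cauchy's formula on the circle of radius 1/2: the kernel minus 1 + l / zeta is l^2 / (zeta (zeta
    - l)), of modulus at most 2 |l|^2 when |l| <= 1/2. Putting l = 2 t gives the constants. *)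
Lemma taylor2 u (b : R) (A : R[i]) : hol_disc u -> (forall z, cabs z < 1 -> cabs (u z) <= b) ->
  has_cderiv u 0 A ->
  cabs A <= 2 * b /\
  forall t, cabs t <= 4^-1 -> cabs (u t - u 0 - A * t) <= 8 * b * cabs t ^+ 2.
Proof.
move=> du ub uA; pose r : R := 2^-1; have rp : 0 < r < 1 by rewrite /r; lra.
have r0 : 0 < r by rewrite /r; lra.
have b0 : 0 <= b by apply: le_trans (ub 0 _); rewrite ?cabs_ge0 ?cabs0.
have rz (z : T) : cabs (r%:C * zv z) < 1 by rewrite cabsM cabs_circle mulr1 cabs_real gtr0_norm // /r; lra.
have bu : bmC (fun z : T => u (r%:C * zv z)) by apply: (hol_bmC du); rewrite /r; lra.
have bzJ : bmC (fun z : T => (zv z)^*%C) by exact: bmCJ (bmC_circle_val R).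
pose a := M (fun z => u (r%:C * zv z) * (zv z)^*%C).
have step l : cabs l <= 2^-1 -> cabs (u (r%:C * l) - u 0 - l * a) <= 2 * b * cabs l ^+ 2.
  move=> l2; have l1 : cabs l < 1 by apply: le_lt_trans l2 _; lra.
  have bA := bmCM bu (bmC_cauchy l1); have bB := bmCM bu bzJ.
  rewrite -(cauchy_formula l1 du rp) -[u 0](mean_hol du (_ : 0 <= r < 1)); last by rewrite /r; lra.
  rewrite -(cextB linM bA bu) /a -(cextZ linM l bB) -(cextB linM (bmCB bA bu) (bmCZ l bB)).
  apply: M_norm; first exact: bmCB (bmCB bA bu) (bmCZ l bB).
  move=> z; have z0 := circle_val_neq0 z; have zl := circle_subr_neq0 l1 z.
  rewrite (_ : _ - _ = u (r%:C * zv z) * l ^+ 2 * ((zv z)^-1 * (zv z - l)^-1)); last first.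
    by rewrite circle_conj; field; rewrite z0 zl.
  rewrite !cabsM !cabsV cabs_circle invr1 mul1r -expr2 ler_pdivrMr ?cabs_gt0 //.
  have zl2 : 2^-1 <= cabs (zv z - l).
    by have := cabsD (zv z - l) l; rewrite subrK cabs_circle; lra.
  apply: (@le_trans _ _ (b * cabs l ^+ 2)).
    by apply: ler_wpM2r; rewrite ?exprn_ge0 ?cabs_ge0 //; exact: ub.
  have X0 : 0 <= b * cabs l ^+ 2 by rewrite mulr_ge0 // exprn_ge0 // cabs_ge0.
  have := ler_wpM2l X0 zl2; rewrite -[2 * b * _]mulrA -[2 * _ * _]mulrA.
  move: (b * cabs l ^+ 2 * cabs (zv z - l)) (b * cabs l ^+ 2) => XY X; clear; lra.
have fac t : cabs t <= 4^-1 -> cabs (u t - u 0 - (2 * a) * t) <= 8 * b * cabs t ^+ 2.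
  move=> t4; have := step (2 * t); rewrite cabsM cabs2.
  have -> : r%:C * (2 * t) = t.
    by rewrite mulrA -[2](rmorph_nat (real_complex R)) -rmorphM /= mulVf ?mul1r // pnatr_eq0.
  have -> : 2 * t * a = 2 * a * t by ring.
  have -> : 2 * b * (2 * cabs t) ^+ 2 = 8 * b * cabs t ^+ 2 by ring.
  by apply; lra.
have -> : A = 2 * a.
  apply: (has_cderiv_unique uA) => e e0.
  exists (Num.min 4^-1 (e / (8 * b + 1))).
    by rewrite lt_min invr_gt0 ltr0n divr_gt0 // ltr_wpDl // mulr_ge0.
  move=> w; rewrite subr0 lt_min => /andP[/ltW w4]; rewrite ltr_pdivlMr; last by rewrite ltr_wpDl // mulr_ge0.
  move=> we; apply: le_trans (fac _ w4) _.
  rewrite expr2 mulrA ler_wpM2r ?cabs_ge0 //.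
  by move: we; have := cabs_ge0 w; rewrite mulrDr mulr1 mulrC; lra.
split => //; rewrite cabsM cabs2 ler_wpM2l //.
apply: M_norm; first exact: bmCM.
by move=> z; rewrite cabsM cabsJ cabs_circle mulr1; exact: ub.
Qed.

Lemma taylor2_at u (z0 : C) d b (A : R[i]) : 0 < d ->
  (forall z : C, cabs (z - z0) < d -> differentiable u z) ->
  (forall z, cabs (z - z0) < d -> cabs (u z) <= b) ->
  has_cderiv u z0 A ->
  cabs A <= 2 * b / d /\
  forall t, cabs (t - z0) <= d / 4 ->
    cabs (u t - u z0 - A * (t - z0)) <= 8 * b / d ^+ 2 * cabs (t - z0) ^+ 2.
Proof.
move=> d0 du ub uA; pose v : C -> C := fun z => u (z0 + d%:C * z).
have dn0 : d%:C != 0 :> R[i] by rewrite -cabs_gt0 cabs_real normr_gt0 gt_eqF.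
have vz z : cabs z < 1 -> cabs (z0 + d%:C * z - z0) < d.
  by move=> z1; rewrite addrC addKr cabsM cabs_real gtr0_norm // gtr_pMr.
have dv : hol_disc v.
  move=> z z1; apply: (@differentiable_comp _ _ _ _ (fun z : C => z0 + d%:C * z : C) u).
    by apply: differentiableD => //; exact: differentiableZ.
  by apply: du; exact: vz.
have vA : has_cderiv v 0 (A * d%:C).
  move=> e e0; have [d' d'0 Hd'] := uA _ (divr_gt0 e0 d0).
  exists (d' / d); first by rewrite divr_gt0.
  move=> w; rewrite subr0 ltr_pdivlMr // => wd; have := Hd' (z0 + d%:C * w).
  rewrite addrC addKr cabsM cabs_real gtr0_norm // mulrC => /(_ wd).
  have -> : e / d * (cabs w * d) = e * cabs w by field; rewrite gt_eqF.
  by rewrite /v mulr0 addr0 mulrA.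
have [A2 T2] := taylor2 dv (fun z z1 => ub _ (vz z z1)) vA.
split.
  by move: A2; rewrite cabsM cabs_real gtr0_norm // -ler_pdivlMr.
move=> t td; have := T2 ((d^-1)%:C * (t - z0)).
rewrite cabsM cabs_real gtr0_norm ?invr_gt0 // /v mulr0 addr0.
rewrite [d%:C * (_ * _)]mulrA -rmorphM /= mulfV ?gt_eqF // mul1r subrKC.
rewrite [A * _ * _]mulrA -[A * d%:C * _]mulrA -rmorphM /= mulfV ?gt_eqF // mulr1.
have -> : 8 * b * (d^-1 * cabs (t - z0)) ^+ 2 = 8 * b / d ^+ 2 * cabs (t - z0) ^+ 2.
  by rewrite exprMn exprVn mulrA.
apply.
by rewrite mulrC ler_pdivrMr // mulrC.
Qed.

(** Without a zero, z / F(z) would be holomorphic and vanish at 0, whereas its real part is positive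
    on the circle of radius r; this contradicts the mean value property and stands in for the
    argument principle. *)
Lemma zero_in_disc F r : hol_disc F -> 0 < r < 1 ->
  (forall z, cabs z = r -> 0 < complex.Re (z^*%C * F z)) -> exists2 z, cabs z < 1 & F z = 0.
Proof.
move=> dF rp pos; have /andP[r0 r1] := rp.
apply: contrapT => nz.
have F0 z : cabs z < 1 -> F z != 0 by move=> z1; apply/eqP => Fz; apply: nz; exists z.
pose u : C -> C := fun z => z * (F z)^-1.
have du : hol_disc u.
  move=> z z1; have dV : differentiable (fun z : C => (F z)^-1 : C) z.
    by apply: differentiableV; [exact: dF|exact: F0].
  have did : differentiable (id : C -> C) z by [].
  exact: (differentiableM did dV).
have := mean_hol du (_ : 0 <= r < 1); rewrite ltW // => /(_ r1).
rewrite /u mul0r => /(congr1 (@complex.Re R)); rewrite Re_cext /=.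
have rz (z : R[i]) : cabs z = 1 -> cabs (r%:C * z) = r.
  by move=> z1; rewrite cabsM z1 mulr1 cabs_real gtr0_norm.
pose f (z : C) : R := complex.Re (u (r%:C * z)).
have fpos z : cabs z = 1 -> 0 < f z.
  move=> z1; have := pos _ (rz _ z1); set w := r%:C * z; rewrite /f -/w /u => wF.
  have Fw : F w != 0 by apply: F0; rewrite rz.
  rewrite (invcE Fw) mulrA mulrC Re_RCmul mulr_gt0 ?invr_gt0 ?exprn_gt0 ?cabs_gt0 //.
  by move: wF; case: (w) (F w) => [a b] [c d] /=; lra.
(* The minimum over the compact circle turns pointwise positivity into positivity of the mean. *)
have [||| c /set_mem /= c1 cmin] := @compact_EVT_min C R f [set z | cabs z = 1].
- by exists 1; rewrite /= cabs1.
- exact: circle_compact.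
- apply: continuous_in_subspaceT => z; rewrite inE /= => z1; rewrite /f.
  have D : differentiable (fun z : C => u (r%:C * z)) z.
    apply: (@differentiable_comp _ _ _ _ (fun z : C => r%:C * z : C) u).
      exact: differentiableZ.
    by apply: du; rewrite rz.
  exact: (Re_comp_continuous (differentiable_continuous D)).
move=> m0; have : f c <= mean (fun z => f (zv z)).
  rewrite -[leLHS](@mean_cst R); apply: mean_le.
  - exact: bmeas_cst.
  - by apply: bmC_Re; apply: (hol_bmC du); rewrite ltW.
  - by move=> z; apply: cmin; rewrite inE /= cabs_circle.
rewrite /f /u m0; have := fpos _ c1; rewrite /f /u; lra.
Qed.

Lemma cts_le_left (f : R -> R) a b : a < b -> {for b, continuous f} ->
  (forall x, a < x < b -> f x <= 0) -> f b <= 0.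
Proof.
move=> ab /cvgrPdist_lt fa fc.
apply/ler_addgt0Pr => e e0; rewrite add0r.
have /nbhs_ballP[d /= d0 Hd] := fa e e0.
pose x := b - Num.min (d / 2) ((b - a) / 2).
have m0 : 0 < Num.min (d / 2) ((b - a) / 2) by rewrite lt_min !divr_gt0 // subr_gt0.
have m1 : Num.min (d / 2) ((b - a) / 2) <= d / 2 by rewrite ge_min lexx.
have m2 : Num.min (d / 2) ((b - a) / 2) <= (b - a) / 2 by rewrite ge_min lexx orbT.
have := fc x; have : `|f b - f x| < e.
  by apply: Hd; rewrite /ball /= /x opprB addrC subrK gtr0_norm //; lra.
rewrite ltr_norml => /andP[_ h] /(_ _); move: h; rewrite /x => h H.
have := H (_ : a < _ < b); rewrite /x; move=> /(_ _); lra.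
Qed.

(* F - id is an infinitesimal generator in the sense of Berkson and Porta. *)
Lemma self_map_generator F l : hol_disc F -> (forall z, cabs z < 1 -> cabs (F z) <= 1) ->
  cabs l < 1 -> complex.Re (l^*%C * F l) <= (1 - cabs l ^+ 2) * complex.Re (l^*%C * F 0) + cabs l ^+ 2.
Proof.
move=> dF F1 l1; set A := complex.Re (_ * F l); set B := complex.Re (_ * F 0).
have l0 := cabs_ge0 l; set c := cabs l ^+ 2.
(* The Schwarz formula on the circle of radius r, where the radial weight of F has real part at most
   1; the inequality has been multiplied by r^2. At r = 1 it is the claim, which is reached by
   continuity in r. *)
have key r : cabs l < r < 1 -> r ^+ 2 * A - (r ^+ 2 - c) * B - r * c <= 0.
  move=> /andP[lr r1]; have r0 : 0 < r := le_lt_trans l0 lr.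
  have rn0 : r%:C != 0 :> R[i] by rewrite -cabs_gt0 cabs_real normr_gt0 gt_eqF.
  pose l' : R[i] := (r^-1)%:C * l.
  have lE : l = r%:C * l' by rewrite /l' mulrA -rmorphM /= mulfV ?gt_eqF // mul1r.
  have l'E : cabs l' = cabs l / r by rewrite /l' cabsM cabs_real gtr0_norm ?invr_gt0 // mulrC.
  have l'1 : cabs l' < 1 by rewrite l'E ltr_pdivrMr // mul1r.
  have rp : 0 < r < 1 by rewrite r0.
  have bF : bmC (fun z : T => F (r%:C * zv z)) by apply: (hol_bmC dF); rewrite ltW.
  pose k := radial_weight F r.
  have bk : bmC k by apply: bmCM bF; exact: bmCJ (bmC_circle_val R).
  have k1 z : complex.Re (k z) <= 1.
    apply: le_trans (Re_leC _) _; rewrite cabsM cabsJ cabs_circle mul1r; apply: F1.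
    by rewrite cabsM cabs_circle mulr1 cabs_real gtr0_norm.
  have := schwarz_formula l'1 dF rp; rewrite -/k -lE; cbv zeta.
  set S := M _; set m := mean _ => FE.
  have S1 : complex.Re S <= 1.
    rewrite /S Re_cext -[leRHS](@mean_poisson R l') //.
    rewrite -[X in _ <= X]/(mean _); apply: mean_le.
    - apply: bmC_Re; apply: bmCM (bmC_schwarz l'1); apply: bmC_real; exact: bmC_Re.
    - exact: bmeas_poisson.
    - move=> z; rewrite Re_RCmul -/(poisson l' z) ler_piMl ?k1 //.
      exact: ltW (poisson_gt0 l'1 z).
  have : r * complex.Re (l'^*%C * F l) <= (1 - cabs l' ^+ 2) * (r * complex.Re (l'^*%C * F 0)) + cabs l' ^+ 2 * r.
    have -> : complex.Re (l'^*%C * F l) = (1 - cabs l' ^+ 2) * complex.Re (l'^*%C * F 0) + cabs l' ^+ 2 * complex.Re S.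
      rewrite FE cabs_sqr; case: (l') (F 0) (S) (m) => [a b] [c1 d] [e f] g /=; ring.
    rewrite mulrDr [r * ((1 - _) * _)]mulrCA lerD2l mulrCA ler_wpM2l ?exprn_ge0 ?cabs_ge0 //.
    by rewrite -[leRHS]mulr1 ler_wpM2l // ltW.
  have JE (w : R[i]) : r * complex.Re (l'^*%C * w) = complex.Re (l^*%C * w).
    by rewrite -Re_RCmul mulrA -[r%:C]conjc_real -conjcM -lE.
  rewrite !JE l'E -/A -/B expr_div_n -/c => H.
  have r2 : 0 < r ^+ 2 by rewrite exprn_gt0.
  have := ler_wpM2l (ltW r2) H.
  have -> : r ^+ 2 * ((1 - c / r ^+ 2) * B + c / r ^+ 2 * r) = (r ^+ 2 - c) * B + c * r.
    by field; rewrite gt_eqF.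
  lra.
suff : 1 ^+ 2 * A - (1 ^+ 2 - c) * B - 1 * c <= 0 by rewrite expr1n; lra.
apply: (@cts_le_left (fun r => r ^+ 2 * A - (r ^+ 2 - c) * B - r * c) (cabs l)) => //.
have c2 : {for 1, continuous (fun r : R => r ^+ 2)} by exact: exprn_continuous.
apply: continuousB; last by apply: continuousM; [exact: cvg_id|exact: cst_continuous].
apply: continuousB.
  by apply: continuousM => //; exact: cst_continuous.
apply: continuousM; last exact: cst_continuous.
by apply: continuousB => //; exact: cst_continuous.
Qed.

(** With F(0) = 0 and no real radial weight, the Schwarz formula leaves an imaginary multiple of l.
    Its constant is found for each radius separately; the constants are compared at the point
    1/4. *)
Lemma imaginary_radial F : hol_disc F -> F 0 = 0 ->
  (forall z, cabs z < 1 -> complex.Re (z^*%C * F z) = 0) ->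
  exists c : R, forall z, cabs z < 1 -> F z = 'i%C * c%:C * z.
Proof.
move=> dF F0 Fre.
have key r : 0 < r < 1 -> exists c : R, forall z, cabs z < r -> F z = 'i%C * c%:C * z.
  move=> rp; have /andP[r0 r1] := rp.
  have rn0 : r%:C != 0 :> R[i] by rewrite -cabs_gt0 cabs_real normr_gt0 gt_eqF.
  pose k := radial_weight F r.
  have k0 z : complex.Re (k z) = 0.
    apply: (mulfI (negbT (gt_eqF r0))); rewrite mulr0 -Re_RCmul /k /radial_weight mulrA.
    have := Fre (r%:C * zv z); rewrite cabsM cabs_circle mulr1 cabs_real gtr0_norm // => /(_ r1).
    by rewrite conjcM conjc_real.
  exists (mean (fun z => complex.Im (k z)) / r) => z zr.
  pose l : R[i] := (r^-1)%:C * z.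
  have zE : z = r%:C * l by rewrite /l mulrA -rmorphM /= mulfV ?gt_eqF // mul1r.
  have l1 : cabs l < 1.
    by rewrite /l cabsM cabs_real gtr0_norm ?invr_gt0 // mulrC ltr_pdivrMr // mul1r.
  rewrite {1}zE (schwarz_formula l1 dF rp) F0 conjc0 mul0r subrr add0r -/k.
  under eq_fun do rewrite k0 mul0r.
  rewrite M_cst add0r; move: (mean _) => m.
  by rewrite rmorphM /l mulrC -!mulrA.
have h12 : (0 : R) < (2^-1 : R) < (1 : R) by clear F0; lra.
have [c1 H1] := key _ h12; exists c1 => z z1.
have [r rp zr] : exists2 r : R, 2^-1 < r < 1 & cabs z < r.
  by exists ((Num.max 2^-1 (cabs z) + 1) / 2); case: (leP 2^-1 (cabs z)) => h; clear F0; lra.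
have rp' : 0 < r < 1 by clear F0; lra.
have [c2 H2] := key r rp'.
rewrite (H2 _ zr); congr (_ * _%:C * _).
pose w : R[i] := (4^-1)%:C.
have wn : cabs w = 4^-1 by rewrite cabs_real ger0_norm.
have w0 : w != 0 by rewrite -cabs_gt0 wn.
have i0 : 'i%C != 0 :> R[i] by rewrite -cabs_gt0 cabs_i.
have w12 : cabs w < 2^-1 by rewrite wn; clear F0; lra.
have wr : cabs w < r by rewrite wn; clear F0; lra.
have : 'i%C * c2%:C * w = 'i%C * c1%:C * w by rewrite -(H1 _ w12) -(H2 _ wr).
by move=> /(mulIf w0)/(mulfI i0)/complexI.
Qed.

Lemma cauchy_converges (a : nat -> R) :
  (forall e, 0 < e -> exists N, forall n m, (N <= n)%N -> (N <= m)%N -> `|a n - a m| <= e) ->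
  exists b, forall e, 0 < e -> exists N, forall n, (N <= n)%N -> `|a n - b| <= e.
Proof.
move=> H; have : cvg (a @ \oo).
  apply/cauchy_cvgP/cauchy_exP => e e0.
  have [N HN] := H (e / 2) (divr_gt0 e0 (ltr0n R 2)).
  exists (a N), N => // n /= Nn; rewrite -ball_normE /=.
  by apply: le_lt_trans (HN _ _ (leqnn N) Nn) _; lra.
move=> /cvgrPdist_le ac; exists (lim (a @ \oo)) => e /ac[N _ HN].
by exists N => n /HN; rewrite distrC.
Qed.

(** The common bound [b] makes the second-order Taylor remainder at z0 uniform in n. Hence the
    derivatives at z0 are controlled by the values at z0 and at one nearby point, they form a Cauchy
    sequence, and the expansion passes to the limit. *)
Lemma pointwise_limit_differentiable (U : nat -> C -> C) u (z0 : C) d b : 0 < d ->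
  (forall n (z : C), cabs (z - z0) < d -> differentiable (U n) z) ->
  (forall n z, cabs (z - z0) < d -> cabs (U n z) <= b) ->
  (forall z, cabs (z - z0) < d -> forall e, 0 < e ->
     exists N, forall n, (N <= n)%N -> cabs (U n z - u z) <= e) ->
  differentiable u z0.
Proof.
move=> d0 dU Ub Uu.
have z0d : cabs (z0 - z0) < d by rewrite subrr cabs0.
pose a n : R[i] := 'd (U n) z0 1.
have Ua n : has_cderiv (U n) z0 (a n) by apply/differentiable_cderiv/dU.
have b0 : 0 <= b by apply: le_trans (Ub 0%N z0 z0d); exact: cabs_ge0.
pose K := 8 * b / d ^+ 2; have K0 : 0 <= K by rewrite divr_ge0 ?exprn_ge0 ?mulr_ge0 // ltW.
have T n t : cabs (t - z0) <= d / 4 -> cabs (U n t - U n z0 - a n * (t - z0)) <= K * cabs (t - z0) ^+ 2.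
  exact: (taylor2_at d0 (dU n) (Ub n) (Ua n)).2.
have ca e : 0 < e -> exists N, forall n m, (N <= n)%N -> (N <= m)%N -> cabs (a n - a m) <= e.
  (* With K s <= e / 4 the two Taylor remainders take e s / 2; the four errors e s / 8 in the values
     take the other half. *)
  move=> e0; pose s := Num.min (d / 4) (e / 4 / (K + 1)).
  have K1 : 0 < K + 1 by rewrite ltr_wpDl.
  have s0 : 0 < s by rewrite lt_min !divr_gt0.
  have sd : s <= d / 4 by rewrite ge_min lexx.
  have sK : K * s <= e / 4.
    have : s <= e / 4 / (K + 1) by rewrite ge_min lexx orbT.
    rewrite ler_pdivlMr // mulrDr mulr1 mulrC; lra.
  pose t := z0 + s%:C; have tE : cabs (t - z0) = s by rewrite /t addrC addKr cabs_real gtr0_norm.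
  have td : cabs (t - z0) < d by rewrite tE; lra.
  have es : 0 < e * s / 8 by rewrite divr_gt0 // mulr_gt0.
  have [N1 HN1] := Uu t td _ es; have [N2 HN2] := Uu z0 z0d _ es.
  exists (maxn N1 N2) => n m; rewrite !geq_max => /andP[n1 n2] /andP[m1 m2].
  rewrite -(ler_pM2r s0) -[X in _ * X <= _]tE -cabsM.
  have Tn := T n t; have Tm := T m t; move: Tn Tm; rewrite tE => /(_ sd) Tn /(_ sd) Tm.
  have A1 := HN1 _ n1; have A2 := HN1 _ m1; have A3 := HN2 _ n2; have A4 := HN2 _ m2.
  have E (an am h Umt Unt Um0 Un0 ut u0 : R[i]) : (an - am) * h =
      (Umt - Um0 - am * h) - (Unt - Un0 - an * h) + ((Unt - ut) - (Umt - ut) - ((Un0 - u0) - (Um0 - u0))).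
    by ring.
  rewrite (E _ _ _ (U m t) (U n t) (U m z0) (U n z0) (u t) (u z0)).
  have sK2 : K * s ^+ 2 <= e / 4 * s by rewrite expr2 mulrA ler_wpM2r // ltW.
  apply: le_trans (cabsD _ _) _; apply: le_trans (lerD (cabsB _ _) (cabsB _ _)) _.
  have B1 := le_trans (cabsB (U n t - u t) (U m t - u t)) (lerD A1 A2).
  have B2 := le_trans (cabsB (U n z0 - u z0) (U m z0 - u z0)) (lerD A3 A4).
  apply: le_trans (lerD (lerD Tm Tn) (lerD B1 B2)) _.
  move: sK2; rewrite [e / 4 * s]mulrAC; move: (K * s ^+ 2) (e * s) => X Y; clear; lra.
have [cr Hcr] : exists c, forall e, 0 < e -> exists N, forall n, (N <= n)%N -> `|complex.Re (a n) - c| <= e.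
  apply: cauchy_converges => e /ca[N HN]; exists N => n m Nn Nm.
  by apply: le_trans (HN _ _ Nn Nm); rewrite -Re_opp -Re_add Re_le_cabs.
have [ci Hci] : exists c, forall e, 0 < e -> exists N, forall n, (N <= n)%N -> `|complex.Im (a n) - c| <= e.
  apply: cauchy_converges => e /ca[N HN]; exists N => n m Nn Nm.
  by apply: le_trans (HN _ _ Nn Nm); rewrite -Im_opp -Im_add Im_le_cabs.
pose A : R[i] := cr +i* ci.
apply: (@cderiv_differentiable _ _ _ A) => e e0.
pose D := Num.min (d / 4) (e / (K + 1)).
have K1 : 0 < K + 1 by rewrite ltr_wpDl.
exists D; first by rewrite lt_min !divr_gt0.
move=> w; rewrite lt_min => /andP[wd wK]; have W0 := cabs_ge0 (w - z0).
apply: (@le_trans _ _ (K * cabs (w - z0) ^+ 2)); last first.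
  by rewrite expr2 mulrA ler_wpM2r //; move: wK; rewrite ltr_pdivlMr // mulrDr mulr1 mulrC; lra.
apply/ler_addgt0Pr => e' e'0.
pose h := e' / 4; have h0 : 0 < h by rewrite divr_gt0.
pose g := e' / 4 / (d + 1); have d1 : 0 < d + 1 by rewrite ltr_wpDl // ltW.
have g0 : 0 < g by rewrite !divr_gt0.
have wd' : cabs (w - z0) < d.
  by apply: lt_trans wd _; rewrite ltr_pdivrMr // ltr_pMr // ltr1n.
have [N1 H1] := Uu w wd' _ h0.
have [N2 H2] := Uu z0 z0d _ h0; have [N3 H3] := Hcr _ g0; have [N4 H4] := Hci _ g0.
pose n := (N1 + N2 + N3 + N4)%N.
have {}H1 := H1 n (_ : _ <= n)%N; have {}H2 := H2 n (_ : _ <= n)%N.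
have {}H3 := H3 n (_ : _ <= n)%N; have {}H4 := H4 n (_ : _ <= n)%N.
move: H1 H2 H3 H4.
move=> /(_ (leq_trans (leq_addr _ _) (leq_trans (leq_addr _ _) (leq_addr _ _)))) H1.
move=> /(_ (leq_trans (leq_addl _ _) (leq_trans (leq_addr _ _) (leq_addr _ _)))) H2.
move=> /(_ (leq_trans (leq_addl _ _) (leq_addr _ _))) H3 /(_ (leq_addl _ _)) H4.
have Aa : cabs (a n - A) * cabs (w - z0) <= e' / 2.
  have : cabs (a n - A) <= 2 * g.
    apply: le_trans (cabs_le_ReIm _) _; rewrite !Re_add !Re_opp !Im_add !Im_opp /=.
    lra.
  have gd : g * (d + 1) = e' / 4 by rewrite /g divfK // gt_eqF.
  have W1 : cabs (w - z0) <= d + 1 by lra.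
  move=> h2; apply: le_trans (ler_pM (cabs_ge0 _) W0 h2 W1) _.
  by rewrite -mulrA gd; lra.
have E (an A' h' Unw Un0 uw u0 : R[i]) : uw - u0 - A' * h' =
    (Unw - Un0 - an * h') + (an - A') * h' - ((Unw - uw) - (Un0 - u0)) by ring.
rewrite (E (a n) A (w - z0) (U n w) (U n z0) (u w) (u z0)).
apply: le_trans (cabsB _ _) _; apply: le_trans (lerD (cabsD _ _) (cabsB _ _)) _.
rewrite cabsM; apply: le_trans (lerD (lerD (T n w (ltW wd)) Aa) (lerD H1 H2)) _.
by rewrite /h; move: (K * _) => X; clear; lra.
Qed.

End DiscFunctions.

(** * Functionals on bounded Borel functions *)
Section Functionals.
Variable R : realType.
Notation T := (borelType (circle R)).
Notation C := R[i]^o.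
Notation zv := (@circle_val R).
Implicit Types (f k : T -> R) (Lam Q : (T -> R) -> R) (l a : R[i]) (b s t : R).

Definition bounded_bm Lam := exists2 K, 0 <= K &
  forall f e, bmeas f -> (forall x, `|f x| <= e) -> `|Lam f| <= K * e.

(** The sum counts the integers from 1 to N that do not exceed y, so it is the integer part of y. *)
Lemma staircase (N : nat) (y : R) : 0 <= y <= N%:R ->
  `|y - \sum_(i < N) ((i.+1%:R <= y)%R : nat)%:R| <= 1.
Proof.
elim: N y => [|N ih] y /andP[y0 yN].
  by rewrite big_ord0 subr0 ger0_norm // (le_trans yN).
rewrite big_ord_recl /=; have [y1|y1] := leP 1 y.
  have -> : y - (1 + \sum_(i < N) (((bump 0 i).+1%:R <= y)%R : nat)%:R) =
      (y - 1) - \sum_(i < N) ((i.+1%:R <= y - 1)%R : nat)%:R.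
    rewrite opprD addrA; congr (_ - _); apply: eq_bigr => i _.
    by rewrite lerBrDr natr1.
  by apply: ih; rewrite subr_ge0 y1 lerBlDr natr1.
rewrite add0r big1 ?subr0 ?ger0_norm ?(ltW y1) // => i _.
rewrite leNgt (lt_le_trans y1) //.
by rewrite ler1n.
Qed.

(** Compares integrals built from different measures through their values on sets: f is within [d]
    of a staircase [g] on its superlevel sets, and both functionals are continuous for the uniform
    norm. *)
Lemma functional_ext Lam Q : linear_bm Lam -> linear_bm Q -> bounded_bm Lam -> bounded_bm Q ->
  (forall A, measurable A -> Lam (\1_A) = Q (\1_A)) -> forall f, bmeas f -> Lam f = Q f.
Proof.
move=> linL linQ [K K0 HK] [K' K'0 HK'] ind f bf.
have [mf [B Bf]] := bf; pose M := `|B| + 1; have M0 : 0 < M by rewrite ltr_wpDl.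
have fM x : 0 <= f x + M <= 2 * M.
  have := Bf x; have := ler_norm B; rewrite ler_norml => h1 /andP[h2 h3].
  by rewrite /M; lra.
apply/eqP; rewrite -subr_eq0 -normr_le0; apply/ler_addgt0Pr => e e0; rewrite add0r.
pose N := (Num.bound ((K + K') * (2 * M) / e)).+1.
have N0 : 0 < N%:R :> R by rewrite ltr0n.
pose d := 2 * M / N%:R; have d0 : 0 < d by rewrite divr_gt0 // mulr_gt0.
pose A (i : 'I_N) : set T := [set x | i.+1%:R * d - M <= f x].
have mA i : measurable (A i).
  have -> : A i = f @^-1` `[i.+1%:R * d - M, +oo[%classic.
    by apply/seteqP; split => x /=; rewrite in_itv /= andbT.
  by rewrite -[X in measurable X]setTI; exact: mf.
pose g x := \sum_(i < N) d * \1_(A i) x - M.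
have bi i : bmeas (fun x => d * \1_(A i) x) by apply: bmeasZ; exact: bmeas_indic.
have bs : bmeas (fun x => \sum_(i < N) d * \1_(A i) x) by exact: bmeas_sum.
have bg : bmeas g by apply: bmeasB => //; exact: bmeas_cst.
have fg x : `|f x - g x| <= d.
  have : 0 <= (f x + M) / d <= N%:R.
    have /andP[h1 h2] := fM x; rewrite divr_ge0 ?(ltW d0) //= ler_pdivrMr //.
    by rewrite /d mulrC divfK // gt_eqF.
  move=> /staircase; rewrite -(ler_pM2l d0) mulr1; apply: le_trans.
  rewrite -[X in _ <= X * _](gtr0_norm d0) -normrM mulrBr mulrC divfK ?gt_eqF //.
  rewrite /g opprB addrCA addrA [M + _]addrC mulr_sumr.
  rewrite le_eqVlt; apply/orP; left; apply/eqP; congr `|_ - _|; apply: eq_bigr => i _.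
  rewrite indicE ler_pdivlMr //; congr (_ * (nat_of_bool _)%:R).
  by apply/idP/idP; rewrite inE /A /= lerBlDr.
have Lsum L : linear_bm L -> L g = \sum_(i < N) d * L (\1_(A i)) - M * L (fun=> 1).
  move=> linl; rewrite /g (linear_bmB linl) //; last exact: bmeas_cst.
  case: linl => D Z; congr (_ - _); last first.
    rewrite -Z; last exact: bmeas_cst.
    by congr L; apply/funext => x; rewrite mulr1.
  elim: (N) A mA bi {bs bg fg g} => [|n ih] A mA bi.
    under eq_fun do rewrite big_ord0; rewrite big_ord0.
    by have := Z 0 (fun=> 0) (bmeas_cst 0); rewrite !mul0r.
  under eq_fun do rewrite big_ord_recr /=; rewrite big_ord_recr /= D; first last.
  - exact: bi.
  - by apply: bmeas_sum => i; exact: bi.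
  by rewrite ih // Z //; apply: bmeas_indic.
have one : Lam (fun=> 1) = Q (fun=> 1).
  by rewrite (_ : (fun=> 1) = \1_setT) ?ind //; apply/funext => x; rewrite indicE in_setT.
have LQ : Lam g = Q g.
  by rewrite !Lsum // one; congr (_ - _); apply: eq_bigr => i _; rewrite ind.
have bfg : bmeas (fun x => f x - g x) by exact: bmeasB.
have h1 := HK _ _ bfg fg; have h2 := HK' _ _ bfg fg.
rewrite (linear_bmB linL) // in h1; rewrite (linear_bmB linQ) // in h2.
have Kd : (K + K') * d <= e.
  rewrite /d mulrA ler_pdivrMr // [e * _]mulrC -ler_pdivrMr //.
  apply: le_trans (ltW (archi_boundP _)) _.
    by rewrite !mulr_ge0 ?addr_ge0 ?invr_ge0 ?(ltW M0) ?(ltW e0).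
  by rewrite ler_nat.
have -> : Lam f - Q f = (Lam f - Lam g) - (Q f - Q g) by rewrite LQ; ring.
apply: le_trans (ler_normB _ _) _; apply: le_trans (lerD h1 h2) _.
by rewrite -mulrDl.
Qed.

Lemma bounded_wint (m : {measure set T -> \bar R}) u : L1 m u -> bounded_bm (wint m u).
Proof.
move=> iu; exists (\int[m]_x `|u x|); first exact: Rintegral_ge0.
by move=> f e bf fe; rewrite mulrC; exact: wint_norm.
Qed.

Lemma linear_bm_add Lam Q c d : linear_bm Lam -> linear_bm Q ->
  linear_bm (fun f => c * Lam f + d * Q f).
Proof.
move=> [D Z] [D' Z']; split=> [f g bf bg|e f bf]; first by rewrite D // D' //; ring.
by rewrite Z // Z' //; ring.
Qed.

Lemma bounded_bm_add Lam Q c d : bounded_bm Lam -> bounded_bm Q ->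
  bounded_bm (fun f => c * Lam f + d * Q f).
Proof.
move=> [K K0 HK] [K' K'0 HK']; exists (`|c| * K + `|d| * K').
  by rewrite addr_ge0 // mulr_ge0.
move=> f e bf fe; apply: le_trans (ler_normD _ _) _; rewrite !normrM mulrDl -!mulrA.
by apply: lerD; apply: ler_wpM2l => //; [exact: HK|exact: HK'].
Qed.

Lemma L1_1 (m : {finite_measure set T -> \bar R}) : L1 m (fun=> 1).
Proof.
apply: bmeas_L1; last exact: bmeas_cst.
by rewrite ltey_eq fin_num_measure.
Qed.

(** An instance of [functional_ext]: on indicators both sides equal mu(A), by [jordan_decomp] on the
    left and by hypothesis on the right, whichever Hahn decomposition was chosen. *)
Lemma charge_RintegralE (mu : {charge set T -> \bar R}) (m1 m2 : {measure set T -> \bar R})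
    (u w : T -> R) : L1 m1 u -> L1 m2 w ->
  (forall A, measurable A -> mu A = (\int[m1]_(z in A) (u z)%:E + \int[m2]_(z in A) (w z)%:E)%E) ->
  forall f, bmeas f -> charge_Rintegral mu f = wint m1 u f + wint m2 w f.
Proof.
move=> iu iw muE; rewrite /charge_Rintegral.
case: cid => P exN; case: cid => N nuPN.
set mp := jordan_pos nuPN; set mn := jordan_neg nuPN => f bf.
pose Lam f := 1 * wint mp (fun=> 1) f + (-1) * wint mn (fun=> 1) f.
pose Q f := 1 * wint m1 u f + 1 * wint m2 w f.
have w1 (m : {measure set T -> \bar R}) (h : T -> R) : wint m (fun=> 1) h = \int[m]_x h x.
  by apply: eq_Rintegral => x _; rewrite mulr1.
transitivity (Lam f); first by rewrite /Lam !w1 mul1r mulN1r.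
transitivity (Q f); last by rewrite /Q !mul1r.
have lp := linear_wint (L1_1 mp); have ln := linear_wint (L1_1 mn).
have bp := bounded_wint (L1_1 mp); have bn := bounded_wint (L1_1 mn).
apply: functional_ext bf.
- exact: linear_bm_add.
- by apply: linear_bm_add; exact: linear_wint.
- exact: bounded_bm_add.
- by apply: bounded_bm_add; exact: bounded_wint.
move=> A mA; rewrite /Lam /Q !mul1r mulN1r !w1.
have ri (m : {measure set T -> \bar R}) v : wint m v (\1_A) = fine (\int[m]_(z in A) (v z)%:E)%E.
  rewrite /wint /Rintegral; congr fine; rewrite [RHS]integral_mkcond.
  apply: eq_integral => x _; rewrite patchE /= indicE mulrC.
  by case: (_ \in _); rewrite ?mulr1 ?mulr0.
have i1 (m : {finite_measure set T -> \bar R}) : \int[m]_x (\1_A x : R) = fine (m A).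
  by rewrite /Rintegral integral_indic // setIT.
have fi (m : {measure set T -> \bar R}) v : L1 m v -> (\int[m]_(z in A) (v z)%:E)%E \is a fin_num.
  by move=> iv; apply: integrable_fin_num => //; exact: integrableS iv.
rewrite !i1 !ri -fineD ?fi // -muE // (jordan_decomp nuPN mA) /cadd /= /cscale /=.
rewrite mulN1e fineB //; exact: fin_num_measure.
Qed.

Lemma charge_CintegralE (mu : {charge set T -> \bar R}) (m1 m2 : {measure set T -> \bar R})
    (u w : T -> R) : L1 m1 u -> L1 m2 w ->
  (forall A, measurable A -> mu A = (\int[m1]_(z in A) (u z)%:E + \int[m2]_(z in A) (w z)%:E)%E) ->
  forall F, bmC F -> charge_Cintegral mu F = cext (fun f => wint m1 u f + wint m2 w f) F.
Proof. by move=> iu iw muE F [bR bI]; congr Complex; exact: charge_RintegralE. Qed.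

Definition hpol a b l : R[i] := a^*%C + b%:C * l + a * l ^+ 2.

Definition kpol a b (z : T) : R := b + 2 * complex.Re (a * zv z).

Lemma kpolE a b z : (kpol a b z)%:C = b%:C + a * zv z + a^*%C / zv z.
Proof.
rewrite -(circle_conj z) -conjcM -addrA /kpol.
by apply: complexP; rewrite !ReImE /=; ring.
Qed.

Lemma kpol_hpol a b z : (zv z)^*%C * hpol a b (zv z) = (kpol a b z)%:C.
Proof.
rewrite kpolE circle_conj /hpol; field; exact: circle_val_neq0.
Qed.

Lemma bmeas_kpol a b : bmeas (kpol a b).
Proof.
apply: bmeasD; [exact: bmeas_cst|apply: bmeasZ].
by apply: bmC_Re; apply: bmCZ; exact: bmC_circle_val.
Qed.

Lemma hpol_differentiable a b (l : C) : differentiable (hpol a b : C -> C) l.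
Proof.
apply: (@differentiableD _ _ _ (fun l : C => a^*%C + b%:C * l : C) (fun l : C => a * l ^+ 2 : C)).
  by apply: differentiableD => //; apply: differentiableZ.
by apply: (@differentiableM _ _ (fun=> a) (fun l : C => l ^+ 2 : C)) => //; exact: differentiableX.
Qed.

Lemma hpol_le a b l : cabs l <= 1 -> cabs (hpol a b l) <= 2 * cabs a + `|b|.
Proof.
move=> l1; have l0 := cabs_ge0 l; have a0 := cabs_ge0 a.
rewrite /hpol; apply: le_trans (cabsD _ _) _; apply: le_trans (lerD (cabsD _ _) (lexx _)) _.
rewrite cabsJ (cabsM b%:C) cabs_real (cabsM a) cabsX.
have h1 : `|b| * cabs l <= `|b| by rewrite ler_piMr.
have h2 : cabs a * cabs l ^+ 2 <= cabs a by rewrite ler_piMr // expr_le1.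
lra.
Qed.

(** The radial weight of i h is purely imaginary, so its Schwarz formula reduces to a quadratic
    polynomial on the open disc. The circle is reached by continuity along a radius. *)
Lemma entire_hpol (h : C -> C) : (forall z : C, differentiable h z) ->
  (forall z : T, (zv z)^*%C * h (zv z) \is Num.real) ->
  exists b, forall l, cabs l <= 1 -> h l = hpol (h 0)^*%C b l.
Proof.
move=> dh hr; pose F : C -> C := fun z => 'i%C * h z.
have dF (z : C) : cabs z < 2 -> differentiable F z by move=> _; exact: differentiableZ.
have r1 : 0 < (1 : R) < 2 by lra.
pose k := radial_weight F 1; pose c := mean (fun z => complex.Im (k z)).
have k0 z : complex.Re (k z) = 0.
  have /Creal_ImP := hr z; rewrite -complexIm => -[E].
  rewrite /k /radial_weight mul1r /F mulrCA Re_mul E /=; ring.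
exists c => l; have in_disc (w : R[i]) : cabs w < 1 -> h w = hpol (h 0)^*%C c w.
  move=> w1; have /= := schwarz_formula w1 dF r1; rewrite !rmorph1 !mul1r -/k -/c.
  under [X in cext _ X]eq_fun do rewrite k0 rmorph0 mul0r.
  rewrite M_cst add0r /F conjcM => E.
  have i2 : 'i%C * 'i%C = -1 :> R[i] by rewrite -expr2 sqr_i.
  have ic : ('i%C)^*%C = - 'i%C :> R[i] by apply: complexP => /=; ring.
  rewrite ic in E; have : - ('i%C * ('i%C * h w)) = h w by rewrite mulrA i2; ring.
  move=> <-; rewrite E /hpol conjcK.
  transitivity (- ('i%C * 'i%C) * (h 0 + (h 0)^*%C * w ^+ 2 + w * c%:C)); first by ring.
  by rewrite i2; ring.
rewrite le_eqVlt => /predU1P[l1|/in_disc//].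
pose E : C -> C := fun z => h z - hpol (h 0)^*%C c z.
have cE (z : C) : {for z, continuous E}.
  apply: differentiable_continuous; apply: differentiableB; [exact: dh|exact: hpol_differentiable].
apply/eqP; rewrite -subr_eq0 -cabs_eq0; apply/eqP.
have := @cts_eq_left R (fun r => cabs (E (r%:C * l))) 0 1 0 ltr01.
rewrite rmorph1 mul1r; apply.
  apply: (@cts_comp_CR_RC R (fun r => r%:C * l) (fun z => cabs (E z))); last first.
    have /cts_CC cEl := cE (1%:C * l).
    by apply/cts_CR => e /cEl[d d0 Hd]; exists d => // w /Hd; apply: le_lt_trans; exact: cabs_lip.
  apply/cts_RC => e e0; exists e => // x.
  by rewrite -mulrBl cabsM l1 mulr1 -rmorphB cabs_real.
by move=> x /andP[x0 x1]; rewrite /E in_disc ?subrr ?cabs0 // cabsM l1 mulr1 cabs_real gtr0_norm.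
Qed.

Definition schwarz l (z : T) : R[i] := (zv z + l) / (zv z - l).

Definition weighted k Lam : (T -> R) -> R := fun f => Lam (fun z => k z * f z).

Lemma linear_weighted k Lam : bmeas k -> linear_bm Lam -> linear_bm (weighted k Lam).
Proof.
move=> bk [D Z]; split=> [f g bf bg|c f bf]; rewrite /weighted.
  rewrite -D; [|exact: bmeasM..]; congr Lam; apply/funext => x; ring.
rewrite -Z; [|exact: bmeasM]; congr Lam; apply/funext => x; ring.
Qed.

Lemma cext_weighted k Lam F : cext (weighted k Lam) F = cext Lam (fun z => (k z)%:C * F z).
Proof.
by apply: complexP; congr Lam; apply/funext => z; rewrite ?Re_RCmul ?Im_RCmul.
Qed.

Lemma subJ_Im (w : R[i]) : w - w^*%C = 2 * 'i%C * (complex.Im w)%:C.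
Proof.
case: w => x y; apply: complexP; rewrite ?Re_mul ?Im_mul /=; ring.
Qed.

Lemma hpol_schwarz a b l z : cabs l < 1 -> hpol a b l * schwarz l z =
  l * ((kpol a b z)%:C * schwarz l z) + (a^*%C - a * l ^+ 2 -
    2 * 'i%C * l * (complex.Im (a * zv z))%:C).
Proof.
move=> l1; have z0 := circle_val_neq0 z; have zl := circle_subr_neq0 l1 z.
have -> : 2 * 'i%C * l * (complex.Im (a * zv z))%:C = l * (a * zv z - a^*%C / zv z).
  rewrite -(circle_conj z) -conjcM.
  by rewrite subJ_Im; ring.
rewrite kpolE /hpol /schwarz; move: (a^*%C) (b%:C) => a' b'.
by field; rewrite z0 zl.
Qed.

(** The shape of the Schwarz formula: [c] is the value at l = 0 and [t] a free imaginary part.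
    Neither contributes to the real part of conj(l) times the gauge when |l| = 1, see [Re_gauge]. *)
Definition gauge (c : R[i]) t (X l : R[i]) : R[i] := c - c^*%C * l ^+ 2 + l * (X + 'i%C * t%:C).

Lemma Re_gauge c t X l : complex.Re (l^*%C * gauge c t X l) =
  (1 - cabs l ^+ 2) * complex.Re (l^*%C * c) + cabs l ^+ 2 * complex.Re X.
Proof.
rewrite /gauge; have -> : 'i%C * t%:C = Complex 0 t by apply: complexP; rewrite ?Re_mul ?Im_mul /=; ring.

have [R0 I0] : complex.Re (Complex 0 t) = 0 /\ complex.Im (Complex 0 t) = t by [].
by move: (Complex 0 t) R0 I0 => it R0 I0; rewrite cabs_sqr (expr2 l) !ReImE R0 I0; ring.
Qed.

Lemma hpol_gauge Lam a b s l : linear_bm Lam -> cabs l < 1 ->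
  hpol a b l * (cext Lam (schwarz l) + 'i%C * s%:C) =
  gauge (a^*%C * ((Lam (fun=> 1))%:C + 'i%C * s%:C))
    (s * b - 2 * Lam (fun z => complex.Im (a * zv z)))
    (cext (weighted (kpol a b) Lam) (schwarz l)) l.
Proof.
move=> lin l1; have bS := bmC_schwarz l1.
have bk := bmeas_kpol a b.
have bI : bmeas (fun z : T => complex.Im (a * zv z)).
  by apply: bmC_Im; apply: bmCZ; exact: bmC_circle_val.
rewrite mulrDr -(cextZ lin) // cext_weighted /gauge.
under [X in cext _ X]eq_fun do rewrite (hpol_schwarz _ _ _ l1).
have b1 : bmC (fun z : T => (kpol a b z)%:C * schwarz l z) by apply: bmCM => //; exact: bmC_real.
rewrite (cextD lin); last 2 first.
- exact: bmCZ.
- apply: bmCB; first exact: bmC_cst.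
  by apply: bmCZ; exact: bmC_real.
rewrite (cextZ lin) // (cextB lin); last 2 first.
- exact: bmC_cst.
- by apply: bmCZ; exact: bmC_real.
rewrite (cextZ lin); last exact: bmC_real.
rewrite (cext_real lin) //.
have -> : cext Lam (fun=> a^*%C - a * l ^+ 2) = (a^*%C - a * l ^+ 2) * (Lam (fun=> 1))%:C.
  have b1R := bmeas_cst 1 : bmeas (fun _ : T => 1).
  rewrite -(cext_real lin) // -(cextZ lin); last exact: bmC_real.
  by congr cext; apply/funext => z; rewrite mulr1.
rewrite conjcM conjcD conjcM !conjc_real conjcK /hpol rmorphB !rmorphM rmorph_nat /=.
have ic : ('i%C)^*%C = - 'i%C :> R[i] by apply: complexP => /=; ring.
have -> : (-1)*i = - 'i%C :> R[i] by apply: complexP => /=; ring.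
by move: (cext _ _) (Lam _)%:C (Lam _)%:C (a^*%C) (b%:C) (s%:C) => X Y Z a' b' s'; ring.
Qed.

Definition monotone_bm Q := forall f g, bmeas f -> bmeas g -> (forall x, f x <= g x) -> Q f <= Q g.

(* Dividing F by (l - tau)(1 - conj tau l), whose boundary weight is
   |zeta - tau|^2, leaves a function of positive real part. *)
Lemma gauge_lower_bound Q c t tau l : linear_bm Q -> monotone_bm Q ->
  cabs tau < 1 -> cabs l < 1 -> gauge c t (cext Q (schwarz tau)) tau = 0 ->
  cabs (l - tau) * ((1 - cabs tau) / 4) * Q (poisson l) <=
  cabs (gauge c t (cext Q (schwarz l)) l).
Proof.
move=> lin mon tau1 l1 F0; have t0 := cabs_ge0 tau; have l0 := cabs_ge0 l.
have p0 : 0 < 1 - cabs tau ^+ 2 by rewrite subr_gt0 expr_lt1.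
(* These are the coefficients of (x - tau)(1 - conj(tau) x). *)
pose a := - tau^*%C; pose b := 1 + cabs tau ^+ 2.
(* This is |zeta - tau|^-2, written through the Poisson kernel, which is already known to be bounded
   and Borel. *)
pose w := fun z => (1 - cabs tau ^+ 2)^-1 * poisson tau z.
have bw : bmeas w by apply: bmeasZ; exact: bmeas_poisson.
have hE x : hpol a b x = (x - tau) * (1 - tau^*%C * x).
  rewrite /hpol /a /b conjcN conjcK rmorphD rmorph1 /= -mulcJ; ring.
have kE z : kpol a b z = cabs (zv z - tau) ^+ 2.
  apply: complexI; rewrite -kpol_hpol hE -mulcJ rmorphB /= circle_conj.
  by field; exact: circle_val_neq0.
have wk z : w z * kpol a b z = 1.
  rewrite /w kE poissonE // mulKf ?gt_eqF // mulVf //.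
  by rewrite expf_neq0 // cabs_eq0 circle_subr_neq0.
pose Lam := weighted w Q; have linL : linear_bm Lam by exact: linear_weighted.
have QE : weighted (kpol a b) Lam = Q.
  apply/funext => f; rewrite /weighted /Lam /weighted.
  by congr Q; apply/funext => z; rewrite mulrA wk mul1r.
have b0 : 0 < b by rewrite ltr_wpDr // sqr_ge0.
(* Solves the equation that makes the imaginary constant of [hpol_gauge] equal to the given t. *)
pose s := (t + 2 * Lam (fun z => complex.Im (a * zv z))) / b.
have st : s * b - 2 * Lam (fun z => complex.Im (a * zv z)) = t.
  by rewrite /s divfK ?gt_eqF //; ring.
have key x : cabs x < 1 -> hpol a b x * (cext Lam (schwarz x) + 'i%C * s%:C) =
    gauge (a^*%C * ((Lam (fun=> 1))%:C + 'i%C * s%:C)) t (cext Q (schwarz x)) x.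
  by move=> x1; rewrite hpol_gauge // QE st.
set c' := a^*%C * _ in key.
(* Both gauges vanish at tau and differ only in c, so c' - c equals its conjugate times tau^2; as
   |tau| < 1, it is 0. *)
have cc : c' = c.
  have := key tau tau1; rewrite hE subrr !mul0r => E0.
  have : (c' - c) = (c' - c)^*%C * tau ^+ 2.
    apply/eqP; rewrite -subr_eq0; apply/eqP; rewrite conjcB mulrBl.
    transitivity (gauge c' t (cext Q (schwarz tau)) tau - gauge c t (cext Q (schwarz tau)) tau).
      by rewrite /gauge; ring.
    by rewrite -E0 F0 subrr.
  move=> /(congr1 (@cabs R)); rewrite cabsM cabsJ cabsX => E.
  apply/eqP; rewrite -subr_eq0 -cabs_eq0; apply/eqP.
  by move: (cabs (c' - c)) E => e; move: p0; set q := _ ^+ 2; nra.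
rewrite -cc -(key l l1) hE !cabsM -!mulrA ler_wpM2l ?cabs_ge0 //.
have h1 : 1 - cabs tau <= cabs (1 - tau^*%C * l).
  have := cabs_lip 1 (tau^*%C * l); have := cabsD (1 - tau^*%C * l) (tau^*%C * l).
  rewrite subrK cabs1 cabsM cabsJ => h _.
  have : cabs tau * cabs l <= cabs tau by rewrite ler_piMr // ltW.
  lra.
(* The weight w is at least 1/4 because |zeta - tau| <= 2. *)
have h2 : 4^-1 * Q (poisson l) <= cabs (cext Lam (schwarz l) + 'i%C * s%:C).
  apply: le_trans (Re_leC _).
  rewrite Re_add Re_cext Re_mul /= mul0r mul1r subr0 addr0 /Lam /weighted.
  case: lin => _ Z; have bp := bmeas_poisson l1; rewrite -Z //.
  apply: mon => [||z]; [exact: bmeasZ|exact: bmeasM|].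
  rewrite ler_wpM2r ?(ltW (poisson_gt0 l1 z)) //.
  have k0 : 0 < kpol a b z by rewrite kE exprn_gt0 // cabs_gt0 circle_subr_neq0.
  rewrite -(ler_pM2r k0) wk mulrC ler_pdivrMr // mul1r kE.
  have zt : cabs (zv z - tau) <= 2.
    by apply: le_trans (cabsB _ _) _; rewrite cabs_circle; lra.
  have := cabs_ge0 (zv z - tau); nra.
apply: ler_pM => //; first by lra.
have : Q (fun=> 0) <= Q (poisson l).
  apply: mon; [exact: bmeas_cst|exact: bmeas_poisson|].
  by move=> z; rewrite ltW // poisson_gt0.
case: lin => _ Z; have := Z 0 (fun=> 0) (bmeas_cst 0).
by rewrite mul0r mul0r => -> h; rewrite mulr_ge0.
Qed.

Lemma monotone_poisson_ge Q l : linear_bm Q -> monotone_bm Q -> cabs l < 1 ->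
  (1 - cabs l) / 2 * Q (fun=> 1) <= Q (poisson l).
Proof.
move=> [_ Z] mon l1; have b1 : bmeas (fun=> 1) := @bmeas_cst R 1; rewrite -Z //.
apply: mon => [||z]; [exact: bmeasZ|exact: bmeas_poisson|].
rewrite mulr1; apply: le_trans (poisson_ge l1 z); have l0 := cabs_ge0 l.
rewrite ler_pM2l ?subr_gt0 // lef_pV2 ?posrE; lra.
Qed.

End Functionals.

(** * Measures with nonnegative Poisson integrals *)
Section PositiveMeasures.
Variable R : realType.
Notation T := (borelType (circle R)).
Notation C := R[i]^o.
Notation zv := (@circle_val R).
Implicit Types (f k : T -> R) (l : R[i]) (r e : R).

HB.instance Definition _ := Measure_isFinite.Build _ _ _ (arc_length R)
  (lty_fin_num_fun (arc_length_fin R)).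

Let linM := @linear_mean R.

Lemma bmeas_comp1 (K : T * T -> R) (y : T) : measurable_fun setT K ->
  (exists M, forall p, `|K p| <= M) -> bmeas (fun x => K (x, y)).
Proof.
move=> mK [M KM]; split; last by exists M.
by apply: measurableT_comp mK _; exact: measurable_pair2.
Qed.

Lemma bmeas_comp2 (K : T * T -> R) (x : T) : measurable_fun setT K ->
  (exists M, forall p, `|K p| <= M) -> bmeas (fun y => K (x, y)).
Proof.
move=> mK [M KM]; split; last by exists M.
by apply: measurableT_comp mK _; exact: measurable_pair1.
Qed.

Section FubiniKernel.
Variables (m : {finite_measure set T -> \bar R}) (u : T -> R) (K : T * T -> R).
Hypotheses (iu : L1 m u) (mK : measurable_fun setT K) (bK : exists M, forall p, `|K p| <= M).

Let F (p : T * T) := (K p * u p.1)%:E.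

Let mu : measurable_fun setT u. Proof. by move/measurable_int: iu => /measurable_EFinP. Qed.

Let mF : measurable_fun setT F.
Proof.
apply/measurable_EFinP; apply: measurable_funM => //.
exact: measurableT_comp mu measurable_fst.
Qed.

Let i2 x : L1 (arc_length R) (fun y => K (x, y) * u x).
Proof.
apply: bmeas_L1; first exact: arc_length_fin.
by apply: bmeasM; [exact: bmeas_comp2|exact: bmeas_cst].
Qed.

Let i1 y : L1 m (fun x => K (x, y) * u x).
Proof. by apply: L1M => //; exact: bmeas_comp1. Qed.

Let iF : (m \x arc_length R)%E.-integrable setT F.
Proof.
have [M KM] := bK; have ia : L1 m (fun x => `|u x|) by exact: integrable_norm.
apply/integrable21ltyP => //.
apply: (@le_lt_trans _ _ (\int[arc_length R]_y (`|M| * \int[m]_x `|u x|)%:E)%E).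
  apply: ge0_le_integral => //.
  - by move=> y _; exact: integral_ge0.
  - apply: (measurable_fun_fubini_tonelli_G (abse \o F)) => //=; exact: measurableT_comp.
  move=> y _.
  have -> : (`|M| * \int[m]_x `|u x|)%:E = (\int[m]_x (`|M| * `|u x|)%:E)%E.
    rewrite -RintegralZl // /Rintegral fineK //; apply: integrable_fin_num => //.
    exact: (@integrableZl _ _ _ m _ measurableT _ (EFin \o fun x => `|u x|)).
  apply: ge0_le_integral => //.
  - by apply: measurableT_comp => //; exact: (measurable_int _ (i1 y)).

  - by apply/measurable_EFinP; apply: measurable_funM => //; exact: measurableT_comp.
  move=> x _; rewrite lee_fin normrM ler_wpM2r //.
  by apply: le_trans (KM _) (ler_norm _).
rewrite integral_cst // lte_mul_pinfty ?lee_fin ?mulr_ge0 ?Rintegral_ge0 //.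
exact: arc_length_fin.
Qed.

Let wintE y : (wint m u (fun x => K (x, y)))%:E = (\int[m]_x F (x, y))%E.
Proof.
by have /(integrable_fin_num measurableT) h := i1 y; rewrite /wint /Rintegral fineK.
Qed.

Lemma bmeas_wint : bmeas (fun y => wint m u (fun x => K (x, y))).
Proof.
split.
  apply/measurable_EFinP; rewrite (_ : _ \o _ = fubini_G m F).
    exact: measurable_fubini_G iF.
  by apply/funext => y; exact: wintE.
have [M KM] := bK; exists (`|M| * \int[m]_x `|u x|) => y.
apply: wint_norm => //; first exact: bmeas_comp1.
by move=> x; apply: le_trans (KM _) (ler_norm _).
Qed.

Lemma wint_mean :
  wint m u (fun x => mean (fun y => K (x, y))) = mean (fun y => wint m u (fun x => K (x, y))).
Proof.
have E2 : (fun y => (\int[m]_x F (x, y))%E) = EFin \o (fun y => wint m u (fun x => K (x, y))).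
  by apply/funext => y; rewrite /= wintE.
have E1 : (fun x => (\int[arc_length R]_y F (x, y))%E) =
    EFin \o (fun x => 2 * pi * (mean (fun y => K (x, y)) * u x)).
  apply/funext => x; have /(integrable_fin_num measurableT) h := i2 x.
  rewrite -[LHS]fineK //=; congr EFin; rewrite -[LHS]/(\int[arc_length R]_y (K (x, y) * u x)).
  have bk := bmeas_comp2 x mK bK.
  under eq_Rintegral do rewrite mulrC.
  rewrite RintegralZl //; last by apply: bmeas_L1 => //; exact: arc_length_fin.
  rewrite /mean mulrC mulrA mulrA mulfV ?mul1r //.
  by rewrite mulf_neq0 ?gt_eqF ?pi_gt0.
have := congr1 fine (Fubini iF); rewrite E1 E2 => E.
have pi0 : (2 * pi : R) != 0 by rewrite mulf_neq0 ?gt_eqF ?pi_gt0.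
have iG : L1 m (fun x => 2 * pi * (mean (fun y => K (x, y)) * u x)).
  by have := integrable_fubini_F iF; rewrite /fubini_F E1.
rewrite {2}/mean [in RHS]/Rintegral -E -/(Rintegral m setT _) -RintegralZl //.
by apply: eq_Rintegral => x _; rewrite mulKf.
Qed.

End FubiniKernel.

Lemma bmeas_mean (K : T * T -> R) : measurable_fun setT K ->
  (exists M, forall p, `|K p| <= M) -> bmeas (fun x => mean (fun y => K (x, y))).
Proof.
move=> mK [M KM]; apply: bmeasZ.
have mK' : measurable_fun setT (fun p : T * T => K (p.2, p.1)).
  apply: (measurableT_comp mK (_ : measurable_fun setT (fun p : T * T => (p.2, p.1)))).
  by apply: measurable_fun_pair => /=.
have := @bmeas_wint (arc_length R) (fun=> 1) _ (L1_1 (arc_length R)) mK'.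
move=> /(_ (ex_intro _ M (fun p => KM _))); congr bmeas; apply/funext => x.
by apply: eq_Rintegral => y _; rewrite mulr1.
Qed.

(** Dominated convergence for sequences that are eventually 0 at each point, the mode of convergence
    in which indicators are approximated below. *)
Lemma wint_eventually0 (m : {measure set T -> \bar R}) u (f : nat -> T -> R) :
  L1 m u -> (forall n, bmeas (f n)) -> (forall n x, `|f n x| <= 1) ->
  (forall x, exists N, forall n, (N <= n)%N -> f n x = 0) ->
  forall e, 0 < e -> exists N, forall n, (N <= n)%N -> `|wint m u (f n)| <= e.
Proof.
move=> iu bf f1 f0 e e0.
have mu : measurable_fun setT u by move/measurable_int: iu => /measurable_EFinP.
have [|||||_ _] := @dominated_convergence _ _ R m setT measurableT
  (fun n x => (f n x * u x)%:E) (fun=> 0%E) (fun x => `|u x|%:E).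
- move=> n; apply/measurable_EFinP; apply: measurable_funM => //; by case: (bf n).
- exact: measurable_cst.
- apply: aeW => x _; have [N HN] := f0 x.
  apply: cvg_near_cst; exists N => // n Nn /=.
  by rewrite HN // mul0r.
- exact: integrable_norm.
- by apply: aeW => x n _; rewrite lee_fin normrM ler_piMl.
rewrite integral0 => /fine_cvgP[_ /cvgrPdist_le /(_ _ e0) [N _ HN]].
by exists N => n Nn; have := HN n Nn; rewrite /= sub0r normrN.
Qed.

Definition lipschitzC (psi : C -> R) :=
  exists2 K, 0 < K & forall z w, `|psi z - psi w| <= K * cabs (z - w).

Lemma lipschitz_continuous (psi : C -> R) (z : C) : lipschitzC psi -> {for z, continuous psi}.
Proof.
move=> [K K0 HK]; apply/cts_CR => e e0; exists (e / K); first exact: divr_gt0.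
by move=> w; rewrite ltr_pdivlMr // mulrC; apply: le_lt_trans.
Qed.

Lemma bmeas_lipschitz psi : lipschitzC psi -> bmeas (fun x : T => psi (zv x)).
Proof. by move=> lp; apply: circle_continuous_bmeas => z _; exact: lipschitz_continuous. Qed.

Lemma lipschitz_approx_indic (W : set C) : open W -> exists psi : nat -> C -> R,
  [/\ forall n, lipschitzC (psi n), forall n z, 0 <= psi n z <= 1 &
    forall z, exists N, forall n, (N <= n)%N -> psi n z = \1_W z].
Proof.
(* The infimum of [S n z] is the smaller of 1 and n + 1 times the distance from z to the complement
   of W; the element 1 keeps the set nonempty when W is the whole plane. *)
move=> oW; pose S n (z : C) := [set t : R | t = 1 \/ exists2 y : C, ~ W y & t = n.+1%:R * cabs (z - y)].
have S1 n z : S n z 1 by left.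
have S0 n z : lbound (S n z) 0.
  by move=> t [->|[y _ ->]] //; rewrite mulr_ge0 // cabs_ge0.
have hi n z : has_inf (S n z) by split; [exists 1|exists 0].
have i0 n z : 0 <= inf (S n z) by apply: lb_le_inf => //; exists 1.
have i1 n z : inf (S n z) <= 1 by apply: ge_inf => //; case: (hi n z).
exists (fun n z => inf (S n z)); split=> [n|n z|z]; last first.
- have [Wz|Wz] := pselect (W z).
    have /nbhs_cabsP[d d0 Hd] : nbhs z W by exact: open_nbhs_nbhs.
    exists (Num.bound d^-1) => n dn; rewrite indicE mem_set //.
    apply/eqP; rewrite eq_le i1 /=; apply: lb_le_inf; first by exists 1.
    move=> t [->|[y Wy ->]] //.
    have dy : d <= cabs (z - y) by rewrite leNgt; apply/negP => /Hd.
    apply: le_trans (ler_pM _ _ (lexx _) dy) => //; last exact: ltW.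
    rewrite -ler_pdivrMr // mul1r; apply: le_trans (ltW (archi_boundP _)) _.
      by rewrite invr_ge0 ltW.
    by rewrite ler_nat leqW.
  exists 0%N => n _; rewrite indicE memNset //.
  apply/eqP; rewrite eq_le i0 andbT; apply: ge_inf; first by case: (hi n z).
  by right; exists z; rewrite // subrr cabs0 mulr0.
- by rewrite i0 i1.
exists n.+1%:R; first by rewrite ltr0n.
have H z w : inf (S n z) - n.+1%:R * cabs (z - w) <= inf (S n w).
  apply: lb_le_inf; first by exists 1.
  move=> t [->|[y Wy ->]].
    by rewrite lerBlDr; apply: le_trans (i1 n z) _; rewrite lerDl mulr_ge0 // cabs_ge0.
  rewrite lerBlDr -mulrDr; apply: (@le_trans _ _ (n.+1%:R * cabs (z - y))).
    by apply: ge_inf; [case: (hi n z)|right; exists y].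
  rewrite ler_pM2l ?ltr0n // [leRHS]addrC; apply: le_trans (cabsD _ _).
  by rewrite addrA subrK.
move=> z w; have := H z w; have := H w z; rewrite [cabs (w - z)]cabsC.
by rewrite ler_norml; lra.
Qed.

Section Density.
Variable tau : (T -> R) -> R.
Hypothesis lin : linear_bm tau.
Hypothesis mon : monotone_bm tau.
Hypothesis ev0 : forall f : nat -> T -> R,
  (forall n, bmeas (f n)) -> (forall n x, `|f n x| <= 1) ->
  (forall x, exists N, forall n, (N <= n)%N -> f n x = 0) ->
  forall e, 0 < e -> exists N, forall n, (N <= n)%N -> `|tau (f n)| <= e.

(** Sets whose indicators are limits of Lipschitz functions in the seminorm tau(|f|). They form a
    sigma-algebra containing the open sets; [tau] will be a total variation. *)
Definition lip_approximable (A : set T) := measurable A /\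
  forall e, 0 < e -> exists psi, [/\ lipschitzC psi, forall z, 0 <= psi z <= 1 &
    tau (fun x => `|\1_A x - psi (zv x)|) <= e].

Let bdist A psi : measurable A -> lipschitzC psi ->
  bmeas (fun x : T => `|\1_A x - psi (zv x)|).
Proof.
move=> mA lp; apply: bmeas_abs; apply: bmeasB; first exact: bmeas_indic.
exact: bmeas_lipschitz.
Qed.

Lemma lip_approximableC A : lip_approximable A -> lip_approximable (~` A).
Proof.
move=> [mA HA]; split; first exact: measurableC.
move=> e /HA[psi [[K K0 HK] psi01 te]]; exists (fun z => 1 - psi z); split.
- exists K => // z w; rewrite (_ : _ - _ = - (psi z - psi w)); last by ring.
  by rewrite normrN.
- by move=> z; have := psi01 z; lra.
move: te; congr (tau _ <= e); apply/funext => x.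
rewrite -normrN !indicE in_setC; congr `| _ |; case: (_ \in _) => /=; ring.
Qed.

Lemma lip_approximableU A B : lip_approximable A -> lip_approximable B ->
  lip_approximable (A `|` B).
Proof.
move=> [mA HA] [mB HB]; split; first exact: measurableU.
move=> e e0; have e2 : 0 < e / 2 by rewrite divr_gt0.
have [p [lp p01 tp]] := HA _ e2; have [q [lq q01 tq]] := HB _ e2.
have lpq : lipschitzC (fun z => Num.max (p z) (q z)).
  have [K K0 HK] := lp; have [K' K'0 HK'] := lq.
  exists (K + K'); first exact: addr_gt0.
  move=> z w; have := HK z w; have := HK' z w; rewrite mulrDl.
  have : 0 <= K * cabs (z - w) by rewrite mulr_ge0 ?(ltW K0) ?cabs_ge0.
  have : 0 <= K' * cabs (z - w) by rewrite mulr_ge0 ?(ltW K'0) ?cabs_ge0.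
  move: (K * _) (K' * _) => x y; rewrite !ler_norml.
  by case: (leP (p z) (q z)); case: (leP (p w) (q w)); lra.
exists (fun z => Num.max (p z) (q z)); split => //.
  by move=> z; case: (leP (p z) (q z)) => _; [exact: q01|exact: p01].
have mAB : measurable (A `|` B) by exact: measurableU.
case: (lin) => D _.
apply: le_trans (mon (bdist mAB lpq) (bmeasD (bdist mA lp) (bdist mB lq)) _) _.
  move=> x; rewrite !indicE in_setU; have := p01 (zv x); have := q01 (zv x).
  have N (t : R) : - `|t| <= t <= `|t| by rewrite -ler_norml.
  have := N ((x \in A)%:R - p (zv x)); have := N ((x \in B)%:R - q (zv x)).
  rewrite ler_norml; move: `|_ - p _| `|_ - q _| => s t; move: (p _) (q _) => p' q'.
  by case: (x \in A); case: (x \in B) => /=; case: (leP p' q') => pq; lra.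
rewrite D; [by lra|exact: bdist..].
Qed.

Lemma lip_approximable_lim (A : set T) (B : nat -> set T) : measurable A ->
  (forall n, lip_approximable (B n)) ->
  (forall x, exists N, forall n, (N <= n)%N -> (x \in B n) = (x \in A)) -> lip_approximable A.
Proof.
move=> mA aB BA; split=> // e e0; have e2 : 0 < e / 2 by rewrite divr_gt0.
pose f n (x : T) := `|\1_A x - \1_(B n) x| : R.
have bf n : bmeas (f n).
  by apply: bmeas_abs; apply: bmeasB; apply: bmeas_indic => //; case: (aB n).
have [N HN] : exists N, forall n, (N <= n)%N -> `|tau (f n)| <= e / 2.
  apply: ev0 => // [n x|x].
    rewrite /f normr_id !indicE; case: (_ \in _); case: (_ \in _);
      by rewrite ?subrr ?normr0 ?subr0 ?sub0r ?normrN ?normr1.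
  have [N HN] := BA x; exists N => n Nn.
  by rewrite /f !indicE HN // subrr normr0.
have [mB /(_ _ e2)[p [lp p01 tp]]] := aB N; exists p; split => //.
case: (lin) => D _.
apply: le_trans (mon (bdist mA lp) (bmeasD (bf N) (bdist mB lp)) _) _.
  by move=> x; rewrite /f; apply: le_trans (ler_normD _ _); rewrite addrA subrK.
rewrite D //; last exact: bdist.
have := HN N (leqnn N); have := ler_norm (tau (f N)); lra.
Qed.

Lemma measurable_lip_approximable (A : set T) : measurable A -> lip_approximable A.
Proof.
move=> mA; have : (@lip_approximable) A; last by [].
move: A mA; apply: smallest_sub.
  split.
  - have -> : set0 = ~` [set: T] by rewrite setCT.
    apply: lip_approximableC; split => // e e0; exists (fun=> 1); split.
    + by exists 1 => // z w; rewrite subrr normr0 mul1r cabs_ge0.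
    + by move=> _; rewrite ler01 lexx.
    rewrite (_ : (fun _ => _) = fun=> 0 * 0).
      by case: (lin) => _ Z; rewrite (Z 0 (fun=> 0)) ?mul0r ?ltW //; exact: bmeas_cst.
    by apply/funext => x; rewrite indicE in_setT subrr normr0 mulr0.
  - by move=> A aA; rewrite setTD; exact: lip_approximableC.
  (* The finite unions increase to the countable one, so membership is eventually constant at each
     point. *)
  - move=> A aA; pose B n := \big[setU/set0]_(i < n.+1) A i.
    apply: (@lip_approximable_lim _ B).
    + by apply: bigcup_measurable => k _; case: (aA k).
    + move=> n; rewrite /B; elim: n => [|n ih]; first by rewrite big_ord1.
      by rewrite big_ord_recr /=; exact: lip_approximableU.
    + move=> x; have [[k _ Ak]|nA] := pselect ((\bigcup_k A k) x).
        exists k => n kn; rewrite !mem_set //; first by exists k.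
        by rewrite /B -bigcup_mkord; exists k.
      exists 0%N => n _; rewrite !memNset //.
      by rewrite /B -bigcup_mkord => -[k _ Ak]; apply: nA; exists k.
move=> U oU; have [W oW WU] := oU.
have mU : measurable (U : set T) by exact: sub_sigma_algebra.
split=> // e e0; have [psi [lp p01 pe]] := lipschitz_approx_indic oW.
pose f n (x : T) := `|\1_U x - psi n (zv x)|.
have [N HN] : exists N, forall n, (N <= n)%N -> `|tau (f n)| <= e.
  apply: ev0 => // [n|n x|x]; first exact: bdist.
    rewrite /f normr_id; have := p01 n (zv x); rewrite indicE => /andP[a b].
    case: (_ \in _) => /=; rewrite ler_norml; lra.
  have [N HN] := pe (zv x); exists N => n /HN E.
  by rewrite /f E -WU !indicE subrr normr0.
exists (psi N); split => //.
by have := HN N (leqnn N); have := ler_norm (tau (f N)); rewrite /f; lra.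
Qed.

End Density.

Lemma poisson_sym r (x y : T) : 0 <= r < 1 ->
  poisson (r%:C * zv y) x = poisson (r%:C * zv x) y.
Proof.
move=> /andP[r0 r1]; have rz z : cabs (r%:C * zv z) = r.
  by rewrite cabsM cabs_circle mulr1 cabs_real ger0_norm.
rewrite !poissonE ?rz //; congr (_ / _).
have cE (z w : T) : cabs (zv z - r%:C * zv w) ^+ 2 = 1 + r ^+ 2 - 2 * r *
    (complex.Re (zv z) * complex.Re (zv w) + complex.Im (zv z) * complex.Im (zv w)).
  have [Ez Ew] : cabs (zv z) ^+ 2 = 1 /\ cabs (zv w) ^+ 2 = 1 by rewrite !cabs_circle expr1n.
  transitivity (cabs (zv z) ^+ 2 + r ^+ 2 * cabs (zv w) ^+ 2 - 2 * r *
    (complex.Re (zv z) * complex.Re (zv w) + complex.Im (zv z) * complex.Im (zv w))).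
    rewrite !cabs_sqr !ReImE.
    by move: (complex.Re (zv z)) (complex.Im (zv z)) (complex.Re (zv w)) (complex.Im (zv w)) => a b c d; ring.
  by rewrite Ez Ew mulr1.
by rewrite !cE; congr (_ - _); ring.
Qed.

Lemma measurable_poisson_kernel r : 0 <= r < 1 ->
  measurable_fun setT (fun p : T * T => poisson (r%:C * zv p.2) p.1) /\
  exists M, forall p : T * T, `|poisson (r%:C * zv p.2) p.1| <= M.
Proof.
move=> /andP[r0 r1]; have rz z : cabs (r%:C * zv z) = r.
  by rewrite cabsM cabs_circle mulr1 cabs_real ger0_norm.
have r2 : 0 < 1 - r ^+ 2 by rewrite subr_gt0 expr_lt1.
pose q (p : T * T) : R := cabs (zv p.1 - r%:C * zv p.2) ^+ 2.
(* The inverse is written as a real power in order to use [measurable_powR]. *)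
have E p : poisson (r%:C * zv p.2) p.1 = (1 - r ^+ 2) * powR (q p) (-1).
  by rewrite poissonE ?rz // powRN powRr1 // sqr_ge0.
have qd p : (1 - r) ^+ 2 <= q p.
  have : 1 - r <= cabs (zv p.1 - r%:C * zv p.2).
    have := cabsD (zv p.1 - r%:C * zv p.2) (r%:C * zv p.2).
    by rewrite subrK cabs_circle rz; lra.
  by have := cabs_ge0 (zv p.1 - r%:C * zv p.2); rewrite /q; nra.
split.
  rewrite (_ : (fun _ => _) = fun p => (1 - r ^+ 2) * powR (q p) (-1)); last exact/funext.
  apply: measurable_funM => //; apply: (measurableT_comp (measurable_powR _)).
  have [[mR _] [mI _]] := bmC_circle_val R.
  rewrite (_ : q = fun p => (complex.Re (zv p.1) - r * complex.Re (zv p.2)) ^+ 2 +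
      (complex.Im (zv p.1) - r * complex.Im (zv p.2)) ^+ 2).
    apply: measurable_funD; apply: measurable_funX; apply: measurable_funB;
      rewrite //=; do ?[apply: measurable_funM => //].
    - exact: measurableT_comp mR measurable_fst.
    - exact: measurableT_comp mR measurable_snd.
    - exact: measurableT_comp mI measurable_fst.
    - exact: measurableT_comp mI measurable_snd.
  by apply/funext => p; rewrite /q cabs_sqr !ReImE; ring.
exists ((1 - r ^+ 2) / (1 - r) ^+ 2) => p; rewrite E ger0_norm; last first.
  by rewrite mulr_ge0 ?powR_ge0 // ltW.
rewrite powRN powRr1 ?sqr_ge0 // ler_pM2l // lef_pV2 ?posrE //.
  by apply: lt_le_trans (qd p); rewrite exprn_gt0 // subr_gt0.
by rewrite exprn_gt0 // subr_gt0.
Qed.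

(** The Lipschitz bound is integrated through |d| <= e + |d|^2 / (4 e). Against the Poisson kernel
    at r x the function |y - x|^2 has mean 2 - 2 r, which gives the second term. *)
Lemma poisson_approximation psi K : 0 < K ->
  (forall z w, `|psi z - psi w| <= K * cabs (z - w)) ->
  forall r e (x : T), 0 < r < 1 -> 0 < e ->
  `|mean (fun y => psi (zv y) * poisson (r%:C * zv y) x) - psi (zv x)| <=
    K * (e + (1 - r) / (2 * e)).
Proof.
move=> K0 HK r e x /andP[r0 r1] e0; have lp : lipschitzC psi by exists K.
pose l := r%:C * zv x; have lr : cabs l = r.
  by rewrite cabsM cabs_circle mulr1 cabs_real gtr0_norm.
have l1 : cabs l < 1 by rewrite lr.
have bp := bmeas_poisson l1; case: (linM) => D Z.
have bpsi := bmeas_lipschitz lp.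
under eq_fun do rewrite poisson_sym ?r1 ?ltW //.
have -> : psi (zv x) = mean (fun y => psi (zv x) * poisson l y).
  by rewrite Z // mean_poisson // mulr1.
rewrite -(linear_bmB linM) /=; [|exact: bmeasM|exact: bmeasZ].
have bd : bmeas (fun y : T => cabs (zv y - zv x) ^+ 2).
  have [bR bI] : bmC (fun y : T => zv y - zv x) by apply: bmCB; [exact: bmC_circle_val|exact: bmC_cst].
  rewrite (_ : (fun _ => _) = fun y => complex.Re (zv y - zv x) * complex.Re (zv y - zv x) +
      complex.Im (zv y - zv x) * complex.Im (zv y - zv x)); first by apply: bmeasD; exact: bmeasM.
  by apply/funext => y; rewrite cabs_sqr !expr2.
have m2 : mean (fun y => cabs (zv y - zv x) ^+ 2 * poisson l y) = 2 - 2 * r.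
  have dF (z : C) : cabs z < 2 ->
      differentiable (fun z : C => (2 : R)%:C - ((2 : R)%:C * (zv x)^*%C) * z : C) z.
    by move=> _; apply: differentiableB => //; exact: differentiableZ.
  have r12 : 0 < (1 : R) < 2 by lra.
  have := Re_poisson l1 dF r12; rewrite rmorph1 mul1r => E.
  transitivity (complex.Re ((2 : R)%:C - ((2 : R)%:C * (zv x)^*%C) * l)).
    rewrite E; congr mean; apply/funext => y; congr (_ * _).
    rewrite mul1r -[in RHS]mulrA Re_add Re_opp Re_RCmul Re_RC.
    have [Ex Ey] : cabs (zv x) ^+ 2 = 1 /\ cabs (zv y) ^+ 2 = 1 by rewrite !cabs_circle expr1n.
    rewrite [in LHS]cabs_sqr; move: Ex Ey; rewrite !cabs_sqr !ReImE.
    move: (complex.Re (zv x)) (complex.Im (zv x)) (complex.Re (zv y)) (complex.Im (zv y)) => a b c d.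
    by clear; nra.
  have -> : (2 : R)%:C * (zv x)^*%C * l = (2 * r : R)%:C * (zv x * (zv x)^*%C).
    by rewrite /l rmorphM /=; ring.
  by rewrite mulcJ cabs_circle expr1n mulr1 Re_add Re_opp !Re_RC.
apply: (@le_trans _ _ (mean (fun y => K * (e * poisson l y + (4 * e)^-1 * (cabs (zv y - zv x) ^+ 2 * poisson l y))))).
  have bb : bmeas (fun y => K * (e * poisson l y + (4 * e)^-1 * (cabs (zv y - zv x) ^+ 2 * poisson l y))).
    by apply: bmeasZ; apply: bmeasD; apply: bmeasZ => //; exact: bmeasM.
  have b1 : bmeas (fun y => psi (zv y) * poisson l y - psi (zv x) * poisson l y).
    by apply: bmeasB; [exact: bmeasM|exact: bmeasZ].
  have pt y : `|psi (zv y) * poisson l y - psi (zv x) * poisson l y| <=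
      K * (e * poisson l y + (4 * e)^-1 * (cabs (zv y - zv x) ^+ 2 * poisson l y)).
    have p0 := poisson_gt0 l1 y; rewrite -mulrBl normrM (gtr0_norm p0) mulrA -mulrDl mulrA.
    rewrite ler_pM2r //; apply: le_trans (HK _ _) _; rewrite ler_pM2l //.
    have := sqr_ge0 (cabs (zv y - zv x) - 2 * e); set c := cabs _ => c0.
    rewrite -(ler_pM2l (mulr_gt0 (ltr0n R 4) e0)) mulrDr mulrA mulfV ?gt_eqF ?mulr_gt0 //.
    by clear -c0; nra.
  rewrite ler_norml; apply/andP; split.
    rewrite lerNl -mulN1r -Z //; apply: mean_le => // [|y]; first exact: bmeasZ.
    by rewrite mulN1r; apply: le_trans (pt y); rewrite -normrN ler_norm.
  by apply: mean_le => // y; apply: le_trans (ler_norm _) (pt y).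
have bm2 : bmeas (fun y => cabs (zv y - zv x) ^+ 2 * poisson l y) by exact: bmeasM.
rewrite Z; last by apply: bmeasD; exact: bmeasZ.
rewrite D; [|exact: bmeasZ..]; rewrite (Z e) // (Z _ (fun y => cabs _ ^+ 2 * _)) //.
rewrite (mean_poisson l1) mulr1 m2 ler_pM2l // lerD2l.
rewrite le_eqVlt; apply/orP; left; apply/eqP; field; by rewrite gt_eqF.
Qed.

(** By Fubini, integrating the Poisson means of psi amounts to averaging psi times the Poisson
    integrals of the measure, a nonnegative quantity; these means approximate psi uniformly. *)
Lemma lipschitz_positive (m1 m2 : {finite_measure set T -> \bar R}) u w : L1 m1 u -> L1 m2 w ->
  (forall l, 0 < cabs l < 1 -> 0 <= wint m1 u (poisson l) + wint m2 w (poisson l)) ->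
  forall psi, lipschitzC psi -> (forall z, 0 <= psi z) ->
  0 <= wint m1 u (fun x => psi (zv x)) + wint m2 w (fun x => psi (zv x)).
Proof.
move=> iu iw H psi lp p0; have [K K0 HK] := lp.
pose Lam f := 1 * wint m1 u f + 1 * wint m2 w f.
have LE f : Lam f = wint m1 u f + wint m2 w f by rewrite /Lam !mul1r.
have lL : linear_bm Lam by apply: linear_bm_add; exact: linear_wint.
have [B B0 HB] : bounded_bm Lam by apply: bounded_bm_add; exact: bounded_wint.
rewrite -LE; apply/ler_addgt0Pr => d d0.
(* Once r is so close to 1 that (1 - r) / (2 e) <= e, the uniform error is 2 K e = d / (B + 1), and
   the functional changes by at most d. *)
pose e := d / (2 * (B + 1) * K); have B1 : 0 < B + 1 by rewrite ltr_wpDl.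
have e0 : 0 < e by rewrite divr_gt0 // !mulr_gt0.
pose r := Num.max (2^-1) (1 - e ^+ 2).
have r01 : 0 < r < 1.
  by rewrite lt_max gt_max invr_gt0 ltr0n /= ltrBlDr ltrDl exprn_gt0 // andbT invf_lt1 ?ltr1n.
have /andP[r0 r1] := r01.
have re : (1 - r) / (2 * e) <= e.
  have e2 : 0 < 2 * e by rewrite mulr_gt0.
  rewrite ler_pdivrMr //; have : 1 - e ^+ 2 <= r by rewrite le_max lexx orbT.
  by rewrite mulrCA -expr2; have := sqr_ge0 e; lra.
have r01' : 0 <= r < 1 by rewrite ltW.
have [mP bP] := measurable_poisson_kernel r01'.
pose Ker (p : T * T) := psi (zv p.2) * poisson (r%:C * zv p.2) p.1.
have bpsi := bmeas_lipschitz lp.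
have mK : measurable_fun setT Ker.
  apply: measurable_funM => //; case: bpsi => mpsi _.
  exact: measurableT_comp mpsi measurable_snd.
have bK : exists M, forall p, `|Ker p| <= M.
  have [M HM] := bP; have [_ [N HN]] := bpsi; exists (N * M) => p.
  by rewrite normrM; exact: ler_pM.
have bKm := bmeas_mean mK bK.
have rz (z : T) : cabs (r%:C * zv z) = r by rewrite cabsM cabs_circle mulr1 cabs_real gtr0_norm.
have pos : 0 <= Lam (fun x => mean (fun y => Ker (x, y))).
  rewrite LE !wint_mean //.
  have bw (m : {finite_measure set T -> \bar R}) v : L1 m v ->
      bmeas (fun y => wint m v (fun x => Ker (x, y))).
    by move=> iv; exact: bmeas_wint.
  case: (linM) => D _; rewrite -D; [|exact: bw..].
  apply: mean_ge0 => y; rewrite /Ker /=.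
  have l1 : cabs (r%:C * zv y) < 1 by rewrite rz.
  have bp := bmeas_poisson l1.
  have [_ Z1] := linear_wint iu; have [_ Z2] := linear_wint iw.
  by rewrite Z1 // Z2 // -mulrDr mulr_ge0 // H // rz.
have dist : `|Lam (fun x => mean (fun y => Ker (x, y)) - psi (zv x))| <= d.
  apply: le_trans (HB _ (K * (e + e)) _ _) _; first exact: bmeasB.
    move=> x; apply: le_trans (poisson_approximation K0 HK x r01 e0) _.
    by rewrite ler_pM2l // lerD2l.
  rewrite (_ : K * (e + e) = d / (B + 1)); last first.
    by rewrite /e; field; rewrite !gt_eqF.
  by rewrite mulrA ler_pdivrMr // mulrC ler_pM2l // lerDl.
by move: dist; rewrite (linear_bmB lL) // ler_norml => /andP[]; lra.
Qed.

(** Indicators are approximated by Lipschitz functions in the total variation |u| dm1 + |w| dm2,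
    which dominates the functional. *)
Lemma positive_measure (m1 m2 : {finite_measure set T -> \bar R}) u w : L1 m1 u -> L1 m2 w ->
  (forall l, 0 < cabs l < 1 -> 0 <= wint m1 u (poisson l) + wint m2 w (poisson l)) ->
  forall A, measurable A -> 0 <= wint m1 u (\1_A) + wint m2 w (\1_A).
Proof.
move=> iu iw H A mA.
have iu' : L1 m1 (fun x => `|u x|) by exact: integrable_norm.
have iw' : L1 m2 (fun x => `|w x|) by exact: integrable_norm.
pose tau f := 1 * wint m1 (fun x => `|u x|) f + 1 * wint m2 (fun x => `|w x|) f.
have lt : linear_bm tau by apply: linear_bm_add; exact: linear_wint.
have mt : monotone_bm tau.
  move=> f g bf bg fg; rewrite /tau !mul1r.
  by apply: lerD; apply: wint_le => // x; rewrite ler_wpM2r.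
have ev : forall f : nat -> T -> R,
  (forall n, bmeas (f n)) -> (forall n x, `|f n x| <= 1) ->
  (forall x, exists N, forall n, (N <= n)%N -> f n x = 0) ->
  forall e, 0 < e -> exists N, forall n, (N <= n)%N -> `|tau (f n)| <= e.
  move=> f bf f1 f0 e e0; have e2 : 0 < e / 2 by rewrite divr_gt0.
  have [N1 H1] := wint_eventually0 iu' bf f1 f0 e2.
  have [N2 H2] := wint_eventually0 iw' bf f1 f0 e2.
  exists (N1 + N2)%N => n Nn; rewrite /tau !mul1r.
  have := H1 n (leq_trans (leq_addr _ _) Nn); have := H2 n (leq_trans (leq_addl _ _) Nn).
  by have := ler_normD (wint m1 (fun x => `|u x|) (f n)) (wint m2 (fun x => `|w x|) (f n)); lra.
have [_ app] := measurable_lip_approximable lt mt ev mA.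
apply/ler_addgt0Pr => e /app[psi [lp p01 pe]].
have pos := lipschitz_positive iu iw H lp (fun z => proj1 (andP (p01 z))).
have bA := bmeas_indic mA; have bp := bmeas_lipschitz lp.
have key (m : {finite_measure set T -> \bar R}) v : L1 m v ->
    wint m v (fun x => psi (zv x)) - wint m v (\1_A) <=
    wint m (fun x => `|v x|) (fun x => `|\1_A x - psi (zv x)|).
  move=> iv; rewrite -(linear_bmB (linear_wint iv)) //.
  apply: le_Rintegral => //; [apply: L1M => //; exact: bmeasB| |].
    apply: L1M; first exact: integrable_norm.
    by apply: bmeas_abs; exact: bmeasB.
  by move=> x _; apply: le_trans (ler_norm _) _; rewrite normrM distrC.
have := key m1 u iu; have := key m2 w iw; move: pe pos; rewrite /tau !mul1r; lra.
Qed.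

(** On a set that is null for one of the two measures, positivity of the sum concerns the other
    density alone, and the set where that density is negative must be null. *)
Lemma positive_ae (m1 m2 : {finite_measure set T -> \bar R}) u w :
  mutually_singular m1 m2 -> L1 m1 u -> L1 m2 w ->
  (forall l, 0 < cabs l < 1 -> 0 <= wint m1 u (poisson l) + wint m2 w (poisson l)) ->
  (\forall x \ae m1, 0 <= u x) /\ (\forall x \ae m2, 0 <= w x).
Proof.
move=> [N [mN N1 N2]] iu iw H; have pos := positive_measure iu iw H.
have mz (v : T -> R) (m : {measure set T -> \bar R}) : L1 m v -> measurable [set x | v x < 0].
  move=> /measurable_int/measurable_EFinP mv.
  rewrite (_ : [set _ | _] = v @^-1` `]-oo, 0[%classic); last first.
    by apply/seteqP; split => x /=; rewrite in_itv.
  by rewrite -[X in measurable X]setTI; exact: mv.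
have null (m : {finite_measure set T -> \bar R}) v B : L1 m v -> measurable B -> m B = 0%E ->
    wint m v (\1_B) = 0.
  move=> iv mB mB0; transitivity (\int[m]_x (0 : R)); last by rewrite /Rintegral integral0.
  rewrite /wint /Rintegral; congr fine.
  apply: ae_eq_integral => //; first exact: (measurable_int _ (L1M iv (bmeas_indic mB))).
  exists B; split => // x /= Hx; apply: contrapT => nB; apply: Hx => _.
  by rewrite indicE memNset // mul0r.
have neg (m : {finite_measure set T -> \bar R}) v B : L1 m v -> measurable B ->
    (forall x, B x -> v x < 0) -> 0 <= wint m v (\1_B) -> m B = 0%E.
  move=> iv mB vB v0; have iB := L1M iv (bmeas_indic mB).
  have Babs x : `|(\1_B x : R) * v x| = -1 * (\1_B x * v x).
    rewrite indicE; case: (pselect (B x)) => xB; last by rewrite memNset // !mul0r mulr0 normr0.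
    by rewrite mem_set // !mul1r mulN1r ltr0_norm // vB.
  have R0 : \int[m]_x `|(\1_B x : R) * v x| = 0.
    apply/eqP; rewrite eq_le Rintegral_ge0 // andbT.
    under eq_Rintegral do rewrite Babs.
    by rewrite RintegralZl // mulN1r oppr_le0.
  have : (\int[m]_(x in setT) `|(\1_B x * v x)%:E| = 0)%E.
    rewrite -[RHS]/(0%R%:E) -R0 /Rintegral fineK //.
    by apply: integrable_fin_num => //; exact: integrable_norm.
  have mBv : measurable_fun setT (fun x => (\1_B x * v x)%:E) by exact: measurable_int iB.
  move=> /(ae_eq_integral_abs m measurableT mBv)[Z [mZ Z0 BZ]].
  apply: (subset_measure0 mB mZ _ Z0) => x Bx; apply: BZ => /= /(_ I) /eqP.
  by rewrite eqe indicE mem_set // mul1r; apply/negP; rewrite lt_eqF // vB.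
have nonneg (m m' : {finite_measure set T -> \bar R}) v v' E : L1 m v -> L1 m' v' ->
    measurable E -> m E = 0%E -> m' (~` E) = 0%E ->
    (forall A, measurable A -> 0 <= wint m v (\1_A) + wint m' v' (\1_A)) ->
    \forall x \ae m, 0 <= v x.
  move=> iv iv' mE E1 E2 H'; have mv := mz _ _ iv.
  have mvN : measurable ([set x | v x < 0] `\` E) by exact: measurableD.
  have m0 : m ([set x | v x < 0] `\` E) = 0%E.
    apply: (neg m v) => // [x []//|].
    have := H' _ mvN; rewrite (null m' v') ?addr0 //.
    apply: (subset_measure0 _ (measurableC mE) _ E2) => //.
    exists ([set x | v x < 0] `\` E `|` E); split; first exact: measurableU.
    apply/eqP; rewrite eq_le measure_ge0 andbT; apply: le_trans (measureU2 _ _ _) _ => //.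
    by rewrite [X in (X + _)%E]m0 [X in (_ + X)%E]E1 adde0.
  move=> x /= /negP; rewrite -ltNge => vx.
  by have [Ex|nEx] := pselect (E x); [right|left].
split; first exact: (nonneg m1 m2 u w N).
apply: (nonneg m2 m1 w u (~` N)) => //; first exact: measurableC.
  by rewrite setCK.
by move=> B mB; rewrite addrC pos.
Qed.

End PositiveMeasures.

(** * Convex sets and tubes *)
Section ConvexGeometry.
Variables (R : realType) (n : nat).
Implicit Types (x y v p : 'rV[R]_n) (t c d e : R) (Omega : set 'rV[R]_n).

Lemma dotDl x y v : dot (x + y) v = dot x v + dot y v.
Proof. by rewrite /dot -big_split /=; apply: eq_bigr => j _; rewrite mxE mulrDl. Qed.

Lemma dotZl t x v : dot (t *: x) v = t * dot x v.
Proof. by rewrite /dot mulr_sumr; apply: eq_bigr => j _; rewrite mxE mulrA. Qed.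

Lemma dotC x v : dot x v = dot v x.
Proof. by apply: eq_bigr => j _; rewrite mulrC. Qed.

Lemma dotBl x y v : dot (x - y) v = dot x v - dot y v.
Proof. by rewrite -scaleN1r dotDl dotZl mulN1r. Qed.

Lemma dotDr x y v : dot v (x + y) = dot v x + dot v y.
Proof. by rewrite dotC dotDl !(dotC v). Qed.

Lemma dotZr t x v : dot v (t *: x) = t * dot v x.
Proof. by rewrite dotC dotZl (dotC v). Qed.

Lemma dotBr x y v : dot v (x - y) = dot v x - dot v y.
Proof. by rewrite dotC dotBl !(dotC v). Qed.

Lemma dot_ge0 x : 0 <= dot x x.
Proof. by rewrite sumr_ge0 // => j _; rewrite -expr2 sqr_ge0. Qed.

Lemma coord_sqr_le x j : x 0 j ^+ 2 <= dot x x.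
Proof.
rewrite /dot (bigD1 j) //= expr2 lerDl sumr_ge0 // => i _.
by rewrite -expr2 sqr_ge0.
Qed.

Lemma dot_eq0 x : dot x x = 0 -> x = 0.
Proof.
move=> x0; apply/rowP => j; rewrite mxE; apply/eqP.
by rewrite -sqrf_eq0 eq_le sqr_ge0 andbT -x0 coord_sqr_le.
Qed.

Lemma dot_le_sum x v d : (forall j, `|x 0 j| <= d) -> `|dot x v| <= d * \sum_j `|v 0 j|.
Proof.
move=> xd; apply: le_trans (ler_norm_sum _ _ _) _; rewrite mulr_sumr.
by apply: ler_sum => j _; rewrite normrM ler_wpM2r.
Qed.

Lemma norm_rV_le x d : 0 <= d -> (forall j, `|x 0 j| <= d) -> `|x| <= d.
Proof.
move=> d0 xd; rewrite [leLHS](_ : _ = mx_norm x) // mx_normE.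
rewrite (_ : d = (NngNum d0)%:num) // num_le.
apply/bigmax_leP; split => [|[i j] _]; first by rewrite -num_le.
by rewrite -num_le /= ord1.
Qed.

Lemma nbhs_rVP x (A : set 'rV[R]_n) :
  nbhs x A <-> exists2 e, 0 < e & forall y, (forall j, `|y 0 j - x 0 j| < e) -> A y.
Proof.
split=> [/nbhs_ballP[e /= e0 He]|[e e0 He]].
  exists e => // y yx; apply: He; rewrite -ball_normE /ball_ /=.
  rewrite [ltLHS](_ : _ = mx_norm (x - y)) // mx_normE.
  rewrite (_ : e = (NngNum (ltW e0))%:num) // num_lt.
  apply/bigmax_ltP; split => [|[i j] _]; first by rewrite -num_lt.
  by rewrite -num_lt /= !mxE ord1 distrC.
apply/nbhs_ballP; exists e => //= y yx; apply: He => j.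
move: yx; rewrite -ball_normE /ball_ /=; apply: le_lt_trans.
by rewrite distrC -[leLHS](_ : `|(x - y) 0 j| = _) ?norm_coord_le // !mxE.
Qed.

Lemma closure_rVP Omega x :
  closure Omega x <-> forall e, 0 < e -> exists2 y, Omega y & forall j, `|y 0 j - x 0 j| < e.
Proof.
split=> [Ox e e0|H A /nbhs_rVP[e e0 HA]].
  have [|y [Oy yx]] := Ox [set y | forall j, `|y 0 j - x 0 j| < e].
    by apply/nbhs_rVP; exists e.
  by exists y.
by have [y Oy yx] := H e e0; exists y; split => //; exact: HA.
Qed.

Definition convexR Omega := forall x y t, Omega x -> Omega y -> 0 <= t <= 1 ->
  Omega (t *: x + (1 - t) *: y).

(** The boundary point y is replaced by a nearby y' of Omega; the displacement is transferred to x,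
    around which Omega contains a box. *)
Lemma open_convex_interior Omega x y t : open Omega -> convexR Omega ->
  Omega x -> closure Omega y -> 0 < t <= 1 -> Omega (t *: x + (1 - t) *: y).
Proof.
move=> oO cO Ox /closure_rVP Oy /andP[t0 t1].
have /nbhs_rVP[e e0 He] : nbhs x Omega by exact: open_nbhs_nbhs.
have [y' Oy' yy'] := Oy (e * t) (mulr_gt0 e0 t0).
pose x' := x + ((1 - t) / t) *: (y - y').
have Ox' : Omega x'.
  apply: He => j; rewrite !mxE [x 0 j + _]addrC addrK normrM normrM normfV (gtr0_norm t0).
  rewrite ger0_norm ?subr_ge0 // mulrAC ltr_pdivrMr //.
  apply: le_lt_trans (_ : `|y' 0 j - y 0 j| < _) => //; rewrite distrC ler_piMl //.
  by rewrite lerBlDr lerDl ltW.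
have -> : t *: x + (1 - t) *: y = t *: x' + (1 - t) *: y'.
  by apply/rowP => j; rewrite !mxE; field; rewrite gt_eqF.
by apply: cO => //; rewrite ltW.
Qed.

Lemma closure_convex Omega : convexR Omega -> convexR (closure Omega).
Proof.
move=> cO x y t /closure_rVP Ox /closure_rVP Oy /andP[t0 t1].
apply/closure_rVP => e e0; have [x' Ox' xx'] := Ox e e0; have [y' Oy' yy'] := Oy e e0.
exists (t *: x' + (1 - t) *: y'); first by apply: cO => //; rewrite t0.
move=> j; rewrite !mxE.
rewrite (_ : _ - _ = t * (x' 0 j - x 0 j) + (1 - t) * (y' 0 j - y 0 j)); last by ring.
have := xx' j; have := yy' j; rewrite !ltr_norml; move: (_ - _) (_ - _) => a b /andP[a1 a2] /andP[b1 b2].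
have lt_conv (s p q : R) : 0 <= s -> s <= 1 -> 0 < p -> 0 < q -> 0 < s * p + (1 - s) * q.
  by move=> s0 s1 p0 q0; have [sh|sh] := leP s (2^-1); nra.
have := lt_conv t (a + e) (b + e) t0 t1; have := lt_conv t (e - a) (e - b) t0 t1.
move=> h1 h2.
apply/andP; split.
  have : 0 < t * (a + e) + (1 - t) * (b + e) by apply: h2; lra.
  by lra.
have : 0 < t * (e - a) + (1 - t) * (e - b) by apply: h1; lra.
by lra.
Qed.

Lemma dot_continuous y : continuous (fun x => dot (x - y) (x - y)).
Proof.
pose F j (z : 'rV[R]_n) := (z - y) 0 j * (z - y) 0 j.
suff H (s : seq 'I_n) : continuous (fun z => \sum_(j <- s) F j z) by exact: H.
elim: s => [|j s ih].
  by under [X in continuous X]eq_fun do rewrite big_nil; exact: cst_continuous.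
under [X in continuous X]eq_fun do rewrite big_cons.
move=> z; apply: continuousD; last exact: ih.
have cj : {for z, continuous (fun z : 'rV[R]_n => (z - y) 0 j)}.
  rewrite (_ : (fun _ => _) = fun z : 'rV[R]_n => z 0 j - y 0 j).
    by apply: continuousB; [exact: coord_continuous|exact: cst_continuous].
  by apply/funext => w; rewrite !mxE.
exact: continuousM.
Qed.

Lemma closest_point Omega y : Omega !=set0 ->
  exists2 p, closure Omega p & forall x, closure Omega x -> dot (p - y) (p - y) <= dot (x - y) (x - y).
Proof.
move=> [x0 Ox0]; pose f x := dot (x - y) (x - y).
pose A := closure Omega `&` [set x | f x <= f x0].
have cf : continuous f by exact: dot_continuous.
have A0 : A !=set0 by exists x0; split; [exact: subset_closure|rewrite /= lexx].
have cA : compact A.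
  apply: bounded_closed_compact.
    exists (`|y| + (f x0 + 1)); split; first exact: num_real.
    move=> M HM x [_ /= fx]; apply: le_trans (ltW HM).
    rewrite -[x](subrKC y); apply: le_trans (ler_normD _ _) _; rewrite lerD2l.
    apply: norm_rV_le => [|j]; first by rewrite addr_ge0 ?dot_ge0.
    have := coord_sqr_le (x - y) j; have := dot_ge0 (x0 - y); rewrite -/(f x) -/(f x0).
    move: fx; move: (f x) (f x0) ((x - y) 0 j) => a b c; clear; rewrite ler_norml => *.
    by apply/andP; split; nra.
  apply: closedI; first exact: closed_closure.
  apply: (@closed_comp _ _ f [set t | t <= f x0]); last exact: closed_le.
  by move=> z _; exact: cf.
have [c cA' Hc] := @compact_EVT_min _ R f A A0 cA (continuous_subspaceT cf).
move: cA'; rewrite inE => -[Oc fc]; exists c => // x Ox.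
have [fx|/ltW fx] := leP (f x) (f x0); first by apply: Hc; rewrite inE.
exact: le_trans fc fx.
Qed.

(** The hyperplane passes through the point p of the closure closest to y, with normal y - p. It
    separates a whole box around y, which is what allows rational boxes in [ae_closure]. *)
Lemma separation Omega y : Omega !=set0 -> convexR Omega -> ~ closure Omega y ->
  exists v c d, [/\ 0 < d, forall x, closure Omega x -> dot x v <= c &
    forall y', (forall j, `|y' 0 j - y 0 j| < d) -> c < dot y' v].
Proof.
move=> O0 cO Oy; have [p Op Hp] := closest_point y O0.
have [v vE] : exists v, y - p = v by exists (y - p).
have pyE : p - y = - v by rewrite -vE opprB.
have v0 : 0 < dot v v.
  rewrite -vE lt_def dot_ge0 andbT; apply/eqP => /dot_eq0 /eqP; rewrite subr_eq0 => /eqP yp.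
  by apply: Oy; rewrite yp.
have vp x : closure Omega x -> dot x v <= dot p v.
  move=> Ox; rewrite -subr_le0 -dotBl leNgt; apply/negP => a0.
  set a := dot _ _ in a0; pose b := dot (x - p) (x - p).
  have b0 : 0 <= b by exact: dot_ge0.
  (* Moving from p towards x by t changes the squared distance to y by t (t b - 2 a), which is
     negative since t b <= a. *)
  pose t := a / (a + b + 1); have ab : 0 < a + b + 1 by lra.
  have t0 : 0 < t by rewrite divr_gt0.
  have t1 : t <= 1 by rewrite ler_pdivrMr //; lra.
  have Oz : closure Omega (t *: x + (1 - t) *: p).
    by apply: (closure_convex cO) => //; rewrite t1 ltW.
  have := Hp _ Oz.
  have -> : t *: x + (1 - t) *: p - y = t *: (x - p) - v.
    by rewrite -vE; apply/rowP => j; rewrite !mxE; ring.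
  rewrite pyE dotBl !dotBr !dotZl !dotZr -/b (dotC v (x - p)) -/a.
  have -> : dot (- v) (- v) = dot v v by rewrite -scaleN1r dotZl dotZr mulrA mulrNN !mul1r.
  have : t * (a + b + 1) = a by rewrite /t divfK // gt_eqF.
  move: (dot v v) => w; clear -t0 a0 b0; nra.
pose s := \sum_j `|v 0 j|; have s0 : 0 <= s by rewrite sumr_ge0.
exists v, (dot p v), (dot v v / (s + 1)); split => //; first by rewrite divr_gt0 // ltr_wpDl.
move=> y' yy'; have s1 : 0 < s + 1 by rewrite ltr_wpDl.
have : `|dot (y' - y) v| <= dot v v / (s + 1) * s.
  by apply: dot_le_sum => j; rewrite !mxE ltW.
have : dot v v / (s + 1) * s < dot v v.
  by rewrite -mulrA gtr_pMr // mulrC ltr_pdivrMr // mul1r ltrDl.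
rewrite ler_norml dotBl; have : dot v v = dot y v - dot p v by rewrite -dotBl vE.
move: (_ * s) => q; lra.
Qed.

Lemma rat_row_approx x e : 0 < e ->
  exists q : 'rV[rat]_n, forall j, `|ratr (q 0 j) - x 0 j| < e.
Proof.
move=> e0; have H j : exists q : rat, `|ratr q - x 0 j| < e.
  have xe : x 0 j - e < x 0 j + e by lra.
  have [q] := rat_in_itvoo xe.
  by rewrite in_itv /= => qx; exists q; rewrite ltr_norml; lra.
exists (\row_j xchoose (H j)) => j; rewrite mxE; exact: (xchooseP (H j)).
Qed.

Definition rat_row (q : 'rV[rat]_n) : 'rV[R]_n := map_mx ratr q.

Section AlmostEverywhere.
Context disp (T : measurableType disp) (m : {measure set T -> \bar R}).

Lemma ae_forall_countable (I : countType) (P : I -> T -> Prop) :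
  (forall i, \forall z \ae m, P i z) -> \forall z \ae m, forall i, P i z.
Proof.
move=> H; have : \forall z \ae m, forall k : nat,
    if unpickle k is Some i then P i z else True.
  apply: ae_foralln => k; case: (unpickle k) => [i|]; first exact: H.
  exact: aeW.
apply: filterS => z Hz i; by have := Hz (pickle i); rewrite pickleK.
Qed.

(** There are uncountably many half-spaces, each with its own null set. But every point outside the
    closure lies in one of countably many rational boxes, and one half-space per separated box is
    enough. *)
Lemma ae_closure Omega (g : T -> 'rV[R]_n) : Omega !=set0 -> convexR Omega ->
  (forall v c, (forall x, Omega x -> dot x v <= c) -> \forall z \ae m, dot (g z) v <= c) ->
  \forall z \ae m, closure Omega (g z).
Proof.
move=> O0 cO H.
pose box (q : 'rV[rat]_n) (k : nat) := [set y' : 'rV[R]_n | forall j, `|y' 0 j - rat_row q 0 j| < k.+1%:R^-1].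
pose sep q k v c := (forall x, Omega x -> dot x v <= c) /\ forall y', box q k y' -> c < dot y' v.
have : \forall z \ae m, forall i : 'rV[rat]_n * nat,
    (exists v c, sep i.1 i.2 v c) -> ~ box i.1 i.2 (g z).
  apply: ae_forall_countable => -[q k] /=.
  have [[v [c [Hv Hb]]]|nsep] := pselect (exists v c, sep q k v c); last exact: aeW.
  by apply: filterS (H v c Hv) => z gz _ /Hb; rewrite ltNge gz.
apply: filterS => z Hz; apply: contrapT => /(separation O0 cO)[v [c [e [e0 Hv He]]]].
pose k := Num.bound (2 / e).
(* A point of the rational box is at most two box radii away from g z in each coordinate. *)
have ke : 2 * k.+1%:R^-1 < e.
  rewrite ltr_pdivrMr // mulrC -ltr_pdivrMr //.
  apply: lt_trans (archi_boundP _) _; first by rewrite divr_ge0 // ltW.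
  by rewrite ltr_nat.
have k0 : 0 < k.+1%:R^-1 :> R by rewrite invr_gt0 ltr0n.
have [q Hq] := rat_row_approx (g z) k0.
apply: (Hz (q, k)).
  exists v, c; split=> [x Ox|y' Hy']; first by apply: Hv; exact: subset_closure.
  apply: He => j; apply: lt_trans ke.
  rewrite (_ : _ - _ = (y' 0 j - rat_row q 0 j) + (rat_row q 0 j - g z 0 j)); last by ring.
  apply: le_lt_trans (ler_normD _ _) _; rewrite mulr_natl mulr2n; apply: ltrD; first exact: Hy'.
  by rewrite mxE.
by move=> j /=; rewrite mxE distrC.
Qed.

End AlmostEverywhere.

Section Tubes.
Variable D : set 'rV[R[i]]_n.
Hypothesis hD : is_convex_tube_domain D.

Definition complexify x y : 'rV[R[i]]_n := \row_j (x 0 j +i* y 0 j).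

Lemma Re_complexify x y : Re_vec (complexify x y) = x.
Proof. by apply/rowP => j; rewrite !mxE. Qed.

Lemma tubeE : [/\ ReD D !=set0, open (ReD D), convexR (ReD D) & forall z, D z <-> ReD D (Re_vec z)].
Proof.
case: hD => [] [U [U0 oU _ DE]] cD.
have RE : ReD D = U.
  apply/seteqP; split => [x [z Dz <-]|x Ox]; first by move: Dz; rewrite DE.
  by exists (complexify x 0); rewrite ?Re_complexify // DE /= Re_complexify.
rewrite RE; split => // [|z]; last by rewrite DE.
move=> x y t Ox Oy /andP[t0 t1].
have t0' : 0 <= t%:C by rewrite lecR.
have t1' : t%:C <= 1 by rewrite lecR.
have := cD (complexify x 0) (complexify y 0) (Itv01 t0' t1').
rewrite !inE DE /= !Re_complexify => /(_ Ox Oy).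
congr U; apply/rowP => j; rewrite /conv /= !mxE !ReImE /=; ring.
Qed.

Lemma tube_nbhs z : D z -> exists2 d, 0 < d &
  forall w : 'rV[R[i]]_n, (forall j, `|complex.Re (w 0 j) - complex.Re (z 0 j)| < d) -> D w.
Proof.
have [_ oO _ DE] := tubeE; move=> /DE Oz.
have /nbhs_rVP[d d0 Hd] : nbhs (Re_vec z) (ReD D) by exact: open_nbhs_nbhs.
exists d => // w Hw; apply/DE; apply: Hd => j; by rewrite !mxE.
Qed.

Lemma W_P v : W_ D v <-> exists c, forall x, ReD D x -> dot x v <= c.
Proof.
split=> [Wv|[c Hc]].
  have [[x0 Ox0] _ _ _] := tubeE.
  pose s := ereal_sup [set (dot x v)%:E | x in ReD D].
  have sx x : ReD D x -> ((dot x v)%:E <= s)%E by move=> Ox; apply: ereal_sup_ubound; exists x.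
  have sf : s \is a fin_num.
    by rewrite fin_numElt (lt_le_trans (ltNyr (dot x0 v)) (sx _ Ox0)).
  by exists (fine s) => x /sx; rewrite -lee_fin fineK.
apply: (@le_lt_trans _ _ c%:E); last exact: ltry.
by apply: ub_ereal_sup => _ [x Ox <-]; rewrite lee_fin Hc.
Qed.

End Tubes.

End ConvexGeometry.

(** * The left inverse *)
Section ImplicitFunction.
Variables (R : realType) (n : nat).
Notation C := R[i]^o.
Implicit Types (x y z v : 'rV[R[i]]_n).

(** Implicit differentiation of the equation satisfied by f. The lower bound on |F| yields both that
    f is Lipschitz at z and that F'(f z) is nonzero; the derivative is then A^-1 hv_j(f z). *)
Lemma implicit_holomorphic (f : 'rV[R[i]]_n -> C) z (F : C -> C) (hv : 'I_n -> C -> C)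
    (r c H d : R) :
  differentiable F (f z) -> (forall j, {for f z, continuous (hv j)}) ->
  0 < c -> 0 < d -> (forall l, cabs l < r -> c * cabs (l - f z) <= cabs (F l)) ->
  (forall j l, cabs l < r -> cabs (hv j l) <= H) ->
  (forall z', vabs (z' - z) < d -> cabs (f z') < r /\
     F (f z') = \sum_j hv j (f z') * (z' 0 j - z 0 j)) ->
  holomorphic_at f z.
Proof.
move=> dF ch c0 d0 LB hH fE; set A := 'd F (f z) 1.
have FA : has_cderiv F (f z) A by exact: differentiable_cderiv.
have [fr Fz] : cabs (f z) < r /\ F (f z) = 0.
  have [|fr ->] := fE z; first by rewrite subrr vabs0.
  by split=> //; rewrite big1 // => j _; rewrite subrr mulr0.
have A0 : A != 0.
  apply/eqP => A0; have c2 : 0 < c / 2 by rewrite divr_gt0.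
  have [e e0 He] := FA _ c2.
  pose q := Num.min (e / 2) ((r - cabs (f z)) / 2).
  have q0 : 0 < q by rewrite lt_min !divr_gt0 // subr_gt0.
  have [qe qr] : q <= e / 2 /\ q <= (r - cabs (f z)) / 2.
    by rewrite !ge_min !lexx orbT.
  pose w := f z + q%:C; have wz : cabs (w - f z) = q.
    by rewrite /w addrC addKr cabs_real gtr0_norm.
  have := He w; rewrite wz A0 mul0r subr0 Fz subr0 => /(_ _).
  have wr : cabs w < r.
    by apply: le_lt_trans (cabsD _ _) _; rewrite cabs_real gtr0_norm //; lra.
  have := LB w wr; rewrite wz => h1 h2.
  have /h2 : q < e by lra.
  by move: (cabs (F w)) h1 => X; clear -c0 q0; nra.
have H0 : 0 <= Num.max H 0 by rewrite le_max lexx orbT.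
pose K := n%:R * Num.max H 0 / c.
have K0 : 0 <= K by rewrite divr_ge0 ?mulr_ge0 // ltW.
have coord z' j : cabs (z' 0 j - z 0 j) <= vabs (z' - z).
  by have := cabs_coord_le (z' - z) j; rewrite !mxE.
have lip z' : vabs (z' - z) < d -> cabs (f z' - f z) <= K * vabs (z' - z).
  move=> /fE[f'r FE]; rewrite /K mulrAC ler_pdivlMr // mulrC.
  apply: le_trans (LB _ f'r) _; rewrite FE.
  apply: (@le_trans _ _ (\sum_(j < n) Num.max H 0 * vabs (z' - z))); last first.
    by rewrite sumr_const card_ord -[leRHS]mulrA mulr_natl.
  apply: le_trans (_ : _ <= \sum_j cabs (hv j (f z') * (z' 0 j - z 0 j))) _.
    elim/big_ind2 : _ => [|x1 x2 y1 y2 h1 h2|//]; first by rewrite cabs0.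
    by apply: le_trans (cabsD _ _) _; exact: lerD.
  apply: ler_sum => j _; rewrite cabsM; apply: ler_pM; rewrite ?cabs_ge0 ?coord //.
  by rewrite le_max hH.
apply: (@vderiv_differentiable _ _ _ _ (fun j => A^-1 * hv j (f z))) => e e0.
have A1 : 0 < cabs A by rewrite cabs_gt0.
pose e1 := e * cabs A / (2 * (K + 1)); have K1 : 0 < K + 1 by rewrite ltr_wpDl.
have e10 : 0 < e1 by rewrite !divr_gt0 ?mulr_gt0.
have [d1 d10 Hd1] := FA _ e10.
pose e2 := e * cabs A / (2 * (n%:R + 1)); have n1 : 0 < n%:R + 1 :> R by rewrite ltr_wpDl.
have e20 : 0 < e2 by rewrite !divr_gt0 ?mulr_gt0.
have [d2 d20 Hd2] : exists2 d2, 0 < d2 & forall l, cabs (l - f z) < d2 ->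
    forall j, cabs (hv j l - hv j (f z)) < e2.
  have /fin_all_exists2[dd dd0 Hdd] : forall j, exists2 d2, 0 < d2 & forall l, cabs (l - f z) < d2 ->
      cabs (hv j l - hv j (f z)) < e2.
    by move=> j; have /cts_CC := ch j; apply.
  exists (\big[Num.min/1]_j dd j); first exact: lt_bigmin.
  move=> l ld j; apply: Hdd; apply: lt_le_trans ld _; exact: bigmin_le.
pose d3 := Num.min d (Num.min d1 d2 / (K + 1)).
exists d3; first by rewrite lt_min d0 divr_gt0 // lt_min d10.
move=> z'; rewrite lt_min => /andP[zd]; rewrite ltr_pdivlMr // mulrC lt_min => /andP[zd1 zd2].
have [f'r FE] := fE z' zd; have L := lip z' zd.
have V0 := vabs_ge0 (z' - z).
have LK : cabs (f z' - f z) <= (K + 1) * vabs (z' - z) by nra.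
have h1 := Hd1 _ (le_lt_trans LK zd1); have h2 := Hd2 _ (le_lt_trans LK zd2).
rewrite Fz subr0 FE in h1.
have key : A * (f z' - f z - \sum_j A^-1 * hv j (f z) * (z' - z) 0 j) =
    (\sum_j (hv j (f z') - hv j (f z)) * (z' 0 j - z 0 j)) -
    ((\sum_j hv j (f z') * (z' 0 j - z 0 j)) - A * (f z' - f z)).
  rewrite mulrBr mulr_sumr; under eq_bigr do rewrite !mulrA mulfV // mul1r !mxE.
  under [in RHS]eq_bigr do rewrite mulrBl.
  by rewrite sumrB; move: (\sum_(i < n) _) (\sum_(i < n) _) => X Y; ring.
rewrite -(ler_pM2l A1) -cabsM key.
apply: le_trans (cabsB _ _) _.
apply: le_trans (lerD (_ : _ <= e2 * n%:R * vabs (z' - z)) h1) _.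
  apply: (@le_trans _ _ (\sum_(j < n) e2 * vabs (z' - z))); last first.
    by rewrite sumr_const card_ord -[leLHS]mulr_natr [leLHS]mulrAC.
  apply: le_trans (_ : _ <= \sum_j cabs ((hv j (f z') - hv j (f z)) * (z' 0 j - z 0 j))) _.
    elim/big_ind2 : _ => [|x1 x2 y1 y2 u1 u2|//]; first by rewrite cabs0.
    by apply: le_trans (cabsD _ _) _; exact: lerD.
  by apply: ler_sum => j _; rewrite cabsM; apply: ler_pM; rewrite ?cabs_ge0 ?coord // ltW.
have E1 : e1 * (K + 1) = e * cabs A / 2 by rewrite /e1; field; rewrite gt_eqF.
have E2 : e2 * (n%:R + 1) = e * cabs A / 2 by rewrite /e2; field; rewrite gt_eqF.
have h3 : e1 * cabs (f z' - f z) <= e * cabs A / 2 * vabs (z' - z).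
  by rewrite -E1 -mulrA ler_pM2l.
have h4 : e2 * n%:R * vabs (z' - z) <= e * cabs A / 2 * vabs (z' - z).
  by rewrite -E2 ler_wpM2r // ler_pM2l // lerDl.
apply: le_trans (lerD h4 h3) _; rewrite -mulrDl.
by rewrite (_ : _ + _ = cabs A * e) ?mulrA //; field.
Qed.

End ImplicitFunction.

(** * Harnack's inequality along segments of a convex tube *)

Section HarnackChain.
Variables (R : realType) (n : nat) (D : set 'rV[R[i]]_n).
Hypothesis hD : is_convex_tube_domain D.
Notation C := R[i]^o.

Lemma line_differentiable (w v : 'rV[R[i]]_n) (t : C) :
  differentiable (fun t : C => w + t *: v) t.
Proof.
by apply: differentiableD => //; apply: differentiableZl.
Qed.

(** The bound r is uniform in f. The segment from p to z is cut into N steps, each half the radius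
    of an affine disc inside D, and every step costs a factor 1/5 in 1 - |f|, which is 1 at p. *)
Lemma harnack_chain p z0 : D p -> D z0 -> exists r d, [/\ 0 < d, 0 <= r < 1,
    forall z, vabs (z - z0) < d -> D z &
    forall f : 'rV[R[i]]_n -> C, (forall z, D z -> holomorphic_at f z) ->
      (forall z, D z -> cabs (f z) <= 1) -> f p = 0 ->
    forall z, vabs (z - z0) < d -> cabs (f z) <= r].
Proof.
move=> Dp Dz0; have [_ _ cO DE] := tubeE hD.
have [d1 d10 H1] := tube_nbhs hD Dp; have [d2 d20 H2] := tube_nbhs hD Dz0.
pose d := Num.min d1 d2; have d0 : 0 < d by rewrite lt_min d10.
have Rc (z : 'rV[R[i]]_n) j : `|complex.Re (z 0 j)| <= vabs z.
  exact: le_trans (Re_le_cabs _) (cabs_coord_le _ _).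
have tubeP eta : vabs eta < d -> D (p + eta).
  move=> ed; apply: H1 => j; rewrite mxE Re_add addrC addKr.
  by apply: le_lt_trans (Rc _ _) (lt_le_trans ed _); rewrite ge_min lexx.
have tubeZ z : vabs (z - z0) < d -> D z.
  move=> zd; apply: H2 => j; have := Rc (z - z0) j; rewrite !mxE Re_add Re_opp.
  by move=> h; apply: le_lt_trans h (lt_le_trans zd _); rewrite ge_min lexx orbT.
pose B := vabs (z0 - p) + d; have B0 : 0 < B by rewrite ltr_wpDl // vabs_ge0.
pose N := (Num.bound (4 * B / d)).+1; have N0 : 0 < N%:R :> R by rewrite ltr0n.
have NB : 2 * B / N%:R < d / 2.
  rewrite ltr_pdivrMr // [ltRHS]mulrC -ltr_pdivrMr ?divr_gt0 //.
  rewrite (_ : 2 * B / (d / 2) = 4 * B / d); last by field; rewrite gt_eqF.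
  apply: lt_trans (archi_boundP _) _; first by rewrite divr_ge0 ?mulr_ge0 // ltW.
  by rewrite ltr_nat.
have r01 : 0 <= (1 - 5^-1 ^+ N : R) < 1.
  have p5 : 0 < 5^-1 ^+ N :> R by rewrite exprn_gt0 // invr_gt0.
  by rewrite subr_ge0 expr_le1 // ?invr_ge0 ?invf_le1 ?ler1n //= ltrBlDr ltrDl p5.
exists (1 - 5^-1 ^+ N), (d / 2); split => // [||f df f1 fp z zd].
- by rewrite divr_gt0.
- by move=> z zd; apply: tubeZ; apply: lt_trans zd _; rewrite ltr_pdivrMr // ltr_pMr // ltr1n.
pose V := z - p; have VB : vabs V <= B.
  rewrite /V (_ : z - p = (z0 - p) + (z - z0)); last by rewrite [RHS]addrC addrA subrK.
  apply: le_trans (vabsD _ _) _; rewrite lerD2l ltW //; apply: lt_trans zd _.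
  by rewrite ltr_pdivrMr // ltr_pMr // ltr1n.
have seg (t : R) (eta : 'rV[R[i]]_n) : 0 <= t <= 1 -> vabs eta < d / 2 -> D (p + t%:C *: V + eta).
  move=> t01 ed; apply/DE.
  have dh : d / 2 < d by rewrite ltr_pdivrMr // ltr_pMr // ltr1n.
  have Dpe : ReD D (Re_vec (p + eta)) by apply/DE/tubeP; exact: lt_trans ed dh.
  have Dze : ReD D (Re_vec (z + eta)).
    apply/DE/tubeZ; rewrite (_ : z + eta - z0 = (z - z0) + eta); last by rewrite addrAC.
    by apply: le_lt_trans (vabsD _ _) _; rewrite [ltRHS](splitr d) ltrD.
  have := cO _ _ t Dze Dpe t01; congr (ReD D _).
  by apply/rowP => j; rewrite !mxE !ReImE /=; ring.
have step k : (k <= N)%N -> 5^-1 ^+ k <= 1 - cabs (f (p + (k%:R / N%:R)%:C *: V)).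
  elim: k => [|k ih] kN; first by rewrite mul0r scale0r addr0 fp cabs0 subr0 expr0.
  have t01 : 0 <= (k%:R / N%:R : R) <= 1.
    by rewrite divr_ge0 //= ler_pdivrMr // mul1r ler_nat ltnW.
  set w := p + _ *: V in ih.
  (* On the disc t -> w + t v the next division point is at t = 1/2, the range of [harnack]. *)
  pose v := (2 / N%:R)%:C *: V.
  have wD (t : C) : cabs t < 1 -> D (w + t *: v).
    move=> t1; apply: seg => //; rewrite !vabsZ cabs_real ger0_norm ?divr_ge0 //.
    apply: le_lt_trans NB; rewrite mulrA mulrAC.
    have X : 0 <= 2 / N%:R :> R by rewrite divr_ge0.
    have := cabs_ge0 t; have := vabs_ge0 V; rewrite [2 * B / _]mulrAC; move: (2 / N%:R) X => q q0.
    move=> v0 t0; rewrite [leLHS]mulrC ler_wpM2l // -[leRHS]mul1r.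
    by apply: ler_pM => //; exact: ltW.
  pose u : C -> C := fun t => f (w + t *: v).
  have du : hol_disc u.
    move=> t t1; apply: (@differentiable_comp _ _ _ _ (fun t : C => w + t *: v) f).
      exact: line_differentiable.
    exact: (df _ (wD t t1)).
  have u1 t : cabs t < 1 -> cabs (u t) <= 1 by move=> t1; exact: f1 (wD t t1).
  have h2 : cabs ((2^-1 : R)%:C) <= 2^-1 :> R by rewrite cabs_real ger0_norm // invr_ge0.
  have := harnack du u1 h2; rewrite /u scale0r addr0.
  have -> : w + (2^-1)%:C *: v = p + (k.+1%:R / N%:R)%:C *: V.
    rewrite /w /v scalerA -rmorphM /= -addrA -scalerDl -rmorphD /=; congr (_ + _%:C *: _).
    by rewrite -natr1; field; rewrite gt_eqF.
  apply: le_trans; rewrite exprSr ler_pM2r ?invr_gt0 //; apply: ih; exact: ltnW.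
have := step N (leqnn N); rewrite mulfV ?gt_eqF // scale1r /V subrKC.
by rewrite lerBrDl addrC -lerBrDl.
Qed.

End HarnackChain.

(** * Zeros of h . (phi - z) in the disc *)

Section LeftInverse.
Variables (R : realType) (n : nat) (D : set 'rV[R[i]]_n).
Hypothesis hD : is_convex_tube_domain D.
Notation T := (borelType (circle R)).
Notation C := R[i]^o.
Notation zv := (@circle_val R).
Variables (phi : C -> 'rV[R[i]]_n) (N : 'I_n -> (T -> R) -> R) (sigma : 'I_n -> R).
Hypothesis linN : forall j, linear_bm (N j).
Hypothesis phiE : forall l j, cabs l < 1 ->
  phi l 0 j = cext (N j) (schwarz l) + 'i%C * (sigma j)%:C.
Variables (a : 'I_n -> R[i]) (b : 'I_n -> R).

Let linM := @linear_mean R.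

Definition hsep (z : 'rV[R[i]]_n) (l : R[i]) : R[i] :=
  \sum_j hpol (a j) (b j) l * (phi l 0 j - z 0 j).

Definition shifted (z : 'rV[R[i]]_n) j f := 1 * N j f + (- complex.Re (z 0 j)) * mean f.

(** When [N] is integration against mu / (2 pi), this is integration against k . (mu - Re z dL) / (2
    pi). *)
Definition hweight (z : 'rV[R[i]]_n) (f : T -> R) : R :=
  \sum_j weighted (kpol (a j) (b j)) (shifted z j) f.

Lemma linear_shifted z j : linear_bm (shifted z j).
Proof. exact: linear_bm_add. Qed.

Lemma linear_hweight z : linear_bm (hweight z).
Proof.
have lw j : linear_bm (weighted (kpol (a j) (b j)) (shifted z j)).
  by apply: linear_weighted; [exact: bmeas_kpol|exact: linear_shifted].
split=> [f g bf bg|c f bf]; rewrite /hweight.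
  by rewrite -big_split; apply: eq_bigr => j _; case: (lw j) => D' _; exact: D'.
by rewrite mulr_sumr; apply: eq_bigr => j _; case: (lw j) => _ Z'; exact: Z'.
Qed.

Lemma shiftedE (z : 'rV[R[i]]_n) l j : cabs l < 1 -> phi l 0 j - z 0 j =
  cext (shifted z j) (schwarz l) + 'i%C * (sigma j - complex.Im (z 0 j))%:C.
Proof.
move=> l1; rewrite phiE //.
have -> : cext (shifted z j) (schwarz l) = cext (N j) (schwarz l) - (complex.Re (z 0 j))%:C.
  have E := mean_schwarz l1; rewrite -[X in _ - X]mulr1 -[X in _ - _ * X]E.
  by apply: complexP; rewrite ?Re_add ?Re_opp ?Re_RCmul ?Im_add ?Im_opp ?Im_RCmul /=
    /shifted mul1r mulNr.
rewrite [in LHS](complexE (z 0 j)) rmorphB /=.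
by move: (cext _ _) (sigma j)%:C (complex.Re _)%:C (complex.Im _)%:C => X s' x y; ring.
Qed.

Lemma hsep_gauge z : exists c t, forall l, cabs l < 1 ->
  hsep z l = gauge c t (cext (hweight z) (schwarz l)) l.
Proof.
pose s j := sigma j - complex.Im (z 0 j).
pose L := shifted z.
pose c j := (a j)^*%C * ((L j (fun=> 1))%:C + 'i%C * (s j)%:C).
pose t j := s j * b j - 2 * L j (fun z => complex.Im (a j * zv z)).
exists (\sum_j c j), (\sum_j t j) => l l1.
transitivity (\sum_j gauge (c j) (t j) (cext (weighted (kpol (a j) (b j)) (L j)) (schwarz l)) l).
  by apply: eq_bigr => j _; rewrite shiftedE // hpol_gauge //; exact: linear_shifted.
have cE : cext (hweight z) (schwarz l) =
    \sum_j cext (weighted (kpol (a j) (b j)) (L j)) (schwarz l).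
  apply: complexP; rewrite /= ?(raddf_sum (@complex.Re R)) ?(raddf_sum (@complex.Im R)) //.
rewrite /gauge big_split sumrB /= -mulr_sumr big_split /= -mulr_suml cE -mulr_sumr.
by rewrite (raddf_sum (@conjc R)) (raddf_sum (real_complex R)).
Qed.

Hypothesis dphi : forall l : C, cabs l < 1 -> forall j, differentiable (fun l : C => phi l 0 j : C) l.
Hypothesis phiD : forall l, cabs l < 1 -> D (phi l).
Hypothesis mon : forall z, D z -> monotone_bm (hweight z).
Hypothesis pos : forall z, D z -> 0 < hweight z (fun=> 1).

Lemma hsep_differentiable z (l : C) : cabs l < 1 -> differentiable (hsep z : C -> C) l.
Proof.
move=> l1; pose G j (l : C) : C := hpol (a j) (b j) l * (phi l 0 j - z 0 j).
rewrite (_ : hsep z = \sum_(j < n) G j).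
  apply: differentiable_sum => j; apply: differentiableM; first exact: hpol_differentiable.
  by apply: differentiableB => //; exact: dphi.
by apply/funext => w; rewrite fct_sumE.
Qed.

Lemma hsep_diff z z' l : hsep z l = hsep z' l + \sum_j hpol (a j) (b j) l * (z' 0 j - z 0 j).
Proof.
by rewrite -big_split; apply: eq_bigr => j _ /=; rewrite -mulrDr; congr (_ * _); ring.
Qed.

(** Adding s l to the gauge form amounts to adding s times the normalized arc length to
    [hweight]. *)
Definition hseps (s : R) z l := hsep z l + s%:C * l.

Lemma hseps_lower_bound s z tau l : 0 <= s -> D z -> cabs tau < 1 -> cabs l < 1 ->
  hseps s z tau = 0 ->
  cabs (l - tau) * ((1 - cabs tau) / 4) * (hweight z (poisson l) + s) <= cabs (hseps s z l).
Proof.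
move=> s0 Dz t1 l1 E.
pose Q f := 1 * hweight z f + s * mean f.
have lQ : linear_bm Q by apply: linear_bm_add => //; exact: linear_hweight.
have mQ : monotone_bm Q.
  move=> f g bf bg fg; rewrite /Q !mul1r; apply: lerD; first exact: mon.
  by rewrite ler_wpM2l //; exact: mean_le.
have [c [t ct]] := hsep_gauge z.
have key x : cabs x < 1 -> hseps s z x = gauge c t (cext Q (schwarz x)) x.
  move=> x1; rewrite /hseps ct // /gauge.
  have -> : cext Q (schwarz x) = cext (hweight z) (schwarz x) + s%:C.
    have Em := mean_schwarz x1; rewrite -[s%:C]mulr1 -[X in _ + _ * X]Em.
    by apply: complexP; rewrite ?Re_add ?Re_RCmul ?Im_add ?Im_RCmul /= /Q mul1r.
  by move: (cext _ _) => X; ring.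
rewrite key // in E; rewrite key //.
by have := gauge_lower_bound lQ mQ t1 l1 E; rewrite /Q mul1r mean_poisson // mulr1.
Qed.

Lemma hweight_poisson z l : D z -> cabs l < 1 ->
  (1 - cabs l) / 2 * hweight z (fun=> 1) <= hweight z (poisson l).
Proof.
by move=> Dz l1; apply: monotone_poisson_ge => //; [exact: linear_hweight|exact: mon].
Qed.

Lemma hseps_zero s z : 0 < s -> D z -> exists2 tau, cabs tau < 1 & hseps s z tau = 0.
Proof.
move=> s0 Dz; have [c [t ct]] := hsep_gauge z.
pose m := cabs c; have m0 : 0 <= m by exact: cabs_ge0.
(* With q = s / (2 (m + s)) and r = 1 - q / 2 one has 1 - r^2 <= q. On |x| = r the real part of
   conj(x) hseps is at least s r^2 - (1 - r^2) m, hence at least s - q (m + s) = s / 2. *)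
have q0 : 0 < s / (2 * (m + s)) by rewrite divr_gt0 // mulr_gt0 // ltr_wpDl.
have q1 : s / (2 * (m + s)) < 1.
  by rewrite ltr_pdivrMr ?mul1r; [|rewrite mulr_gt0 // ltr_wpDl]; lra.
pose r := 1 - s / (2 * (m + s)) / 2.
have r01 : 0 < r < 1 by rewrite /r; lra.
have dF : hol_disc (hseps s z).
  move=> x x1; apply: differentiableD; first exact: hsep_differentiable.
  exact: differentiableZ.
apply: (zero_in_disc dF r01).
move=> x xr; have x1 : cabs x < 1 by rewrite xr; case/andP: r01.
have P0 : 0 <= hweight z (poisson x).
  apply: le_trans (hweight_poisson Dz x1); rewrite mulr_ge0 ?ltW ?pos //.
  by rewrite divr_gt0 // subr_gt0.
rewrite /hseps mulrDr Re_add ct // Re_gauge.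
move: P0; rewrite -[hweight z _]/(complex.Re (cext (hweight z) (schwarz x))).
move: (cext _ _) => S P0; rewrite mulrCA [_^*%C * x]mulrC mulcJ Re_RCmul Re_RC xr.
have h1 : - m <= complex.Re (x^*%C * c).
  apply: le_trans (Re_ge_Ncabs _); rewrite lerN2 cabsM cabsJ xr ler_piMl //.
  by case/andP: r01 => _ /ltW.
have h2 : 0 <= r ^+ 2 * complex.Re S.
  by rewrite mulr_ge0 // sqr_ge0.
have E : s / (2 * (m + s)) * (2 * (m + s)) = s by rewrite divfK // gt_eqF // mulr_gt0 // ltr_wpDl.
pose q := s / (2 * (m + s)); have rq : r = 1 - q / 2 by [].
rewrite -/q in q0 q1 E; set Y := r ^+ 2 * complex.Re S in h2 *.
have rE : 1 - r ^+ 2 = q - q ^+ 2 / 4 by rewrite rq; field.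
have q2 : 0 <= q ^+ 2 / 4 <= q.
  by rewrite divr_ge0 ?sqr_ge0 //= ler_pdivrMr //; nra.
have h3 : - (q * m) <= (1 - r ^+ 2) * complex.Re (x^*%C * c).
  rewrite rE; apply: (@le_trans _ _ ((q - q ^+ 2 / 4) * - m)).
    by rewrite mulrN lerN2 ler_wpM2r //; lra.
  by rewrite ler_wpM2l //; lra.
have h4 : s - s * q <= s * r ^+ 2.
  have -> : r ^+ 2 = 1 - (q - q ^+ 2 / 4) by rewrite -rE; ring.
  by rewrite -[X in X - _]mulr1 -mulrBr ler_pM2l //; lra.
move: (complex.Re _) h1 h3 => X h1 h3; lra.
Qed.

Lemma hweight_poisson_gt0 z l : D z -> cabs l < 1 -> 0 < hweight z (poisson l).
Proof.
move=> Dz l1; apply: lt_le_trans (hweight_poisson Dz l1).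
by rewrite mulr_gt0 ?pos // divr_gt0 // subr_gt0.
Qed.

Lemma hseps_unique s z tau l : 0 <= s -> D z -> cabs tau < 1 -> cabs l < 1 ->
  hseps s z tau = 0 -> hseps s z l = 0 -> l = tau.
Proof.
move=> s0 Dz t1 l1 Et El; have := hseps_lower_bound s0 Dz t1 l1 Et; rewrite El cabs0.
have h : 0 < (1 - cabs tau) / 4 * (hweight z (poisson l) + s).
  rewrite mulr_gt0 ?divr_gt0 ?subr_gt0 //.
  by rewrite ltr_pwDl // hweight_poisson_gt0.
rewrite -mulrA pmulr_lle0 // => lt0; apply/eqP; rewrite -subr_eq0 -cabs_eq0.
by rewrite eq_le lt0 cabs_ge0.
Qed.

(** The radius r covers two uses: r = 1 when s > 0, and r < 1 when s = 0, where the available lower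
    bound degenerates at the circle. *)
Lemma hseps_zero_holomorphic s (f : 'rV[R[i]]_n -> C) z r c d : r <= 1 -> 0 < c -> 0 < d ->
  (forall z', vabs (z' - z) < d -> cabs (f z') < r /\ hseps s z' (f z') = 0) ->
  (forall l, cabs l < r -> c * cabs (l - f z) <= cabs (hseps s z l)) ->
  holomorphic_at f z.
Proof.
move=> r1 c0 d0 fz LB.
have fr : cabs (f z) < r by case: (fz z) => //; rewrite subrr vabs0.
apply: (@implicit_holomorphic _ _ f z (hseps s z) (fun j => hpol (a j) (b j)) r c
  (\sum_j (2 * cabs (a j) + `|b j|)) d _ _ c0 d0 LB).
- apply: (@differentiableD _ _ _ (hsep z : C -> C) (fun l => s%:C * l : C)).
    by apply: hsep_differentiable; exact: lt_le_trans r1.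
  by apply: differentiableZ.
- by move=> j; apply: differentiable_continuous; exact: hpol_differentiable.
- move=> j l lr; apply: le_trans (hpol_le _ _ _) _; first exact: ltW (lt_le_trans lr r1).
  rewrite (bigD1 j) //= lerDl sumr_ge0 // => i _.
  by rewrite addr_ge0 ?mulr_ge0 ?cabs_ge0.
move=> z' /fz[f'r f'0]; split; first exact: f'r.
move: f'0; rewrite /hseps (hsep_diff z z').
move: (hsep z' _) (\sum_j _) => X Y E.
by rewrite -[RHS]add0r -E; ring.
Qed.

Lemma tube_ball z : D z -> exists2 d, 0 < d & forall z', vabs (z' - z) < d -> D z'.
Proof. by move=> Dz; have [_ [d [d0 _ Hd _]]] := harnack_chain hD Dz Dz; exists d. Qed.

Definition hzero s z : C := xget (0 : C) [set t : C | cabs t < 1 /\ hseps s z t = 0].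

Lemma hzeroP s z : (exists2 t, cabs t < 1 & hseps s z t = 0) ->
  cabs (hzero s z) < 1 /\ hseps s z (hzero s z) = 0.
Proof.
by case=> t t1 t0; apply: (@xgetPex _ (0 : C) [set t : C | cabs t < 1 /\ hseps s z t = 0]); exists t.
Qed.

Lemma hzero_holomorphic s z : 0 < s -> D z -> holomorphic_at (hzero s) z.
Proof.
move=> s0 Dz; have [d d0 Hd] := tube_ball Dz.
have [t1 t0] := hzeroP (hseps_zero s0 Dz).
apply: (@hseps_zero_holomorphic s (hzero s) z 1 ((1 - cabs (hzero s z)) / 4 * s) d) => //.
- by rewrite mulr_gt0 // divr_gt0 // subr_gt0.
- by move=> z' /Hd Dz'; exact: hzeroP (hseps_zero s0 Dz').
move=> l l1; apply: le_trans (hseps_lower_bound (ltW s0) Dz t1 l1 t0).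
rewrite mulrC mulrA ler_wpM2l ?mulr_ge0 ?cabs_ge0 ?divr_ge0 ?subr_ge0 ?(ltW t1) //.
by rewrite lerDr ltW // hweight_poisson_gt0.
Qed.

Lemma hseps_phi0 s : hseps s (phi 0) 0 = 0.
Proof. by rewrite /hseps mulr0 addr0 /hsep big1 // => j _; rewrite subrr mulr0. Qed.

(** For each s > 0 the zero is a holomorphic function of z with values in the disc, and it is 0 at
    phi(0). So [harnack_chain] bounds it by one r for all s. *)
Lemma hsep_zero z0 : D z0 -> exists r d, [/\ 0 < d, 0 <= r < 1 &
  forall z, vabs (z - z0) < d -> D z /\ exists2 t, cabs t <= r & hseps 0 z t = 0].
Proof.
move=> Dz0; have z1 : cabs 0 < 1 :> R by rewrite cabs0 ltr01.
have [r [d [d0 /andP[r0 r1] Hd H]]] := harnack_chain hD (phiD z1) Dz0.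
exists r, d; split => // [|z zd]; first by rewrite r0.
have Dz := Hd z zd; split => //; apply: contrapT => nz.
have fs_le s : 0 < s -> cabs (hzero s z) <= r.
  move=> s0; apply: (H (hzero s)) => // [w|w Dw|].
  - exact: hzero_holomorphic.
  - by have [/ltW] := hzeroP (hseps_zero s0 Dw).
  - have [t1 t0] := hzeroP (hseps_zero s0 (phiD z1)).
    by rewrite -(hseps_unique (ltW s0) (phiD z1) t1 z1 t0 (hseps_phi0 s)).
pose A := [set l : C | cabs l <= r].
have A0 : A !=set0 by exists 0; rewrite /A /= cabs0.
have cF : {within A, continuous (fun l : C => cabs (hsep z l))}.
  apply: continuous_in_subspaceT => l; rewrite inE /A /= => lr.
  have /differentiable_continuous/cts_CC cl : differentiable (hsep z : C -> C) l.
    by apply: hsep_differentiable; exact: le_lt_trans r1.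
  by apply/cts_CR => e /cl[e' e'0 He]; exists e' => // w /He; apply: le_lt_trans; exact: cabs_lip.
have [m] := @compact_EVT_min _ R _ A A0 (@disc_compact R r) cF.
rewrite inE => mr Hm; have m0 : 0 < cabs (hsep z m).
  rewrite cabs_gt0; apply/eqP => m0; apply: nz; exists m => //.
  by rewrite /hseps m0 rmorph0 mul0r addr0.
(* No limit in s is taken: with s half the minimum of |hsep z| on |l| <= r, the zero of [hseps s z]
   lies in this disc and there |hsep z| <= s. *)
pose s := cabs (hsep z m) / 2; have s0 : 0 < s by rewrite divr_gt0.
have [t1 t0] := hzeroP (hseps_zero s0 Dz).
have := Hm (hzero s z); rewrite inE => /(_ (fs_le s s0)).
have -> : hsep z (hzero s z) = - (s%:C * hzero s z).
  by apply/eqP; rewrite -subr_eq0 opprK; apply/eqP.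
rewrite cabsN cabsM cabs_real (gtr0_norm s0) => h.
have : s * cabs (hzero s z) <= s by rewrite ler_piMr // ltW.
rewrite /s in h *; lra.
Qed.

Lemma hsep_left_inverse : exists2 f : 'rV[R[i]]_n -> C,
  forall z, D z -> holomorphic_at f z /\ cabs (f z) < 1 &
  forall l, cabs l < 1 -> f (phi l) = l.
Proof.
have hz z : D z -> cabs (hzero 0 z) < 1 /\ hseps 0 z (hzero 0 z) = 0.
  move=> Dz; apply: hzeroP; have [r [d [d0 /andP[r0 r1] H]]] := hsep_zero Dz.
  have [|_ [t tr t0]] := H z; first by rewrite subrr vabs0.
  by exists t => //; exact: le_lt_trans r1.
exists (hzero 0) => [z Dz|l l1]; last first.
  have [t1 t0] := hz _ (phiD l1).
  symmetry; apply: (@hseps_unique 0 (phi l)) => //; first exact: phiD.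
  rewrite /hseps rmorph0 mul0r addr0 /hsep big1 // => j _.
  by rewrite subrr mulr0.
have [t1 t0] := hz z Dz; split => //.
have [r [d [d0 /andP[r0 r1] H]]] := hsep_zero Dz.
have fr z' : vabs (z' - z) < d -> cabs (hzero 0 z') <= r.
  move=> /H[Dz' [t tr E]]; have [t1' t0'] := hz z' Dz'.
  by rewrite -(hseps_unique (lexx 0) Dz' t1' (le_lt_trans tr r1) t0' E).
(* The zeros for nearby points stay in |l| <= r; on |l| < r' the Poisson integral of the weight is
   at least (1 - r') / 2 times its mass, which gives the constant c. *)
pose r' := (1 + r) / 2; have [rr' r'1] : r < r' /\ r' < 1 by rewrite /r'; split; lra.
pose c := (1 - cabs (hzero 0 z)) / 4 * ((1 - r') / 2 * hweight z (fun=> 1)).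
have c0 : 0 < c.
  by rewrite /c !mulr_gt0 ?pos ?invr_gt0 ?subr_gt0.
apply: (@hseps_zero_holomorphic 0 (hzero 0) z r' c d) => //.
- exact: ltW.
- move=> z' zd; split; first exact: le_lt_trans (fr z' zd) rr'.
  by have [Dz' _] := H z' zd; have [] := hz z' Dz'.
move=> l lr; have l1 : cabs l < 1 := lt_trans lr r'1.
apply: le_trans (hseps_lower_bound (lexx 0) Dz t1 l1 t0).
rewrite addr0 mulrC -[leRHS]mulrA ler_wpM2l ?cabs_ge0 // ler_pM2l ?divr_gt0 ?subr_gt0 //.
apply: le_trans (hweight_poisson Dz l1); rewrite ler_pM2r ?pos //.
by rewrite ler_pM2r ?invr_gt0 // lerD2l lerN2 ltW.
Qed.

End LeftInverse.

(** * The gradient of a left inverse *)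
Definition frechet (R : realType) (V W : normedModType R[i]) (f : V -> W) (x : V) :
  {linear V -> W} := 'd f x.

Section Necessity.
Variables (R : realType) (n : nat) (D : set 'rV[R[i]]_n).
Hypothesis hD : is_convex_tube_domain D.
Notation C := R[i]^o.
Variables (phi : C -> 'rV[R[i]]_n) (f : 'rV[R[i]]_n -> C).
Hypothesis dphi : forall l : C, cabs l < 1 -> differentiable phi l.
Hypothesis dphic : forall l : C, cabs l < 1 -> forall j, differentiable (fun l : C => phi l 0 j : C) l.
Hypothesis phiD : forall l, cabs l < 1 -> D (phi l).
Hypothesis df : forall z, D z -> holomorphic_at f z.
Hypothesis f1 : forall z, D z -> cabs (f z) <= 1.
Hypothesis fphi : forall l, cabs l < 1 -> f (phi l) = l.

Definition grad (j : 'I_n) (l : C) : C := frechet f (phi l) (delta_mx 0 j).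

Definition dirder (v : 'rV[R[i]]_n) (l : C) : C := \sum_j grad j l * v 0 j.

Lemma dirderE l v : frechet f (phi l) v = dirder v l.
Proof.
rewrite {1}[v](row_sum_delta) raddf_sum; apply: eq_bigr => j _.
by transitivity (v 0 j *: grad j l : C); [exact: linearZ|exact: mulrC].
Qed.

Lemma f_dirder l : cabs l < 1 -> has_vderiv f (phi l) (dirder^~ l).
Proof.
move=> l1 e e0; have [d d0 Hd] := differentiable_vderiv (df (phiD l1)) e0.
by exists d => // y /Hd; rewrite -dirderE.
Qed.

Lemma dirderZ c v l : dirder (c *: v) l = c * dirder v l.
Proof. by rewrite /dirder mulr_sumr; apply: eq_bigr => j _; rewrite mxE mulrCA. Qed.

Lemma dirderD v w l : dirder (v + w) l = dirder v l + dirder w l.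
Proof. by rewrite /dirder -big_split; apply: eq_bigr => j _; rewrite mxE mulrDr. Qed.

Lemma tube_convex z w (t : R) : D z -> D w -> 0 <= t <= 1 -> D (z + t%:C *: (w - z)).
Proof.
have [_ _ cO DE] := tubeE hD; move=> /DE Dz /DE Dw t01; apply/DE.
have := cO _ _ t Dw Dz t01; congr (ReD D _).
by apply/rowP => j; rewrite !mxE !ReImE /=; ring.
Qed.

Lemma segment_derivative l w : cabs l < 1 -> forall e, 0 < e ->
  exists2 d, 0 < d & forall s : R, 0 < s < d ->
    cabs (f (phi l + s%:C *: (w - phi l)) - l - s%:C * dirder (w - phi l) l) <= s * e.
Proof.
move=> l1 e e0; set v := w - phi l; have v1 : 0 < vabs v + 1 by rewrite ltr_wpDl // vabs_ge0.
have [d d0 Hd] := f_dirder l1 (divr_gt0 e0 v1).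
exists (d / (vabs v + 1)); first exact: divr_gt0.
move=> s /andP[s0]; rewrite ltr_pdivlMr // => sd.
have sv : vabs (s%:C *: v) = s * vabs v by rewrite vabsZ cabs_real gtr0_norm.
have := Hd (phi l + s%:C *: v); rewrite [_ + _ - _]addrC addKr sv fphi // dirderZ => /(_ _) h.
apply: le_trans (h _) _.
  by apply: le_lt_trans sd; rewrite ler_pM2l // lerDl.
rewrite mulrCA ler_pM2l // mulrAC ler_pdivrMr // ler_pM2l // lerDl //.
Qed.

(** In [self_map_generator] for f((1 - s) phi + s w) the terms free of s cancel because f(phi(l)) =
    l. What is left is divided by s, with an error at most e. *)
Lemma generator_inequality l w : cabs l < 1 -> D w ->
  complex.Re (l^*%C * dirder (w - phi l) l) <=
  (1 - cabs l ^+ 2) * complex.Re (l^*%C * dirder (w - phi 0) 0).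
Proof.
move=> l1 Dw; have z1 : cabs 0 < 1 :> R by rewrite cabs0 ltr01.
set A := complex.Re _; set B := complex.Re _.
have l0 := cabs_ge0 l; have q01 : 0 <= 1 - cabs l ^+ 2 <= 1.
  have s0 := sqr_ge0 (cabs l); have s1 : cabs l ^+ 2 <= 1 by rewrite expr_le1 // ltW.
  by rewrite subr_ge0 s1 lerBlDr lerDl.
apply/ler_addgt0Pr => e e0; have e2 : 0 < e / 2 by rewrite divr_gt0.
have [d d0 Hd] := segment_derivative w l1 e2.
have [d' d'0 Hd'] := segment_derivative w z1 e2.
pose s := Num.min (Num.min d d') 1 / 2.
have m0 : 0 < Num.min (Num.min d d') 1 by rewrite !lt_min d0 d'0 /=.
have s0 : 0 < s by rewrite divr_gt0.
have sm : s < Num.min (Num.min d d') 1 by rewrite ltr_pdivrMr // ltr_pMr // ltr1n.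
have [sd sd' s1] : [/\ s < d, s < d' & s <= 1].
  by move: sm; rewrite !lt_min => /andP[/andP[-> ->] /ltW ->].
pose F : C -> C := fun x => f (phi x + s%:C *: (w - phi x)).
have inD x : cabs x < 1 -> D (phi x + s%:C *: (w - phi x)).
  by move=> x1; apply: tube_convex => //; [exact: phiD|rewrite ltW].
have dF : hol_disc F.
  move=> x x1; apply: (@differentiable_comp _ _ _ _ (fun x => phi x + s%:C *: (w - phi x)) f).
    have dx := dphi x1.
    apply: (differentiableD dx); apply: differentiableZ; exact: differentiableB.
  exact: (df (inD x x1)).
have F1 x : cabs x < 1 -> cabs (F x) <= 1 by move=> /inD; exact: f1.
have := self_map_generator dF F1 l1.
have hl : `|complex.Re (l^*%C * (F l - l - s%:C * dirder (w - phi l) l))| <= s * (e / 2).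
  apply: le_trans (Re_le_cabs _) _; rewrite cabsM cabsJ.
  apply: le_trans (Hd s _); last by rewrite s0.
  by rewrite ler_piMl ?cabs_ge0 // ltW.
have h0 : `|complex.Re (l^*%C * (F 0 - 0 - s%:C * dirder (w - phi 0) 0))| <= s * (e / 2).
  apply: le_trans (Re_le_cabs _) _; rewrite cabsM cabsJ.
  apply: le_trans (Hd' s _); last by rewrite s0.
  by rewrite ler_piMl ?cabs_ge0 // ltW.
have El : complex.Re (l^*%C * (F l - l - s%:C * dirder (w - phi l) l)) =
    complex.Re (l^*%C * F l) - cabs l ^+ 2 - s * A.
  have ll : complex.Re (l^*%C * l) = cabs l ^+ 2 by rewrite mulrC mulcJ.
  rewrite /A -ll -Re_RCmul -!Re_opp -!Re_add; congr complex.Re; ring.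
have E0 : complex.Re (l^*%C * (F 0 - 0 - s%:C * dirder (w - phi 0) 0)) =
    complex.Re (l^*%C * F 0) - s * B.
  by rewrite /B -Re_RCmul -!Re_opp -!Re_add; congr complex.Re; ring.
rewrite El in hl; rewrite E0 in h0.
move: hl h0; rewrite !ler_norml => /andP[hl _] /andP[_ h0].
move: (complex.Re (l^*%C * F l)) (complex.Re (l^*%C * F 0)) hl h0 => X Y hl h0 h.
move: q01 h; set q := 1 - _ => /andP[q0 q1] h.
rewrite -(ler_pM2l s0).
have h3 : q * Y <= q * (s * B + s * (e / 2)) by rewrite ler_wpM2l //; lra.
have h4 : q * (s * (e / 2)) <= s * (e / 2) by rewrite ler_piMl // mulr_ge0 // ltW.
rewrite mulrDr (mulrCA s) -/q; rewrite mulrDr in h3.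
have h5 : s * e = s * (e / 2) + s * (e / 2) by rewrite -mulrDr -splitr.
rewrite h5; move: h3 h4 h hl; rewrite -/q; move: (q * Y) (q * (s * B)) (s * A) (s * (e / 2)) (q * _).
by clear; move=> *; lra.
Qed.

Lemma grad_imaginary j l : cabs l < 1 ->
  complex.Im (l^*%C * grad j l) = (1 - cabs l ^+ 2) * complex.Im (l^*%C * grad j 0).
Proof.
move=> l1; have z1 : cabs 0 < 1 :> R by rewrite cabs0 ltr01.
have [_ _ _ DE] := tubeE hD.
pose w (y : R) := phi 0 + ('i%C * y%:C) *: (delta_mx 0 j : 'rV[R[i]]_n).
have Dw y : D (w y).
  apply/DE; have /DE := phiD z1; congr (ReD D _); apply/rowP => k.
  by rewrite !mxE; case: (_ && _); rewrite ?mulr1 ?mulr0 ?addr0 // Re_add mulrC Re_RCmul /= mulr0 addr0.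
have dd l' : dirder (delta_mx 0 j) l' = grad j l'.
  rewrite /dirder (bigD1 j) //= mxE !eqxx mulr1 big1 ?addr0 // => k kj.
  by rewrite mxE (negbTE kj) andbF mulr0.
have affine (a A B q : R) : (forall y, a - y * A <= - (y * (q * B))) -> A = q * B.
  move=> ineq; apply/eqP; rewrite -subr_eq0; apply/negPn/negP => d0.
  (* At this y the product y (A - q B) is a - 1, so the inequality would read 1 <= 0. *)
  have := ineq ((a - 1) / (A - q * B)).
  have : (a - 1) / (A - q * B) * (A - q * B) = a - 1 by rewrite divfK.
  move: (_ / (A - q * B)) => y; rewrite mulrBr; move: (y * A) (y * (q * B)) => X Y; lra.
apply: (affine (complex.Re (l^*%C * dirder (phi 0 - phi l) l))) => y.
have := generator_inequality l1 (Dw y).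
have -> : w y - phi l = (phi 0 - phi l) + ('i%C * y%:C) *: delta_mx 0 j by rewrite /w addrAC.
have -> : w y - phi 0 = ('i%C * y%:C) *: delta_mx 0 j by rewrite /w addrC addKr.
rewrite dirderD !dirderZ !dd mulrDr Re_add.
have Ri (X : R[i]) : complex.Re (l^*%C * ('i%C * y%:C * X)) = - (y * complex.Im (l^*%C * X)).
  rewrite (_ : l^*%C * _ = y%:C * ('i%C * (l^*%C * X))); last by ring.
  by rewrite Re_RCmul Re_mul /= mul0r mul1r sub0r mulrN.
move: (grad j l) (grad j 0) (dirder _ _) => X Y Z.
by rewrite (Ri X) (Ri Y) mulrN mulrCA.
Qed.

(** The partial derivative along phi is a limit of the difference quotients [U m], which are
    holomorphic in x. The Taylor bound for f on affine discs of radius d / 2 in direction e_j gives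
    uniform bounds and convergence. *)
Lemma grad_differentiable j (l : C) : cabs l < 1 -> differentiable (grad j) l.
Proof.
move=> l1; have [d d0 Hd] := tube_nbhs hD (phiD l1).
have dl := dphic l1.
pose ed : 'rV[R[i]]_n := delta_mx 0 j.
have [r r0 Hr] : exists2 r, 0 < r & forall x, cabs (x - l) < r ->
    cabs x < 1 /\ forall t, cabs t < d / 2 -> D (phi x + t *: ed).
  have /fin_all_exists2[rr rr0 Hrr] : forall k, exists2 r, 0 < r & forall x, cabs (x - l) < r ->
      cabs (phi x 0 k - phi l 0 k) < d / 2.
    move=> k; have /differentiable_continuous/cts_CC := dl k; apply; exact: divr_gt0.
  exists (Num.min (1 - cabs l) (\big[Num.min/1]_k rr k)).
    by rewrite lt_min subr_gt0 l1 lt_bigmin.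
  move=> x; rewrite lt_min => /andP[xl xr]; split.
    have := cabsD (x - l) l; rewrite subrK; lra.
  move=> t td; apply: Hd => k; rewrite !mxE -Re_opp -Re_add.
  apply: le_lt_trans (Re_le_cabs _) _.
  rewrite addrAC; apply: le_lt_trans (cabsD _ _) _; rewrite [ltRHS]splitr.
  apply: ltr_leD; first by apply: Hrr; apply: lt_le_trans xr _; exact: bigmin_le.
  rewrite cabsM; case: (_ && _); rewrite ?cabs1 ?cabs0 ?mulr1 ?mulr0; first exact: ltW.
  by rewrite divr_ge0 // ltW.
(* The increments stay below d / 8, a quarter of the radius d / 2, as [taylor2_at] requires. *)
pose t m : R := d / 8 / m.+1%:R.
have t0 m : 0 < t m by rewrite !divr_gt0.
have tm m : t m <= d / 8.
  by rewrite ler_pdivrMr // ler_peMr ?ler1n // divr_ge0 // ltW.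
pose U m (x : C) : C := (t m)%:C^-1 * (f (phi x + (t m)%:C *: ed) - f (phi x)).
have taylor x : cabs (x - l) < r ->
    cabs (grad j x) <= 2 / (d / 2) /\
    forall m, cabs (U m x - grad j x) <= 8 / (d / 2) ^+ 2 * t m.
  move=> /Hr[x1 xD].
  pose u : C -> C := fun t => f (phi x + t *: ed).
  have du (s : C) : cabs (s - 0) < d / 2 -> differentiable u s.
    rewrite subr0 => sd; apply: (@differentiable_comp _ _ _ _ (fun s : C => phi x + s *: ed) f).
      exact: line_differentiable.
    exact: (df (xD s sd)).
  have ub s : cabs (s - 0) < d / 2 -> cabs (u s) <= 1.
    by rewrite subr0 => sd; exact: f1 (xD s sd).
  have uA : has_cderiv u 0 (grad j x).
    move=> e e0; have ve : vabs ed <= 1.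
      by rewrite -lecR vabsE rmorph1; exact: norm_delta_mx_le1.
    have [b b0 Hb] := f_dirder x1 e0; exists b => // s; rewrite subr0 => sb.
    have sv : vabs (s *: ed) <= cabs s by rewrite vabsZ ler_piMr ?cabs_ge0.
    have := Hb (phi x + s *: ed); rewrite [_ + _ - _]addrC addKr dirderZ.
    have -> : dirder ed x = grad j x.
      rewrite /dirder (bigD1 j) //= mxE !eqxx mulr1 big1 ?addr0 // => k kj.
      by rewrite mxE (negbTE kj) andbF mulr0.
    move=> /(_ (le_lt_trans sv sb)) h; rewrite /u scale0r addr0 mulrC.
    by apply: le_trans h _; rewrite ler_pM2l.
  have d2 : 0 < d / 2 by rewrite divr_gt0.
  have [h1 h2] := taylor2_at d2 du ub uA; split; first by rewrite mulr1 in h1.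
  move=> m; have := h2 (t m)%:C; rewrite subr0 cabs_real (gtr0_norm (t0 m)) => /(_ _) h.
  have {}h := h (_ : t m <= d / 2 / 4).
  rewrite mulr1 in h; rewrite /U -[X in cabs (_ - X)](mulKf (_ : (t m)%:C != 0)).
    rewrite -mulrBr cabsM cabsV cabs_real (gtr0_norm (t0 m)) mulrC ler_pdivrMr //.
    rewrite -[leRHS]mulrA -expr2; apply: le_trans (h _).
      by rewrite /u scale0r addr0 mulrC.
    by apply: le_trans (tm m) _; lra.
  by rewrite -cabs_gt0 cabs_real normr_gt0 gt_eqF.
have d8 : 0 < 8 / (d / 2) ^+ 2 by rewrite divr_gt0 // exprn_gt0 // divr_gt0.
apply: (@pointwise_limit_differentiable _ U (grad j) l r (2 / (d / 2) + 8 / (d / 2) ^+ 2 * (d / 8)) r0).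
- move=> m x /Hr[x1 xD].
  have td : cabs (t m)%:C < d / 2.
    by rewrite cabs_real (gtr0_norm (t0 m)); apply: le_lt_trans (tm m) _; lra.
  have dx := dphi x1.
  apply: differentiableZ; apply: differentiableB.
    apply: (@differentiable_comp _ _ _ _ (fun x => phi x + (t m)%:C *: ed) f).
      exact: (differentiableD dx).
    exact: (df (xD _ td)).
  by apply: (@differentiable_comp _ _ _ _ phi f) => //; exact: (df (phiD x1)).
- move=> m x /taylor[h1 /(_ m) h2].
  rewrite -[U m x](subrK (grad j x)) addrC; apply: le_trans (cabsD _ _) _.
  apply: lerD => //; apply: le_trans h2 _; by rewrite ler_pM2l.
move=> x /taylor[_ h2] e e0.
exists (Num.bound (8 / (d / 2) ^+ 2 * (d / 8) / e)) => m Nm.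
apply: le_trans (h2 m) _; rewrite /t mulrA ler_pdivrMr // [leRHS]mulrC -ler_pdivrMr //.
apply: le_trans (ltW (archi_boundP _)) _; first by rewrite !mulr_ge0 ?invr_ge0 // ?ltW // exprn_gt0 // divr_gt0.
by rewrite ler_nat; exact: leqW.
Qed.

(** Subtracting the value at 0 and its conjugate times l^2 removes the imaginary radial part found
    in [grad_imaginary]; after multiplication by i, [imaginary_radial] identifies the remainder as a
    real multiple of l. *)
Lemma grad_hpol j : exists b : R, forall l, cabs l < 1 -> grad j l = hpol (grad j 0)^*%C b l.
Proof.
pose K : C -> C := fun l => 'i%C * (grad j l - grad j 0 - (grad j 0)^*%C * l ^+ 2).
have dK : hol_disc K.
  move=> l l1; apply: differentiableZ; apply: differentiableB.
    by apply: differentiableB => //; exact: grad_differentiable.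
  by apply: (@differentiableM _ _ (fun=> (grad j 0)^*%C) (fun l : C => l ^+ 2 : C)) => //; exact: differentiableX.
have K0 : K 0 = 0 by rewrite /K expr0n mulr0 subr0 subrr mulr0.
have KR l : cabs l < 1 -> complex.Re (l^*%C * K l) = 0.
  move=> l1; have := grad_imaginary j l1; rewrite /K cabs_sqr expr2.
  move: (grad j l) (grad j 0) => X Y E; rewrite mulrCA Re_mul /= mul0r mul1r sub0r.
  apply/eqP; rewrite oppr_eq0; apply/eqP; rewrite !mulrBr !Im_add !Im_opp E.
  by rewrite (expr2 l) !ReImE; ring.
have [c Hc] := imaginary_radial dK K0 KR.
exists c => l l1; have := Hc l l1; rewrite /K -mulrA => /(mulfI (neq0Ci _)) E.
rewrite /hpol conjcK -E; move: (grad j l) (grad j 0) (_^*%C) => X Y Z.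
by ring.
Qed.

(** Otherwise, by the chain rule, f(phi(l)) = l would have derivative 0 at 0. This is the source of
    h being nonzero. *)
Lemma grad0_neq0 : exists j, grad j 0 != 0.
Proof.
apply: contrapT => H; have z1 : cabs 0 < 1 :> R by rewrite cabs0 ltr01.
have g0 j : grad j 0 = 0 by apply/eqP/negPn/negP => h; apply: H; exists j.
have [K [d [K0 d0 HK]]] : exists K d, [/\ 0 < K, 0 < d & forall l, cabs l < d ->
    vabs (phi l - phi 0) <= K * cabs l].
  have /fin_all_exists2[rr rr0 Hrr] : forall k, exists2 r, 0 < r & forall x, cabs (x - 0) < r ->
      cabs (phi x 0 k - phi 0 0 k - 'd (fun l : C => phi l 0 k : C) 0 1 * (x - 0)) <= 1 * cabs (x - 0).
    by move=> k; apply: (differentiable_cderiv (dphic z1 k)); exact: ltr01.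
  pose K := \sum_k (cabs ('d (fun l : C => phi l 0 k : C) 0 1) + 1).
  have K0 : 0 <= K by apply: sumr_ge0 => k _; rewrite addr_ge0 ?cabs_ge0.
  exists (K + 1), (\big[Num.min/1]_k rr k); split; [by rewrite ltr_wpDl|exact: lt_bigmin|].
  move=> l ld; apply: le_trans (vabs_le_sum _) _; apply: (@le_trans _ _ (K * cabs l)); last first.
    by rewrite ler_wpM2r ?cabs_ge0 // lerDl.
  rewrite /K mulr_suml; apply: ler_sum => k _; rewrite !mxE.
  have lk : cabs (l - 0) < rr k by rewrite subr0; apply: lt_le_trans ld _; exact: bigmin_le.
  have := Hrr k l lk; rewrite subr0 mul1r => h.
  rewrite -[X in cabs X](subrK ('d (fun l : C => phi l 0 k : C) 0 1 * l)).
  by apply: le_trans (cabsD _ _) _; rewrite cabsM mulrDl mul1r [leRHS]addrC lerD2r.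
have e0 : 0 < (2 * K)^-1 by rewrite invr_gt0 mulr_gt0.
have [d' d'0 Hd'] := f_dirder z1 e0.
pose x := Num.min (Num.min d (d' / K)) 1 / 2.
have m0 : 0 < Num.min (Num.min d (d' / K)) 1 by rewrite !lt_min d0 divr_gt0 //=.
have x0 : 0 < x by rewrite divr_gt0.
have xm : x < Num.min (Num.min d (d' / K)) 1 by rewrite ltr_pdivrMr // ltr_pMr // ltr1n.
have [xd xd' x1] : [/\ x < d, x < d' / K & x < 1].
  by move: xm; rewrite !lt_min => /andP[/andP[-> ->] ->].
have cx : cabs x%:C = x by rewrite cabs_real gtr0_norm.
have v : vabs (phi x%:C - phi 0) <= K * x by rewrite -{2}cx; apply: HK; rewrite cx.
have vd : vabs (phi x%:C - phi 0) < d'.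
  by apply: le_lt_trans v _; rewrite mulrC -ltr_pdivlMr.
have := Hd' _ vd; rewrite fphi ?cx // fphi // subr0.
have -> : dirder (phi x%:C - phi 0) 0 = 0.
  by rewrite /dirder big1 // => j _; rewrite g0 mul0r.
rewrite subr0 cx => h; have : (2 * K)^-1 * vabs (phi x%:C - phi 0) <= x / 2.
  rewrite ler_pdivrMl ?mulr_gt0 //; apply: le_trans v _.
  by rewrite [2 * K]mulrC -mulrA [2 * _]mulrC divfK.
lra.
Qed.

Lemma necessary_hpol : exists (a : 'I_n -> R[i]) (b : 'I_n -> R),
  (exists j, a j != 0) /\
  forall w l, D w -> cabs l < 1 ->
    (1 - cabs l ^+ 2) * complex.Re (l^*%C * hsep phi a b w 0) <= complex.Re (l^*%C * hsep phi a b w l).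
Proof.
have /choice[b Hb] := grad_hpol.
exists (fun j => (grad j 0)^*%C), b; split.
  by have [j gj] := grad0_neq0; exists j; rewrite -cabs_gt0 cabsJ cabs_gt0.
have E w l : cabs l < 1 -> hsep phi (fun j => (grad j 0)^*%C) b w l = - dirder (w - phi l) l.
  move=> l1; rewrite /hsep /dirder -sumrN; apply: eq_bigr => j _.
  by rewrite -Hb // !mxE -mulrN opprB.
move=> w l Dw l1; have z1 : cabs 0 < 1 :> R by rewrite cabs0 ltr01.
rewrite !E // !mulrN !Re_opp mulrN lerN2.
exact: generator_inequality.
Qed.

End Necessity.

(** * Boundary measures *)
Section AlmostEverywhereIntegrals.
Variable R : realType.
Notation T := (borelType (circle R)).
Variable m : {measure set T -> \bar R}.
Implicit Types (f u w : T -> R).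

Lemma wint_ae_eq u w f : L1 m u -> L1 m w -> bmeas f -> (\forall x \ae m, u x = w x) ->
  wint m u f = wint m w f.
Proof.
move=> iu iw bf uw; rewrite /wint /Rintegral; congr fine; apply: ae_eq_integral => //.
- exact: (measurable_int _ (L1M iu bf)).
- exact: (measurable_int _ (L1M iw bf)).
by apply: filterS uw => x -> _.
Qed.

Lemma wint_ge0_ae u f : L1 m u -> bmeas f -> (forall x, 0 <= f x) ->
  (\forall x \ae m, 0 <= u x) -> 0 <= wint m u f.
Proof.
move=> iu bf f0 u0; have ia : L1 m (fun x => `|u x|) by exact: integrable_norm.
rewrite (wint_ae_eq iu ia bf); first by apply: wint_ge0 => x; rewrite mulr_ge0.
by apply: filterS u0 => x ux; rewrite ger0_norm.
Qed.

Lemma wint_gt0_ae u : L1 m u -> (0 < m setT)%E -> (\forall x \ae m, 0 < u x) ->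
  0 < wint m u (fun=> 1).
Proof.
move=> iu m0 u0; have b1 : bmeas (fun=> 1) := @bmeas_cst R 1.
have u0' : \forall x \ae m, 0 <= u x by apply: filterS u0 => x /ltW.
rewrite lt_def wint_ge0_ae // andbT; apply/eqP => w0.
have ia : L1 m (fun x => `|u x|) by exact: integrable_norm.
have R0 : \int[m]_x `|u x| = 0.
  rewrite -w0 (wint_ae_eq iu ia b1); first by apply: eq_Rintegral => x _; rewrite mul1r.
  by apply: filterS u0' => x ux; rewrite ger0_norm.
have : (\int[m]_(x in setT) `|(u x)%:E| = 0)%E.
  by rewrite -[RHS]/(0%R%:E) -R0 /Rintegral fineK //; exact: integrable_fin_num.
move=> /(ae_eq_integral_abs m measurableT (measurable_int _ iu)) => uz.
have : \forall x \ae m, False.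
  apply: filterS2 u0 uz => x ux /(_ I) /eqP; rewrite eqe => /eqP E.
  by move: ux; rewrite E ltxx.
move=> [A [mA A0 TA]]; suff : m setT = 0%E by move=> E; rewrite E ltxx in m0.
by apply: (subset_measure0 measurableT mA _ A0) => x _; exact: TA.
Qed.

End AlmostEverywhereIntegrals.

Section BoundaryData.
Variables (R : realType) (D : set 'rV[R[i]]_2).
Hypothesis hD : is_convex_tube_domain D.
Hypothesis hW : closure (W_ D) = [set v : 'rV[R]_2 | v 0 1 <= 0].
Notation T := (borelType (circle R)).
Notation C := R[i]^o.
Notation zv := (@circle_val R).
Variables (phi : C -> 'rV[R[i]]_2) (mu : 'I_2 -> {charge set T -> \bar R}).
Hypotheses (hphi : M_ R 2 phi) (hmu : boundary_measure phi mu).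
Variables (g rho : T -> borelType 'rV[R]_2) (nu : {finite_measure set T -> \bar R}).
Hypothesis hgL1 : forall j : 'I_2, (arc_length R).-integrable setT (fun z => (g z 0 j)%:E).
Hypotheses (hrho : measurable_fun setT rho) (hrhoS : forall z, sphere R 2 (rho z)).
Hypothesis hdec : forall (j : 'I_2) (A : set T), measurable A ->
  mu j A = (\int[arc_length R]_(z in A) (g z 0 j)%:E + \int[nu]_(z in A) (rho z 0 j)%:E)%E.

Let linM := @linear_mean R.
Let c2 : R := (2 * pi)^-1.
Let c2_gt0 : 0 < c2. Proof. by rewrite invr_gt0 mulr_gt0 // pi_gt0. Qed.

Lemma cabs_disc (l : R[i]) : disc R l <-> cabs l < 1.
Proof. by rewrite cabs_lt /disc /= rmorph1. Qed.

Lemma measurable_coord (j : 'I_2) :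
  measurable_fun setT (fun x : borelType 'rV[R]_2 => (x : 'rV[R]_2) 0 j).
Proof.
apply: (measurability _ (RGenOInfty.measurableE R)).
move=> _ [_ [a ->] <-]; rewrite setTI; apply: sub_sigma_algebra.
rewrite set_itvE; apply: (@open_comp _ _ (fun x : 'rV[R]_2 => x 0 j)); last exact: open_gt.
by move=> x _; exact: coord_continuous.
Qed.

Lemma dot_rho z : dot (rho z) (rho z) = 1.
Proof.
have h := hrhoS z; rewrite -[LHS]sqr_sqrtr ?dot_ge0 // (_ : Num.sqrt _ = 1) ?expr1n //.
Qed.

Lemma bmeas_rho j : bmeas (fun z => rho z 0 j).
Proof.
split; first exact: (measurableT_comp (measurable_coord j) hrho).
exists 1 => z; rewrite -(ler_pXn2r (n := 2)) ?nnegrE // expr1n real_normK ?num_real //.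
by rewrite -(dot_rho z) coord_sqr_le.
Qed.

Lemma L1_rho j : L1 nu (fun z => rho z 0 j).
Proof.
apply: bmeas_L1; last exact: bmeas_rho.
by rewrite ltey_eq fin_num_measure.
Qed.

(** Integration against mu_j / (2 pi), in terms of its absolutely continuous and singular parts. *)
Definition bfunc j (f : T -> R) : R :=
  c2 * wint (arc_length R) (fun z => g z 0 j) f + c2 * wint nu (fun z => rho z 0 j) f.

Lemma linear_bfunc j : linear_bm (bfunc j).
Proof.
by apply: linear_bm_add; apply: linear_wint; [exact: hgL1|exact: L1_rho].
Qed.

Lemma phi_bfunc l j : cabs l < 1 ->
  phi l 0 j = cext (bfunc j) (schwarz l) + 'i%C * (complex.Im (phi 0 0 j))%:C.
Proof.
move=> l1; have -> := hmu (proj2 (cabs_disc l) l1) j; congr (_ + _).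
rewrite (charge_CintegralE (hgL1 j) (L1_rho j) (hdec j)); last exact: bmC_schwarz.
by apply: complexP; rewrite ?Re_RCmul ?Im_RCmul /= /bfunc -mulrDr.
Qed.

Lemma Re_phi l j : cabs l < 1 -> complex.Re (phi l 0 j) = bfunc j (poisson l).
Proof.
move=> l1; rewrite phi_bfunc // Re_add Re_mul Im_RC Re_RC /=.
by rewrite mul0r mulr0 subr0 addr0.
Qed.

Lemma differentiable_phi (l : C) : cabs l < 1 -> forall j, differentiable (fun l : C => phi l 0 j : C) l.
Proof.
move=> /cabs_disc l1 j; have [[_ dphi] _] := hphi.
have := dphi l l1 => dl.
apply: (@differentiable_comp _ _ _ _ phi (fun x : 'rV[R[i]]_2 => x 0 j : C)) => //.
exact: differentiable_coord.
Qed.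

Lemma sum_wint (m : {measure set T -> \bar R}) (u k : 'I_2 -> T -> R) f :
  (forall j, L1 m (u j)) -> (forall j, bmeas (k j)) -> bmeas f ->
  \sum_j wint m (u j) (fun z => k j z * f z) = wint m (fun z => \sum_j k j z * u j z) f.
Proof.
move=> iu bk bf; rewrite !big_ord_recl !big_ord0 !addr0 /wint -RintegralD //; last 2 first.
- by apply: L1M => //; exact: bmeasM.
- by apply: L1M => //; exact: bmeasM.
by apply: eq_Rintegral => x _; rewrite !big_ord_recl big_ord0; ring.
Qed.

Lemma L1_sum (m : {measure set T -> \bar R}) (u k : 'I_2 -> T -> R) :
  (forall j, L1 m (u j)) -> (forall j, bmeas (k j)) -> L1 m (fun z => \sum_j k j z * u j z).
Proof.
move=> iu bk; rewrite /L1.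
have -> : EFin \o (fun z => \sum_j k j z * u j z) =
    (EFin \o (fun z => k 0 z * u 0 z)) \+ (EFin \o (fun z => k 1 z * u 1 z)).
  apply/funext => z /=; rewrite !big_ord_recl big_ord0 addr0 EFinD.
  by congr (_ + (k _ z * u _ z)%:E)%E; apply: val_inj.
by apply: integrableD => //; exact: L1M.
Qed.

Lemma sum_bfunc (k : 'I_2 -> T -> R) f : (forall j, bmeas (k j)) -> bmeas f ->
  \sum_j bfunc j (fun z => k j z * f z) =
  c2 * wint (arc_length R) (fun z => \sum_j k j z * g z 0 j) f +
  c2 * wint nu (fun z => \sum_j k j z * rho z 0 j) f.
Proof.
move=> bk bf; rewrite big_split /= -!mulr_sumr !sum_wint //; exact: L1_rho.
Qed.

Variables (a : 'I_2 -> R[i]) (b : 'I_2 -> R).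

Let k j := kpol (a j) (b j).
Let bk j : bmeas (k j). Proof. exact: bmeas_kpol. Qed.

(** The density of the absolutely continuous part of k . (mu - x dL). *)
Definition gap (x : 'rV[R]_2) (z : T) : R := \sum_j k j z * g z 0 j - \sum_j k j z * x 0 j.

Lemma L1_gap x : L1 (arc_length R) (gap x).
Proof.
have bx : bmeas (fun z => \sum_j k j z * x 0 j).
  by apply: bmeas_sum => j; apply: bmeasM => //; exact: bmeas_cst.
have i1 := L1_sum (fun j => hgL1 j) bk.
have i2 := bmeas_L1 (arc_length_fin R) bx.
exact: (integrableB measurableT i1 i2).
Qed.

Lemma hweightE (z : 'rV[R[i]]_2) f : bmeas f -> hweight bfunc a b z f =
  c2 * wint (arc_length R) (gap (Re_vec z)) f +
  c2 * wint nu (fun w => \sum_j k j w * rho w 0 j) f.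
Proof.
move=> bf; rewrite /hweight /weighted /shifted.
under eq_bigr do rewrite mul1r mulNr; rewrite sumrB sum_bfunc // addrAC; congr (_ + _).
have bx : bmeas (fun w => \sum_j k j w * (Re_vec z) 0 j).
  by apply: bmeas_sum => j; apply: bmeasM => //; exact: bmeas_cst.
have i1 := L1_sum (fun j => hgL1 j) bk.
have i2 := bmeas_L1 (arc_length_fin R) bx.
transitivity (c2 * (wint (arc_length R) (fun w => \sum_j k j w * g w 0 j) f -
  wint (arc_length R) (fun w => \sum_j k j w * (Re_vec z) 0 j) f)); last first.
  congr (_ * _); rewrite /wint -RintegralB //; [|exact: L1M..].
  by apply: eq_Rintegral => w _; rewrite mulrBr.
rewrite mulrBr; congr (_ - _).
rewrite -(sum_wint (u := fun j _ => (Re_vec z) 0 j)) //; last first.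
  by move=> j; apply: bmeas_L1 (arc_length_fin R) _; exact: bmeas_cst.
rewrite mulr_sumr; apply: eq_bigr => j _; rewrite /mean -/c2 mulrCA; congr (_ * _).
rewrite mxE /wint -RintegralZl //; last exact: (bmeas_L1 (arc_length_fin R) (bmeasM (bk j) bf)).
by apply: eq_Rintegral => w _; rewrite mulrC.
Qed.

Lemma W_le0 v : W_ D v -> v 0 1 <= 0.
Proof. by move=> Wv; have := subset_closure Wv; rewrite hW. Qed.

Section Sufficiency.
Hypothesis hP : \forall z \ae arc_length R,
  closure (ReD D) (g z) /\ forall x, ReD D x -> dot (x - g z) (\row_j k j z) < 0.
Hypothesis hRho : \forall z \ae nu, rho z = e2 R.
Hypothesis h0 : ReD D (Re_vec (phi 0)).
Hypothesis hk : \forall z \ae nu, k 1 z = 0.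

(** The Poisson kernel at l is at least t = (1 - |l|) / 2, so Re phi(l) = t x0 + (1 - t) y with x0 =
    Re phi(0), where y integrates mu against the nonnegative rest of the kernel. A hyperplane
    separating y from Re D would have normal v in W_D, so v_2 <= 0 and the singular part, along e_2,
    cannot push <y, v> beyond the bound. Hence y is in the closure, and openness at x0 puts Re
    phi(l) inside. *)
Lemma phi_tube l : cabs l < 1 -> D (phi l).
Proof.
move=> l1; have [nO oO cO DE] := tubeE hD; apply/DE.
have lge := cabs_ge0 l.
pose t := (1 - cabs l) / 2; have [t0 t1] : 0 < t /\ t < 1 by rewrite /t; lra.
pose x0 := Re_vec (phi 0).
have bp := bmeas_poisson l1.
pose f z := poisson l z - t; have bf : bmeas f by apply: bmeasB => //; exact: bmeas_cst.
have f0 z : 0 <= f z.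
  rewrite subr_ge0; apply: le_trans (poisson_ge l1 z).
  by rewrite /t ler_pM2l ?subr_gt0 // lef_pV2 ?posrE; lra.
have z1 : cabs 0 < 1 :> R by rewrite cabs0 ltr01.
have p0 : poisson (0 : R[i]) = (fun=> 1).
  by apply/funext => z; rewrite poissonE // cabs0 subr0 cabs_circle !expr1n expr0n subr0 divr1.
pose y := (1 - t)^-1 *: (Re_vec (phi l) - t *: x0).
have yE j : (1 - t) * y 0 j = bfunc j f.
  rewrite !mxE mulrA mulfV ?gt_eqF ?subr_gt0 // mul1r !Re_phi // p0.
  have [_ Z] := linear_bfunc j; have bt : bmeas (fun _ : T => t) by exact: bmeas_cst.
  rewrite /f (linear_bmB (linear_bfunc j)) // -Z //; last exact: bmeas_cst.
  by congr (_ - bfunc _ _); apply/funext => z; rewrite mulr1.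
have Oy : closure (ReD D) y.
  apply: contrapT => /(separation nO cO)[v [c [d [d0 Hv Hd]]]].
  have cy : c < dot y v by apply: Hd => j; rewrite subrr normr0.
  have v1 : v 0 1 <= 0.
    by apply: W_le0; apply/W_P => //; exists c => x Ox; apply: Hv; exact: subset_closure.
  have bv j : bmeas (fun _ : T => v 0 j) by exact: bmeas_cst.
  have E : (1 - t) * dot y v = c2 * wint (arc_length R) (fun z => \sum_j v 0 j * g z 0 j) f +
      c2 * wint nu (fun z => \sum_j v 0 j * rho z 0 j) f.
    rewrite -sum_bfunc // /dot mulr_sumr; apply: eq_bigr => j _.
    rewrite mulrA yE mulrC; have [_ Z] := linear_bfunc j; by rewrite -Z.
  have h1 : wint nu (fun z => \sum_j v 0 j * rho z 0 j) f <= 0.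
    have iv : L1 nu (fun z => \sum_j v 0 j * rho z 0 j) by apply: L1_sum => // j; exact: L1_rho.
    have [_ Z] := linear_wint iv.
    have ivN : L1 nu (fun z => - \sum_j v 0 j * rho z 0 j) by exact: (integrableN iv).
    have : 0 <= wint nu (fun z => - \sum_j v 0 j * rho z 0 j) f.
      apply: wint_ge0_ae => //; apply: filterS hRho => z ->.
      rewrite !big_ord_recl big_ord0 !mxE /= mulr0 add0r addr0 mulr1 oppr_ge0.
      by rewrite (_ : lift ord0 ord0 = 1) //; apply: val_inj.
    by rewrite /wint; under eq_Rintegral do rewrite mulrN -mulN1r;
      rewrite RintegralZl ?mulN1r ?oppr_ge0 //; exact: L1M.
  have h2 : c2 * wint (arc_length R) (fun z => \sum_j v 0 j * g z 0 j) f <= c * (1 - t).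
    have iv : L1 (arc_length R) (fun z => \sum_j v 0 j * g z 0 j).
      by apply: L1_sum => // j; exact: hgL1.
    have ic : L1 (arc_length R) (fun=> c) := bmeas_L1 (arc_length_fin R) (bmeas_cst c).
    have : 0 <= wint (arc_length R) (fun z => c - \sum_j v 0 j * g z 0 j) f.
      apply: wint_ge0_ae => //; first exact: (integrableB measurableT ic iv).
      apply: filterS hP => z [gz _]; rewrite subr_ge0; have := Hv _ gz.
      by congr (_ <= _); apply: eq_bigr => j _; rewrite mulrC.
    rewrite /wint; under eq_Rintegral do rewrite mulrBr; rewrite RintegralB //; [|exact: L1M..].
    rewrite subr_ge0 => h; rewrite -(ler_pM2l c2_gt0) in h; apply: le_trans h _.
    rewrite le_eqVlt; apply/orP; left; apply/eqP.
    have -> : \int[arc_length R]_x (f x * c) = c * \int[arc_length R]_x f x.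
      rewrite -RintegralZl //; last exact: (bmeas_L1 (arc_length_fin R) bf).
      by apply: eq_Rintegral => z _; rewrite mulrC.
    rewrite mulrCA; congr (_ * _); rewrite -[LHS]/(mean f) /f (linear_bmB linM) //; last exact: bmeas_cst.
    by rewrite mean_poisson // mean_cst.
  have h3 : c2 * wint nu (fun z => \sum_j v 0 j * rho z 0 j) f <= 0 by rewrite pmulr_rle0.
  have : (1 - t) * dot y v <= c * (1 - t) by rewrite E -[leRHS]addr0 lerD.
  by rewrite mulrC ler_pM2r ?subr_gt0 // leNgt cy.
have := open_convex_interior oO cO h0 Oy (_ : 0 < t <= 1); rewrite t0 ltW // => /(_ isT).
congr (ReD D _); apply/rowP => j.
by rewrite /y /x0 !mxE; field; rewrite gt_eqF // subr_gt0.
Qed.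

(** The inequality in [hP] makes [gap] positive almost everywhere, and k . rho = 0 for nu by [hRho]
    and [hk]. So [hweight] is a monotone functional of positive mass. *)
Lemma data_left_inverse : exists2 f : 'rV[R[i]]_2 -> C,
  forall z, D z -> holomorphic_at f z /\ cabs (f z) < 1 &
  forall l, cabs l < 1 -> f (phi l) = l.
Proof.
have [nO oO cO DE] := tubeE hD.
have gap_gt0 z : D z -> \forall w \ae arc_length R, 0 < gap (Re_vec z) w.
  move=> /DE Dz; apply: filterS hP => w [_ /(_ _ Dz)].
  rewrite dotBl subr_lt0 /gap subr_gt0; congr (_ < _); apply: eq_bigr => j _;
    by rewrite mxE mulrC.
have krho : \forall w \ae nu, \sum_j k j w * rho w 0 j = 0.
  apply: filterS2 hRho hk => w -> kw; rewrite !big_ord_recl big_ord0 !mxE /= mulr0 add0r addr0 mulr1.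
  by rewrite -[RHS]kw; congr k; apply: val_inj.
have iR : L1 nu (fun w => \sum_j k j w * rho w 0 j) by apply: L1_sum => // j; exact: L1_rho.
have nu0 f : bmeas f -> wint nu (fun w => \sum_j k j w * rho w 0 j) f = 0.
  move=> bf; have i0 : L1 nu (fun=> 0).
    by apply: bmeas_L1; [rewrite ltey_eq fin_num_measure|exact: bmeas_cst].
  rewrite (wint_ae_eq iR i0 bf krho) /wint.
  by under eq_Rintegral do rewrite mulr0; rewrite /Rintegral integral0.
have hE z f : bmeas f -> hweight bfunc a b z f = c2 * wint (arc_length R) (gap (Re_vec z)) f.
  by move=> bf; rewrite hweightE // nu0 // mulr0 addr0.
pose sg j := complex.Im (phi 0 0 j).
have phE : forall l j, cabs l < 1 -> phi l 0 j = cext (bfunc j) (schwarz l) + 'i%C * (sg j)%:C.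
  by move=> l j; exact: phi_bfunc.
have mon z : D z -> monotone_bm (hweight bfunc a b z).
  move=> Dz f f' bf bf' ff'; rewrite !hE // ler_pM2l // -subr_ge0.
  rewrite -(linear_bmB (linear_wint (L1_gap _))) //.
  apply: wint_ge0_ae; [exact: L1_gap|exact: bmeasB|by move=> w; rewrite subr_ge0|].
  by apply: filterS (gap_gt0 z Dz) => w /ltW.
have pos z : D z -> 0 < hweight bfunc a b z (fun=> 1).
  move=> Dz; rewrite hE; last exact: bmeas_cst.
  have L0 : (0 < arc_length R setT)%E by rewrite arc_lengthT lte_fin mulr_gt0 // pi_gt0.
  by rewrite mulr_gt0 //; apply: wint_gt0_ae; [exact: L1_gap|exact: L0|exact: gap_gt0].
exact: (hsep_left_inverse hD linear_bfunc phE differentiable_phi phi_tube mon pos).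
Qed.

End Sufficiency.

Section NecessaryConditions.
Hypothesis hnu : mutually_singular (arc_length R) nu.
Hypothesis phiD : forall l, cabs l < 1 -> D (phi l).
Hypothesis a0 : exists j, a j != 0.
Hypothesis hineq : forall w l, D w -> cabs l < 1 ->
  (1 - cabs l ^+ 2) * complex.Re (l^*%C * hsep phi a b w 0) <= complex.Re (l^*%C * hsep phi a b w l).

(** In gauge form the value at 0 is c, so by [Re_gauge] the inequality [hineq] reduces to |l|^2
    times the Poisson integral being nonnegative, whence l must be nonzero. *)
Lemma hweight_ge0 w l : D w -> 0 < cabs l < 1 -> 0 <= hweight bfunc a b w (poisson l).
Proof.
move=> Dw /andP[l0 l1]; pose sg j := complex.Im (phi 0 0 j).
have phE : forall l j, cabs l < 1 -> phi l 0 j = cext (bfunc j) (schwarz l) + 'i%C * (sg j)%:C.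
  by move=> x j; exact: phi_bfunc.
have z1 : cabs 0 < 1 :> R by rewrite cabs0 ltr01.
have [c [t ct]] := hsep_gauge linear_bfunc phE a b w.
have := hineq Dw l1; rewrite (ct 0 z1) (ct l l1).
have -> : gauge c t (cext (hweight bfunc a b w) (schwarz 0)) 0 = c.
  by rewrite /gauge expr0n mulr0 subr0 mul0r addr0.
by rewrite Re_gauge lerDl pmulr_rge0 // exprn_gt0.
Qed.

Lemma gap_rho_ge0 w : D w -> (\forall z \ae arc_length R, 0 <= gap (Re_vec w) z) /\
  (\forall z \ae nu, 0 <= \sum_j k j z * rho z 0 j).
Proof.
move=> Dw; apply: (positive_ae hnu (L1_gap _) (L1_sum L1_rho bk)) => l l01.
have := hweight_ge0 Dw l01; case/andP: l01 => l0 l1.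
rewrite hweightE; last exact: bmeas_poisson.
by rewrite -mulrDr pmulr_rge0.
Qed.

(** This is [positive_ae] for c dL - <mu, v>: divided by 2 pi, its Poisson integral at l is c - <Re
    phi(l), v>. *)
Lemma W_ae v c : (forall x, ReD D x -> dot x v <= c) ->
  (\forall z \ae arc_length R, dot (g z) v <= c) /\ (\forall z \ae nu, dot (rho z) v <= 0).
Proof.
move=> Hv; have bv j : bmeas (fun _ : T => v 0 j) by exact: bmeas_cst.
have ig := L1_sum hgL1 bv; have ir := L1_sum L1_rho bv.
have ic : L1 (arc_length R) (fun=> c) := bmeas_L1 (arc_length_fin R) (bmeas_cst c).
have igc : L1 (arc_length R) (fun z => c - \sum_j v 0 j * g z 0 j).
  exact: (integrableB measurableT ic ig).
have irN : L1 nu (fun z => - \sum_j v 0 j * rho z 0 j) by exact: (integrableN ir).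
have [] := positive_ae hnu igc irN; last first.
  move=> Hg Hr; split.
    by apply: filterS Hg => z; rewrite subr_ge0 => h; apply: le_trans h; rewrite /dot;
      under eq_bigr do rewrite mulrC.
  by apply: filterS Hr => z; rewrite oppr_ge0 => h; apply: le_trans h; rewrite /dot;
      under eq_bigr do rewrite mulrC.
move=> l /andP[_ l1]; have bp := bmeas_poisson l1; rewrite -(pmulr_rge0 _ c2_gt0).
have E : c2 * (wint (arc_length R) (fun z => c - \sum_j v 0 j * g z 0 j) (poisson l) +
    wint nu (fun z => - \sum_j v 0 j * rho z 0 j) (poisson l)) = c - dot (Re_vec (phi l)) v.
  have -> : wint (arc_length R) (fun z => c - \sum_j v 0 j * g z 0 j) (poisson l) =
      wint (arc_length R) (fun=> c) (poisson l) -
      wint (arc_length R) (fun z => \sum_j v 0 j * g z 0 j) (poisson l).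
    rewrite /wint -RintegralB //; [|exact: L1M..].
    by apply: eq_Rintegral => z _; rewrite mulrBr.
  have -> : wint nu (fun z => - \sum_j v 0 j * rho z 0 j) (poisson l) =
      - wint nu (fun z => \sum_j v 0 j * rho z 0 j) (poisson l).
    rewrite /wint -mulN1r -RintegralZl //; last exact: L1M.
    by apply: eq_Rintegral => z _; rewrite mulrN mulN1r.
  have -> : dot (Re_vec (phi l)) v = \sum_j bfunc j (fun z => v 0 j * poisson l z).
    apply: eq_bigr => j _; have [_ Z] := linear_bfunc j.
    by rewrite Z // mxE Re_phi // mulrC.
  rewrite sum_bfunc //.
  have -> : wint (arc_length R) (fun=> c) (poisson l) = c * \int[arc_length R]_x poisson l x.
    rewrite /wint -RintegralZl //; last exact: (bmeas_L1 (arc_length_fin R) bp).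
    by apply: eq_Rintegral => z _; rewrite mulrC.
  have M1 : c2 * \int[arc_length R]_x poisson l x = 1 := mean_poisson l1.
  by rewrite mulrDr mulrBr mulrCA M1 mulr1 mulrN opprD addrA.
rewrite E subr_ge0; apply: Hv; have [_ _ _ DE] := tubeE hD; apply/DE; exact: phiD.
Qed.

(** The bound <rho, v> <= 0 extends from W_D to its closure, which contains e_1, - e_1 and - e_2. So
    rho_1 = 0 and rho_2 >= 0, and rho is a unit vector. *)
Lemma rho_e2 : \forall z \ae nu, rho z = e2 R.
Proof.
have rho1 z j : `|rho z 0 j| <= 1.
  rewrite -(ler_pXn2r (n := 2)) ?nnegrE // expr1n real_normK ?num_real //.
  by rewrite -(dot_rho z) coord_sqr_le.
have H (t : 'rV[R]_2) : t 0 1 <= 0 -> \forall z \ae nu, dot (rho z) t <= 0.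
  move=> t1; have : closure (W_ D) t by rewrite hW.
  move=> /closure_rVP Wt.
  (* The factor 2 bounds the sum of the |rho_j|; a sequence of approximations of t keeps the
     exceptional sets countable in number. *)
  have : \forall z \ae nu, forall m : nat, dot (rho z) t <= m.+1%:R^-1 *+ 2.
    apply: ae_foralln => m; have m0 : 0 < m.+1%:R^-1 :> R by rewrite invr_gt0.
    have [v /(W_P hD)[c Hc] vt] := Wt _ m0; have [_] := W_ae Hc.
    apply: filterS => z hz; rewrite -[t](subrK v) addrC dotDr -[leRHS]add0r; apply: lerD => //.
    apply: le_trans (ler_norm _) _; rewrite dotC.
    apply: le_trans (dot_le_sum (d := m.+1%:R^-1) _ _) _.
      by move=> j; rewrite !mxE distrC ltW.
    rewrite -[leRHS]mulr_natr ler_pM2l // !big_ord_recl big_ord0 addr0.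
    by rewrite (_ : 2 = 1 + 1) //; apply: lerD.
  apply: filterS => z hz; apply/ler_addgt0Pr => e e0; rewrite add0r.
  apply: le_trans (hz (Num.bound (2 / e))) _; rewrite -[leLHS]mulr_natl ler_pdivrMr //.
  rewrite [leRHS]mulrC -ler_pdivrMr //; apply: le_trans (ltW (archi_boundP _)) _.
    by rewrite divr_ge0 // ltW.
  by rewrite ler_nat.
pose E0 : 'rV[R]_2 := delta_mx 0 0.
have h1 : \forall z \ae nu, dot (rho z) E0 <= 0 by apply: H; rewrite mxE.
have h2 : \forall z \ae nu, dot (rho z) (- E0) <= 0 by apply: H; rewrite !mxE oppr0.
have h3 : \forall z \ae nu, dot (rho z) (- e2 R) <= 0.
  by apply: H; rewrite !mxE /= oppr_le0 ler01.
apply: filterS3 h1 h2 h3 => z; have := dot_rho z; rewrite /dot !big_ord_recl !big_ord0 !mxE /=.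
rewrite (_ : lift ord0 ord0 = 1); last exact: val_inj.
rewrite !(mulr1, mulr0, addr0, add0r, oppr0, mulrN, mulrN1) => E r1 r2 r3.
have r0 : rho z 0 0 = 0 by apply/eqP; rewrite eq_le r1 -oppr_le0.
have r4 : rho z 0 1 = 1.
  move: E; rewrite r0 mul0r add0r => E; move: r3; rewrite oppr_le0 => r3; nra.
apply/rowP => j; rewrite mxE /=; case: j => [[|[|j]] ij] //=.
  by rewrite (_ : Ordinal ij = 0) ?r0 //; exact: val_inj.
by rewrite (_ : Ordinal ij = 1) ?r4 //; exact: val_inj.
Qed.

Lemma g_closure : \forall z \ae arc_length R, closure (ReD D) (g z).
Proof.
by have [nO _ cO _] := tubeE hD; apply: ae_closure => // v c /W_ae[].
Qed.

Lemma measurable_point (z0 : T) : measurable [set z0].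
Proof.
have [[mR _] [mI _]] := bmC_circle_val R.
rewrite (_ : [set z0] = ((fun z : T => complex.Re (zv z)) @^-1` [set complex.Re (zv z0)]) `&`
    ((fun z : T => complex.Im (zv z)) @^-1` [set complex.Im (zv z0)])).
  apply: measurableI; rewrite -[X in measurable X]setTI; [exact: mR|exact: mI].
apply/seteqP; split => [z ->//|z [/= zr zi]].
by apply: val_inj; exact: complexP.
Qed.

(* The Poisson kernel at r z0 has mean 1 but the value (1 + r)/(1 - r) at z0. *)
Lemma arc_length_point (z0 : T) : arc_length R [set z0] = 0%E.
Proof.
have m1 := measurable_point z0; have b1 := bmeas_indic m1.
pose q := mean (\1_[set z0] : T -> R).
have q0 : 0 <= q by apply: mean_ge0 => z; rewrite indicE.
have qr r : 0 < r < 1 -> q <= (1 - r).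
  move=> /andP[r0 r1]; have lr : cabs (r%:C * zv z0) = r.
    by rewrite cabsM cabs_circle mulr1 cabs_real gtr0_norm.
  have l1 : cabs (r%:C * zv z0) < 1 by rewrite lr.
  have pz : poisson (r%:C * zv z0) z0 = (1 + r) / (1 - r).
    rewrite poissonE // lr (_ : zv z0 - _ = (1 - r)%:C * zv z0); last first.
      by rewrite rmorphB rmorph1 mulrBl mul1r.
    rewrite cabsM cabs_circle mulr1 cabs_real ger0_norm ?subr_ge0 ?(ltW r1) //.
    by field; rewrite gt_eqF // subr_gt0.
  have [_ Z] := linM.
  have : mean (fun z => (1 - r)^-1 * \1_[set z0] z) <= mean (poisson (r%:C * zv z0)).
    apply: mean_le => [||z]; [exact: bmeasZ|exact: bmeas_poisson|].
    rewrite indicE; have [->|zz] := eqVneq z z0.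
      by rewrite mem_set // mulr1 pz ler_peMl ?invr_ge0 ?subr_ge0 ?(ltW r1) // lerDl ltW.
    by rewrite memNset ?mulr0 ?ltW ?poisson_gt0 //; exact/eqP.
  by rewrite Z // mean_poisson // -/q mulrC ler_pdivrMr ?subr_gt0 // mul1r.
have {}q0 : q = 0.
  apply/eqP; rewrite eq_le q0 andbT leNgt; apply/negP => qp.
  have h : q <= 2^-1 by have := qr (2^-1); lra.
  have := qr (1 - q / 2); lra.
move: q0; rewrite /q /mean /Rintegral integral_indic // setIT => /eqP.
rewrite mulf_eq0 gt_eqF ?c2_gt0 //= => /eqP E.
by rewrite -[LHS]fineK ?E //; exact: fin_num_measure.
Qed.

(** On the circle a zero of [kpol] solves c z^2 + d z + conj(c) = 0, and a root other than z1 must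
    be - d / c - z1. *)
Lemma kpol_zeros (c : R[i]) (d : R) : c != 0 ->
  exists z1 z2, forall z, kpol c d z = 0 -> z = z1 \/ z = z2.
Proof.
move=> c0; have root z : kpol c d z = 0 -> c * zv z ^+ 2 + d%:C * zv z + c^*%C = 0.
  move=> kz; have := kpolE c d z; rewrite kz rmorph0 => /(congr1 (fun x => x * zv z)) E.
  rewrite mul0r in E; rewrite [RHS]E !mulrDl divfK ?circle_val_neq0 //.
  by ring.
have [[z1 k1]|none] := pselect (exists z, kpol c d z = 0); last first.
  by exists point, point => z kz; case: none; exists z.
have [[z2 [k2 z12]]|none] := pselect (exists z, kpol c d z = 0 /\ z != z1); last first.
  exists z1, z1 => z kz; left; apply/eqP/negPn/negP => zz; apply: none; by exists z.
exists z1, z2 => z kz; have [->|zz1] := eqVneq z z1; first by left.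
right; have inj (x y : T) : x != y -> zv x - zv y != 0.
  by apply: contraNneq => /eqP; rewrite subr_eq0 => /eqP /val_inj ->.
have sum x : kpol c d x = 0 -> x != z1 -> zv x = - d%:C / c - zv z1.
  move=> kx xz; apply: (mulfI c0); apply: (mulfI (inj _ _ xz)).
  have E1 := root _ k1; have Ex := root _ kx.
  apply/eqP; rewrite -subr_eq0 mulrBr [c * (_ / c)]mulrC divfK //; apply/eqP.
  transitivity ((c * zv x ^+ 2 + d%:C * zv x + c^*%C) - (c * zv z1 ^+ 2 + d%:C * zv z1 + c^*%C)).
    by ring.
  by rewrite E1 Ex subrr.
by apply: val_inj; rewrite -[LHS]/(zv z) -[RHS]/(zv z2) (sum z) // (sum z2).
Qed.

Lemma k_neq0 : \forall z \ae arc_length R, exists j, k j z != 0.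
Proof.
have [j aj] := a0; have [z1 [z2 Hz]] := kpol_zeros (b j) aj.
exists ([set z1] `|` [set z2]); split.
- by apply: measurableU; exact: measurable_point.
- apply/eqP; rewrite eq_le measure_ge0 andbT; apply: le_trans (measureU2 _ _ _) _;
    [exact: measurable_point..|].
  by rewrite [X in (X + _)%E]arc_length_point [X in (_ + X)%E]arc_length_point adde0.
move=> z /= nz; apply: Hz; apply/eqP/negPn/negP => kz; apply: nz; by exists j.
Qed.

(** Off one null set the weak inequality holds at all rational points of Re D. If <x - g, K> >= 0 at
    some x in Re D, moving x along K, which is nonzero almost everywhere, would give a rational
    point of the open set Re D with a positive value. *)
Lemma P_ae : \forall z \ae arc_length R,
  closure (ReD D) (g z) /\ forall x, ReD D x -> dot (x - g z) (\row_j k j z) < 0.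
Proof.
have [_ oO _ DE] := tubeE hD.
have gapE x z : gap x z = - dot (x - g z) (\row_j k j z).
  rewrite dotBl opprB /gap; congr (_ - _); apply: eq_bigr => j _; by rewrite mxE mulrC.
have rat : \forall z \ae arc_length R, forall q : 'rV[rat]_2, ReD D (rat_row R q) ->
    dot (rat_row R q - g z) (\row_j k j z) <= 0.
  apply: ae_forall_countable => q; have [Dq|Dq] := pselect (ReD D (rat_row R q)); last exact: aeW.
  have Dc : D (complexify (rat_row R q) 0) by apply/DE; rewrite Re_complexify.
  have [h _] := gap_rho_ge0 Dc; apply: filterS h => z; rewrite Re_complexify gapE.
  by rewrite oppr_ge0.
apply: filterS3 g_closure rat k_neq0 => z gz Hq [j0 kj0]; split=> // x Ox.
set K := \row_j _ in Hq *; rewrite ltNge; apply/negP => xK.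
have K0 : 0 < dot K K.
  rewrite lt_def dot_ge0 andbT; apply/eqP => /dot_eq0 /rowP /(_ j0); rewrite !mxE => /eqP.
  by rewrite (negbTE kj0).
have /nbhs_rVP[e e0 He] : nbhs x (ReD D) by exact: open_nbhs_nbhs.
pose S := \sum_j `|K 0 j| + 1.
have S0 : 0 <= \sum_j `|K 0 j| by exact: sumr_ge0.
have S1 : 0 < S by rewrite /S ltr_wpDl.
have KS j : `|K 0 j| <= S.
  by rewrite /S (bigD1 j) //= -addrA lerDl addr_ge0 // sumr_ge0.
(* The shift s K uses half of the box around x. The rational error d fits in the other half, and its
   effect on <., K> is less than the gain s <K, K>. *)
pose s := e / (2 * S); have s0 : 0 < s by rewrite divr_gt0 // mulr_gt0.
have sS : s * S = e / 2 by rewrite /s; field; rewrite gt_eqF.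
pose d := Num.min (e / 2) (s * dot K K / S).
have d0 : 0 < d by rewrite lt_min !divr_gt0 // mulr_gt0.
have [q Hqd] := rat_row_approx (x + s *: K) d0.
have Dq : ReD D (rat_row R q).
  apply: He => j; have := Hqd j; rewrite !mxE lt_min => /andP[h1 _].
  rewrite (_ : _ - _ = (ratr (q 0 j) - (x 0 j + s * K 0 j)) + s * K 0 j); last by ring.
  apply: le_lt_trans (ler_normD _ _) _; rewrite [ltRHS]splitr; apply: ltr_leD.
    by move: h1; rewrite /K !mxE.
  by rewrite normrM (gtr0_norm s0) -sS ler_pM2l.
have := Hq q Dq.
have -> : rat_row R q - g z = (rat_row R q - (x + s *: K)) + (s *: K + (x - g z)).
  by apply/rowP => j; rewrite !mxE; ring.
rewrite dotDl (dotDl (s *: K)) dotZl.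
have : `|dot (rat_row R q - (x + s *: K)) K| <= d * \sum_j `|K 0 j|.
  apply: dot_le_sum => j; have := Hqd j; by rewrite !mxE => /ltW.
have : d * \sum_j `|K 0 j| < s * dot K K.
  apply: (@lt_le_trans _ _ (d * S)); first by rewrite ltr_pM2l // ltrDl.
  by rewrite -ler_pdivlMr // ge_min lexx orbT.
rewrite ler_norml; move: (d * _) (s * dot K K) (dot (_ - (x + _)) K) (dot (x - _) K) xK => A B X Y Y0 AB /andP[XA _].
rewrite leNgt => /negP; apply; rewrite addrA ltr_wpDr // -ltrBlDr sub0r.
by apply: lt_le_trans XA; rewrite ltrN2.
Qed.

Lemma mean_kpol l j : cabs l < 1 -> mean (fun z => k j z * poisson l z) = b j + 2 * complex.Re (a j * l).
Proof.
move=> l1; have dF (z : C) : cabs z < 2 ->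
    differentiable (fun z : C => (b j)%:C + ((2 : R)%:C * a j) * z : C) z.
  by move=> _; apply: differentiableD => //; exact: differentiableZ.
have r12 : 0 < (1 : R) < 2 by lra.
have := Re_poisson l1 dF r12; rewrite rmorph1 mul1r -mulrA Re_add Re_RC Re_RCmul => ->.
congr mean; apply/funext => z; congr (_ * _).
by rewrite mul1r -mulrA Re_add Re_RC Re_RCmul.
Qed.

(** By [P_ae] the vector k(zeta) is in W_D for almost every zeta, so [k 1] is nonpositive there. Its
    Poisson integral b + 2 Re(a l) is then nonpositive in the disc, and l approaches the boundary
    point that maximizes it. *)
Lemma k1_bound : b 1 + 2 * cabs (a 1) <= 0.
Proof.
have k1 : \forall z \ae arc_length R, 0 <= - k 1 z.
  apply: filterS P_ae => z [_ Hz]; rewrite oppr_ge0.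
  have : W_ D (\row_j k j z).
    apply/W_P => //; exists (dot (g z) (\row_j k j z)) => x /Hz; rewrite dotBl subr_lt0.
    exact: ltW.
  by move=> /W_le0; rewrite mxE.
have ineq l : cabs l < 1 -> b 1 + 2 * complex.Re (a 1 * l) <= 0.
  move=> l1; rewrite -mean_kpol //; have bp := bmeas_poisson l1.
  have bN : bmeas (fun z => - k 1 z) by exact: bmeasN.
  have : 0 <= wint (arc_length R) (fun z => - k 1 z) (poisson l).
    apply: wint_ge0_ae => //; first exact: (bmeas_L1 (arc_length_fin R) bN).
    by move=> z; rewrite ltW // poisson_gt0.
  have ik : L1 (arc_length R) (fun z => k 1 z * poisson l z).
    exact: (bmeas_L1 (arc_length_fin R) (bmeasM (bk 1) bp)).
  have -> : wint (arc_length R) (fun z => - k 1 z) (poisson l) =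
      - \int[arc_length R]_z (k 1 z * poisson l z).
    rewrite /wint -mulN1r -RintegralZl //.
    by apply: eq_Rintegral => z _; rewrite mulN1r mulrN mulrC.
  by rewrite oppr_ge0 /mean -/c2 pmulr_rle0.
have [w w1 wa] := rotate (a 1); set A := cabs (a 1) in wa *.
have A0 : 0 <= A by exact: cabs_ge0.
have {}ineq r : 0 < r < 1 -> b 1 + 2 * (r * A) <= 0.
  move=> /andP[r0 r1]; have := ineq (r%:C * w); rewrite cabsM w1 mulr1 cabs_real gtr0_norm // => /(_ r1).
  by rewrite mulrCA [a 1 * w]mulrC wa Re_RCmul Re_RC.
rewrite leNgt; apply/negP => S0; set S := b 1 + 2 * A in S0.
(* If S > 0, the radius 1 - q with q = S / (4 (A + 1) + S) leaves S - 2 q A > 0, against [ineq]. *)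
have q0 : 0 < 4 * (A + 1) + S by lra.
have q1 : 0 < S / (4 * (A + 1) + S) < 1.
  by rewrite divr_gt0 //= ltr_pdivrMr // mul1r; lra.
have E : S / (4 * (A + 1) + S) * (4 * (A + 1) + S) = S by rewrite divfK // gt_eqF.
move: (S / _) q1 E => q /andP[q2 q3] E; have := ineq (1 - q).
have bE : b 1 = S - 2 * A by rewrite /S addrK.
have q4 : 0 < 1 - q < 1 by rewrite subr_gt0 q3 ltrBlDr ltrDl.
have qA : 0 <= q * A by rewrite mulr_ge0 // ltW.
have qS : 0 < q * S by exact: mulr_gt0.
move=> /(_ q4); rewrite bE mulrBl mul1r mulrBr.
rewrite mulrDr mulrCA mulrDr mulr1 mulrDr in E.
rewrite addrA subrK subr_le0 => h; move: E; apply/eqP; rewrite gt_eqF //.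
apply: (le_lt_trans h); rewrite -addrA ltr_pwDr //.
  by rewrite addr_gt0 // mulr_gt0.
by rewrite ler_wpM2r // ler_nat.
Qed.

Lemma k1_le0 z : k 1 z <= 0.
Proof.
apply: le_trans k1_bound; rewrite lerD2l ler_pM2l //.
by apply: le_trans (Re_leC _) _; rewrite cabsM cabs_circle mulr1.
Qed.

(** Positivity of the singular part k . rho with rho = e_2 gives [k 1] >= 0 for nu, while [k1_le0]
    holds everywhere. *)
Lemma k1_nu : \forall z \ae nu, k 1 z = 0.
Proof.
have z1 : cabs 0 < 1 :> R by rewrite cabs0 ltr01.
have [_ h] := gap_rho_ge0 (phiD z1).
apply: filterS2 rho_e2 h => z ->; rewrite !big_ord_recl big_ord0 !mxE /= mulr0 add0r addr0 mulr1.
rewrite (_ : lift ord0 ord0 = 1); last exact: val_inj.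
by move=> kz; apply/eqP; rewrite eq_le k1_le0.
Qed.

(** Since b <= - 2 |a|, a zero forces Re(a z) to attain its maximum |a|, so a z = |a|, which
    determines z. *)
Lemma k1_zero_unique z w : (a 1 != 0) || (b 1 != 0) -> k 1 z = 0 -> k 1 w = 0 -> z = w.
Proof.
move=> ab kz kw; have bnd := k1_bound.
have a10 : a 1 != 0.
  case/orP: ab => // b0; apply/eqP => a10; move: kz; rewrite /k /kpol a10 mul0r mulr0 addr0.
  by apply/eqP.
have key x : k 1 x = 0 -> a 1 * zv x = (cabs (a 1))%:C.
  rewrite /k /kpol => kx; have c1 : cabs (a 1 * zv x) = cabs (a 1) by rewrite cabsM cabs_circle mulr1.
  have le := Re_leC (a 1 * zv x); have sq := cabs_sqr (a 1 * zv x); rewrite c1 in le sq.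
  have re : complex.Re (a 1 * zv x) = cabs (a 1) by lra.
  apply: complexP => //=; apply/eqP; rewrite -sqrf_eq0; apply/eqP.
  by move: sq; rewrite re -[X in X = _]addr0 => /addrI.
by apply: val_inj; apply: (mulfI a10); rewrite (key z kz) (key w kw).
Qed.

(** The measure nu is carried by the zero set of [k 1], which has at most one point. *)
Lemma nu_dirac : (a 1 != 0) || (b 1 != 0) ->
  exists (alpha : R) (l0 : T), [/\ 0 <= alpha,
    (forall A : set T, measurable A -> nu A = alpha%:E * \d_l0 A)%E & alpha * k 1 l0 = 0].
Proof.
move=> ab; have [N [mN N0 HN]] := k1_nu.
have null A : measurable A -> (forall z, A z -> k 1 z <> 0) -> nu A = 0%E.
  by move=> mA kA; apply: (subset_measure0 mA mN _ N0) => z Az; apply: HN; exact: kA.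
have [[l0 kl0]|none] := pselect (exists z, k 1 z = 0); last first.
  (* Without a zero, nu = 0: the weight is 0 and the point is arbitrary. *)
  exists 0, point; split => // [A mA|]; last by rewrite mul0r.
  by rewrite mul0e; apply: null => // z _ kz; apply: none; exists z.
exists (fine (nu [set l0])), l0; split => [|A mA|]; last by rewrite kl0 mulr0.
  exact/fine_ge0/measure_ge0.
have m0 := measurable_point l0; rewrite fineK ?fin_num_measure // diracE.
have nD : nu (A `\` [set l0]) = 0%E.
  apply: null; first exact: measurableD.
  by move=> z [_ zl0] kz; apply: zl0; exact: k1_zero_unique.
have -> : nu A = (nu (A `&` [set l0]) + nu (A `\` [set l0]))%E by rewrite addeC -measureDI.
rewrite nD adde0; have [Al|Al] := pselect (A l0).
  rewrite (mem_set Al) mule1; congr (nu _); apply/seteqP; split => [z []//|z ->//].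
rewrite (memNset Al) mule0 (_ : _ `&` _ = set0) ?measure0 //.
by apply/seteqP; split => [z [Az zl]|//]; apply: Al; rewrite -zl.
Qed.

End NecessaryConditions.

End BoundaryData.

(** * Quadratic maps and the class H^n *)

Section QuadraticMaps.
Variables (R : realType) (n : nat).
Notation C := R[i]^o.
Notation T := (borelType (circle R)).
Notation zv := (@circle_val R).

Definition hvec (a : 'I_n -> R[i]) (b : 'I_n -> R) (z : C) : 'rV[R[i]]_n :=
  \row_j hpol (a j) (b j) z.

Lemma hvec_differentiable a b (z : C) : differentiable (hvec a b) z.
Proof.
pose u : 'rV[R[i]]_n := \row_j (a j)^*%C; pose v : 'rV[R[i]]_n := \row_j (b j)%:C.
pose w : 'rV[R[i]]_n := \row_j a j.
rewrite (_ : hvec a b = (fun z : C => u + z *: v + (z * z) *: w)); last first.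
  by apply/funext => x; apply/rowP => j; rewrite !mxE /hpol; ring.
have d1 : differentiable (fun z : C => u + z *: v) z by exact: line_differentiable.
apply: (differentiableD d1); apply: (@differentiableZl _ _ _ (fun z : C => z * z : C)).
exact: differentiableM.
Qed.

Lemma hvec_H a b : H_ R n (hvec a b).
Proof.
split; first by split=> // z _; exact: hvec_differentiable.
by move=> l j; rewrite mxE kpol_hpol; apply/complex_realP; exists (kpol (a j) (b j) l).
Qed.

Lemma conj_mulE (h : C -> 'rV[R[i]]_n) a b (l : T) :
  (forall j, h (zv l) 0 j = hpol (a j) (b j) (zv l)) ->
  conj_mul h l = \row_j kpol (a j) (b j) l.
Proof.
by move=> hE; apply/rowP => j; rewrite /conj_mul !mxE hE kpol_hpol.
Qed.

Lemma H_hpol (h : C -> 'rV[R[i]]_n) : H_ R n h -> exists b : 'I_n -> R,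
  forall l, cabs l <= 1 -> forall j, h l 0 j = hpol (h 0 0 j)^*%C (b j) l.
Proof.
move=> [[_ dh] hr].
have H j : exists b : R, forall l, cabs l <= 1 -> h l 0 j = hpol (h 0 0 j)^*%C b l.
  apply: (@entire_hpol R (fun z : C => h z 0 j)) => [z|z]; last exact: hr.
  have dz := dh z I.
  apply: (@differentiable_comp _ _ _ _ h (fun x : 'rV[R[i]]_n => x 0 j : C)) => //.
  exact: differentiable_coord.
by have /choice[b Hb] := H; exists b => l l1 j; exact: Hb.
Qed.

End QuadraticMaps.

Theorem corollary3p9 (R : realType) (D : set 'rV[R[i]]_2)
    (hD : is_convex_tube_domain D)
    (hW : closure (W_ D) = [set v : 'rV[R]_2 | v 0 1 <= 0])
    (phi : R[i]^o -> 'rV[R[i]]_2)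
    (mu : 'I_2 -> {charge set (borelType (circle R)) -> \bar R})
    (hphi : M_ R 2 phi) (hmu : boundary_measure phi mu)
    (g : borelType (circle R) -> borelType 'rV[R]_2)
    (rho : borelType (circle R) -> borelType 'rV[R]_2)
    (nu : {finite_measure set (borelType (circle R)) -> \bar R})
    (hg : measurable_fun setT g)
    (hgL1 : forall j : 'I_2,
      (arc_length R).-integrable setT (fun z => (g z 0 j)%:E))
    (hrho : measurable_fun setT rho)
    (hrhoS : forall z, sphere R 2 (rho z))
    (hnu : mutually_singular (arc_length R) nu)
    (hdec : forall (j : 'I_2) (A : set (borelType (circle R))), measurable A ->
      mu j A = (\int[arc_length R]_(z in A) (g z 0 j)%:E
                + \int[nu]_(z in A) (rho z 0 j)%:E)%E) :
  (phi @` disc R `<=` D /\ complex_geodesic D phi) <->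
  exists h : R[i]^o -> 'rV[R[i]]_2,
    H_ R 2 h /\ (exists z, h z != 0) /\
    [/\ (exists2 k, Hplus R 1 k & component h 1 = (fun z => - k z)),
        (\forall l \ae (arc_length R), P_ D (conj_mul h l) (g l)),
        (\forall l \ae nu, rho l = e2 R),
        ReD D (Re_vec (phi 0))
      & (exists z, h z 0 1 != 0) ->
          exists (alpha : R) (l0 : borelType (circle R)),
            [/\ 0 <= alpha,
                (forall A : set (borelType (circle R)), measurable A ->
                  nu A = alpha%:E * \d_l0 A)%E
              & alpha%:C * h (circle_val l0) 0 1 = 0]].
Proof.
have disc1 := @cabs_disc R.
have z1 : cabs 0 < 1 :> R by rewrite cabs0 ltr01.
have [[_ dphi] _] := hphi; have [_ _ _ DE] := tubeE hD.
split=> [[_ [[phiD _] [f [fD df] fphi]]]|[h [hH [_ [_ hP hRho hR hv]]]]].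
  have phiD' l : cabs l < 1 -> D (phi l) by move=> l1; apply: phiD; exact/disc1.
  have dphi' (l : R[i]^o) : cabs l < 1 -> differentiable phi l by move=> l1; apply: dphi; exact/disc1.
  have dphic := differentiable_phi hphi.
  have f1 z : D z -> cabs (f z) <= 1 by move=> Dz; have /disc1/ltW := fD z Dz.
  have fphi' l : cabs l < 1 -> f (phi l) = l by move=> l1; apply: fphi; exact/disc1.
  have [a [b [a0 hineq]]] := necessary_hpol hD dphi' dphic phiD' df f1 fphi'.
  have Pae := P_ae hD hmu hgL1 hrho hrhoS hdec hnu phiD' a0 hineq.
  have k1 := k1_le0 hD hW hmu hgL1 hrho hrhoS hdec hnu phiD' a0 hineq.
  exists (hvec a b); split; first exact: hvec_H.
  split.
    have [j aj] := a0; exists 0; apply/eqP => /rowP/(_ j); rewrite !mxE /hpol expr0n !mulr0 !addr0.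
    by move=> /eqP; rewrite -cabs_eq0 cabsJ cabs_eq0; apply/negP.
  split.
  - exists (fun z => - component (hvec a b) 1 z); last by apply/funext => z; rewrite opprK.
    have cE : component (hvec a b) 1 = hvec (fun _ : 'I_1 => a 1) (fun=> b 1).
      by apply/funext => z; apply/rowP => j; rewrite !mxE.
    rewrite cE; split.
      by split=> // z _; apply: differentiableN; exact: hvec_differentiable.
    move=> l j; rewrite !mxE mulrN kpol_hpol -rmorphN /= lecR oppr_ge0; exact: k1.
  - apply: filterS Pae => z [gz Hz]; split=> // x /Hz.
    by rewrite (@conj_mulE _ _ _ a b) // => j; rewrite mxE.
  - exact: (rho_e2 hD hW hmu hgL1 hrho hrhoS hdec hnu phiD').
  - by apply/DE; exact: phiD'.
  move=> [z hz]; have ab : (a 1 != 0) || (b 1 != 0).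
    rewrite -negb_and; apply: contra hz => /andP[/eqP a10 /eqP b10].
    by rewrite mxE a10 b10 /hpol !(rmorph0, conjc0, mul0r, addr0).
  have [alpha [l0 [al0 nuE kl0]]] :=
    nu_dirac hD hW hmu hgL1 hrho hrhoS hdec hnu phiD' a0 hineq ab.
  exists alpha, l0; split => //; rewrite mxE.
  have c0 : (circle_val l0)^*%C != 0 by rewrite -cabs_gt0 cabsJ cabs_circle.
  by apply: (mulfI c0); rewrite mulr0 mulrCA kpol_hpol -rmorphM /= kl0.
have [b hE] := H_hpol hH; pose a j := (h 0 0 j)^*%C.
have kE l : conj_mul h l = \row_j kpol (a j) (b j) l.
  by apply: conj_mulE => j; apply: hE; rewrite cabs_circle.
have hP' : \forall z \ae arc_length R, closure (ReD D) (g z) /\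
    forall x, ReD D x -> dot (x - g z) (\row_j kpol (a j) (b j) z) < 0.
  have [N [mN N0 HN]] := hP; exists N; split => // z Hz.
  apply: HN => Pz; apply: Hz; have : P_ D (conj_mul h z) (g z) := Pz.
  by rewrite kE.
(* Either h_2 vanishes identically, or by (v) nu is alpha times a Dirac mass with alpha = 0 or h_2 =
   0 at its point; in each case the set where k_2 is nonzero is null for nu. *)
have hk : \forall z \ae nu, kpol (a 1) (b 1) z = 0.
  have kh z : h (circle_val z) 0 1 = 0 -> kpol (a 1) (b 1) z = 0.
    move=> h0; have := congr1 (fun v : 'rV[R]_2 => v 0 1) (kE z).
    by rewrite !mxE h0 mulr0.
  have [hn|h0] := pselect (exists z, h z 0 1 != 0); last first.
    apply: aeW => z; apply: kh; apply/eqP/negPn/negP => hz; apply: h0; by exists (circle_val z).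
  have [alpha [l0 [al0 nuE hl0]]] := hv hn.
  have [mk _] := bmeas_kpol (a 1) (b 1).
  have mA : measurable [set z | kpol (a 1) (b 1) z <> 0].
    rewrite (_ : [set _ | _] = ~` (kpol (a 1) (b 1) @^-1` [set 0])) //.
    by apply: measurableC; rewrite -[X in measurable X]setTI; exact: mk.
  exists [set z | kpol (a 1) (b 1) z <> 0]; split => //.
  rewrite nuE // diracE; have [->|al] := eqVneq alpha 0; first by rewrite mul0e.
  rewrite memNset ?mule0 //= => kl; apply: kl; apply: kh.
  by move: hl0 => /eqP; rewrite mulf_eq0 -cabs_eq0 cabs_real normr_eq0 (negbTE al) => /eqP.
have phiD := phi_tube hD hW hmu hgL1 hrho hrhoS hdec hP' hRho hR.
have [f fD fphi] := data_left_inverse hD hW hphi hmu hgL1 hrho hrhoS hdec hP' hRho hR hk.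
split; first by move=> _ [l /disc1 l1 <-]; exact: phiD.
split.
  by split=> l l1; [apply: phiD; exact/disc1|exact: dphi].
exists f; last by move=> l /disc1; exact: fphi.
by split=> z /fD[fz f1] //; exact/disc1.
Qed.
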